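(* Let $V:\mathbb{R}^m\to\mathbb{R}$ be a potential, let $\lambda_i>0$, $i=1,2,\dots$, be arbitrary scaling constants, and for each $d\ge1$ consider the MCMC algorithm to sample from the product target $\propto\prod_{i=1}^d\exp(-V(q_i/\lambda_i))$ on $\mathbb{R}^{dm}$ based on an equivariant, volume preserving and reversible integrator for the Hamiltonian equations of the (preconditioned) Hamiltonian function $$\mathcal{H}^M(Q,P)=\frac12\sum_{i=1}^d\|\lambda_ip_i\|^2+\sum_{i=1}^dV(q_i/\lambda_i).$$ Assume that the integrator, when applied with unit mass matrix to the potential $V$ in $\mathbb{R}^m$, satisfies Conditions 1 and 2 (stated in the context), with exponent $\nu>0$ and leading coefficient $\alpha(q,p)$. Choose $h_d=\ell/d^{1/(2\nu)}$ for some constant $\ell>0$. Then, at stationarity (that is, when $(Q,P)$ has density $\propto\exp(-\mathcal{H}^M(Q,P))$), the expectation of the acceptance probability $\min(1,\exp(-\Delta_d^M(Q,P,h_d)))$ converges, as $d\to\infty$, to $$A=2\,\Phi\left(-\frac{\ell^\nu\sqrt{\Sigma}}{2}\right),$$ where $\Phi$ is the cumulative distribution function of $N(0,1)$ and $\Sigma=\mathbb{E}(\alpha(q,p)^2)$, the last expectation being taken with respect to the density $\propto\exp(-H(q,p))$ on $\mathbb{R}^m\times\mathbb{R}^m$, $H(q,p)=\frac12\|p\|^2+V(q)$.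
   Context: $\|\cdot\|$ is the Euclidean norm. $V:\mathbb{R}^m\to\mathbb{R}$ is a differentiable function with $\exp(-V)$ integrable; $H(q,p)=\frac12\|p\|^2+V(q)$ on $\mathbb{R}^m\times\mathbb{R}^m$, with Hamiltonian equations (unit mass matrix) $\dot q=p$, $\dot p=-\nabla V(q)$. Integrator (unit mass matrix): a family of maps $\psi_h:\mathbb{R}^m\times\mathbb{R}^m\to\mathbb{R}^m\times\mathbb{R}^m$, $h>0$, such that for some $\eta\ge 0$ and every solution $(q(t),p(t))$ of the Hamiltonian equations, $\psi_h(q(0),p(0))-(q(h),p(h))=o(h^\eta)$ as $h\to0$. Write $(q^\star,p^\star)=\psi_h(q,p)$. Volume preserving: $|\det\psi_h'(q,p)|=1$ for all $(q,p)$, where $\psi_h'$ is the Jacobian matrix. Reversible: for all $(q,p)$, $\psi_h(q,p)=(q^\star,p^\star)\Leftrightarrow\psi_h(q^\star,-p^\star)=(q,-p)$. Energy error: $\Delta(q,p,h)=H(\psi_h(q,p))-H(q,p)$. Condition 1: there exist real functions $\alpha(q,p)$, $\rho(q,p,h)$ and a constant $\nu>0$ such that $\Delta(q,p,h)=h^\nu\alpha(q,p)+h^\nu\rho(q,p,h)$ with $\lim_{h\to0}\rho(q,p,h)=0$ for each $(q,p)$. Condition 2: there exists a real function $D(q,p)$, integrable with respect to the probability density $\propto\exp(-H(q,p))$, such that $\sup_{0<h\le1}|\Delta(q,p,h)|^3/h^{3\nu}\le D(q,p)$. Preconditioning and equivariance: for $\lambda>0$, the potential $V(q/\lambda)$ is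 combined with mass matrix $M=\lambda^{-2}I_m$, giving the Hamiltonian $H^{M}(q,p)=\frac12\|\lambda p\|^2+V(q/\lambda)$ with equations $\dot q=\lambda^2p$, $\dot p=-\frac1\lambda\nabla V(q/\lambda)$. The change of variables $\bar q=q/\lambda$, $\bar p=\lambda p$ transforms these into the unit-mass equations for $V$. Equivariance of the integrator means that rescaling variables and applying the integrator commute; here this says that the integrator $\psi_h^{M}$ for $H^{M}$ satisfies $(q^\star,p^\star)=\psi^{M}_h(q,p)\Leftrightarrow(q^\star/\lambda,\lambda p^\star)=\psi_h(q/\lambda,\lambda p)$. Product setting: for $d\ge1$ write $Q=(q_1,\dots,q_d)$, $P=(p_1,\dots,p_d)$ with $q_i,p_i\in\mathbb{R}^m$. The integrator for $\mathcal{H}^M$ acts componentwise: $(q_i^\star,p_i^\star)$ is the result of applying to $(q_i,p_i)$ the integrator $\psi_h^{M}$ with $\lambda=\lambda_i$, $M=\lambda_i^{-2}I_m$. The energy error is $\Delta_d^M(Q,P,h)=\mathcal{H}^M(Q^\star,P^\star)-\mathcal{H}^M(Q,P)$. In the MCMC algorithm, given the current state $Q$, one draws independent $p_i\sim N(0,\lambda_i^{-2}I_m)$, computes $(Q^\star,P^\star)$, and accepts $Q^\star$ with probability $\min(1,\exp(-\Delta_d^M(Q,P,h)))$. *)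

(* Defs.v *)
From HB Require Import structures.
From mathcomp Require Import all_boot all_order all_algebra.
From mathcomp Require Import all_classical all_reals all_analysis.

Set Implicit Arguments.
Unset Strict Implicit.
Unset Printing Implicit Defensive.

Import Order.TTheory GRing.Theory Num.Theory.
Import numFieldNormedType.Exports.

Local Open Scope classical_set_scope.
Local Open Scope ring_scope.

(* The n-fold product of a sigma-finite measure on T, as a measure on
   n.-tuple T; power_measureE gives its values on boxes. *)
Section power_measure.
Context d (T : measurableType d) (R : realType).
Local Open Scope ereal_scope.

Definition tcons n (x : T * n.-tuple T) : n.+1.-tuple T :=
  [tuple of x.1 :: x.2].

Lemma measurable_tcons n : measurable_fun [set: T * n.-tuple T] (@tcons n).
Proof. exact: (measurable_cons measurable_fst measurable_snd). Qed.

Lemma tcons_preimage n (A : 'I_n.+1 -> set T) :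
  @tcons n @^-1` [set t | forall i, A i (tnth t i)] =
  A ord0 `*` [set t | forall i, A (lift ord0 i) (tnth t i)].
Proof.
apply/seteqP; split=> -[x t] /=.
  move=> h; split=> [|i]; first by have := h ord0; rewrite tnth0.
  by have := h (lift ord0 i); rewrite tnthS.
by move=> [h0 h] i; case: (unliftP ord0 i) => [j|] ->; rewrite ?tnthS ?tnth0.
Qed.

Lemma measurable_box n (A : 'I_n -> set T) : (forall i, measurable (A i)) ->
  measurable [set t : n.-tuple T | forall i, A i (tnth t i)].
Proof.
move=> mA.
rewrite (_ : [set _ | _] = \bigcap_(i in [set: 'I_n]) ((@tnth n T)^~ i @^-1` A i)).
  by apply: fin_bigcap_measurable => // i _; rewrite -[X in measurable X]setTI;
    exact: measurable_tnth.
by apply/seteqP; split=> t /= h i => [_|]; exact: h.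
Qed.

Context (mu : {sigma_finite_measure set T -> \bar R}).

Section power_measureS.
Context n (nu : {sigma_finite_measure set (n.-tuple T) -> \bar R}).

Definition power_measureS : set (n.+1.-tuple T) -> \bar R :=
  pushforward (mu \x nu) (@tcons n).

Let mtcons A : measurable A -> measurable (@tcons n @^-1` A).
Proof. by move=> mA; rewrite -[X in measurable X]setTI; exact: measurable_tcons. Qed.

Let power_measureS0 : power_measureS set0 = 0.
Proof. by rewrite /power_measureS /pushforward preimage_set0 measure0. Qed.

Let power_measureS_ge0 A : 0 <= power_measureS A.
Proof. by rewrite /power_measureS /pushforward; exact: measure_ge0. Qed.

Let power_measureS_sigma_additive : semi_sigma_additive power_measureS.
Proof.
move=> F mF tF mUF; rewrite /power_measureS /pushforward preimage_bigcup.
apply: measure_semi_sigma_additive.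
- by move=> k; exact: mtcons.
- apply/trivIsetP => /= i j _ _ ij; rewrite -preimage_setI.
  by move/trivIsetP : tF => /(_ _ _ _ _ ij) ->//; rewrite preimage_set0.
- by rewrite -preimage_bigcup; exact: mtcons.
Qed.

HB.instance Definition _ := isMeasure.Build _ _ _ power_measureS
  power_measureS0 power_measureS_ge0 power_measureS_sigma_additive.

Let power_measureS_sigma_finite : sigma_finite setT power_measureS.
Proof.
have /sigma_finiteP[F [TF ndF Foo]] := sigma_finiteT mu.
have /sigma_finiteP[G [TG ndG Goo]] := sigma_finiteT nu.
pose u (t : n.+1.-tuple T) := (thead t, [tuple of behead t]).
have tK : cancel (@tcons n) u by move=> [x t]; congr pair; apply: val_inj.
have mu' : measurable_fun setT u.
  apply/measurable_fun_pairP; split => /=.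
    exact: measurable_tnth.
  exact: measurable_behead.
exists (fun k => u @^-1` (F k `*` G k)).
  rewrite -preimage_bigcup; apply/esym/seteqP; split=> // t _.
  have [i _ Fi] : (\bigcup_i F i) (thead t) by rewrite -TF.
  have [j _ Gj] : (\bigcup_i G i) [tuple of behead t] by rewrite -TG.
  exists (maxn i j) => //; split => /=.
  - by move: Fi; exact/subsetPset/ndF/leq_maxl.
  - by move: Gj; exact/subsetPset/ndG/leq_maxr.
move=> k; have [mF Fk] := Foo k; have [mG Gk] := Goo k; split.
  by rewrite -[X in measurable X]setTI; apply: mu' => //; exact: measurableX.
rewrite /power_measureS /pushforward -comp_preimage.
rewrite (_ : u \o _ = id); last by apply/funext => x /=; rewrite tK.
by rewrite preimage_id product_measure1E// lte_mul_pinfty// ge0_fin_numE.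
Qed.

HB.instance Definition _ := Measure_isSigmaFinite.Build _ _ _ power_measureS
  power_measureS_sigma_finite.

End power_measureS.

Fixpoint power_measure n : {sigma_finite_measure set (n.-tuple T) -> \bar R} :=
  match n with
  | 0 => \d_[tuple]
  | n'.+1 => power_measureS (power_measure n')
  end.

Lemma power_measureE n (A : 'I_n -> set T) : (forall i, measurable (A i)) ->
  power_measure n [set t | forall i, A i (tnth t i)] = \prod_(i < n) mu (A i).
Proof.
elim: n A => [|n IH] A mA.
  by rewrite big_ord0 /= diracE mem_set// => -[].
rewrite big_ord_recl -IH//= /power_measureS /pushforward tcons_preimage.
rewrite product_measure1E//.
by apply: (@measurable_box n (fun i => A (lift ord0 i))) => i; exact: mA.
Qed.

End power_measure.


(* The Borel sigma-algebra of row vectors, generated by the coordinates. *)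
Section rV_measurable.
Context d (T : measurableType d) (n : nat).

Definition tuple_of_rV (v : 'rV[T]_n) : n.-tuple T := [tuple v ord0 i | i < n].

Definition rV_of_tuple (t : n.-tuple T) : 'rV[T]_n := \row_i tnth t i.

Let rV0 : g_sigma_algebra_preimage tuple_of_rV set0.
Proof. exact: (@measurable0 _ (g_sigma_algebra_preimageType tuple_of_rV)). Qed.

Let rVC A : g_sigma_algebra_preimage tuple_of_rV A ->
  g_sigma_algebra_preimage tuple_of_rV (~` A).
Proof. exact: (@measurableC _ (g_sigma_algebra_preimageType tuple_of_rV)). Qed.

Let rV_bigcup (F : (set 'rV[T]_n)^nat) :
  (forall i, g_sigma_algebra_preimage tuple_of_rV (F i)) ->
  g_sigma_algebra_preimage tuple_of_rV (\bigcup_i F i).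
Proof.
exact: (@bigcupT_measurable _ (g_sigma_algebra_preimageType tuple_of_rV)).
Qed.

HB.instance Definition _ := @isMeasurable.Build (measure_tuple_display d)
  'rV[T]_n (g_sigma_algebra_preimage tuple_of_rV) rV0 rVC rV_bigcup.

Lemma measurable_rV_of_tuple : measurable_fun setT rV_of_tuple.
Proof.
move=> _ _ [B mB <-]; rewrite !setTI -comp_preimage.
rewrite (_ : _ \o _ = id)//; apply/funext => t; apply: eq_from_tnth => i /=.
by rewrite tnth_mktuple mxE.
Qed.

End rV_measurable.

Section lebesgue_rV.
Context {R : realType} (n : nat).
Local Open Scope ereal_scope.

Definition lebesgue_rV : set 'rV[R]_n -> \bar R :=
  pushforward (power_measure (@lebesgue_measure R) n) (@rV_of_tuple _ R n).

Let mrV (A : set 'rV[R]_n) : measurable A ->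
  measurable ((@rV_of_tuple _ R n : n.-tuple (measurableTypeR R) -> _) @^-1` A).
Proof.
by move=> mA; rewrite -[X in measurable X]setTI; exact: measurable_rV_of_tuple.
Qed.

Let lebesgue_rV0 : lebesgue_rV set0 = 0.
Proof. by rewrite /lebesgue_rV /pushforward preimage_set0 measure0. Qed.

Let lebesgue_rV_ge0 A : 0 <= lebesgue_rV A.
Proof. by rewrite /lebesgue_rV /pushforward; exact: measure_ge0. Qed.

Let lebesgue_rV_sigma_additive : semi_sigma_additive lebesgue_rV.
Proof.
move=> F mF tF mUF; rewrite /lebesgue_rV /pushforward preimage_bigcup.
apply: measure_semi_sigma_additive.
- by move=> k; exact: mrV.
- apply/trivIsetP => /= i j _ _ ij; rewrite -preimage_setI.
  by move/trivIsetP : tF => /(_ _ _ _ _ ij) ->//; rewrite preimage_set0.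
- by rewrite -preimage_bigcup; exact: mrV.
Qed.

HB.instance Definition _ := isMeasure.Build _ _ _ lebesgue_rV
  lebesgue_rV0 lebesgue_rV_ge0 lebesgue_rV_sigma_additive.

Let rV_of_tupleK : cancel (@rV_of_tuple _ R n) (@tuple_of_rV _ R n).
Proof.
by move=> t; apply: eq_from_tnth => i; rewrite tnth_mktuple mxE.
Qed.

Let lebesgue_rV_sigma_finite : sigma_finite setT lebesgue_rV.
Proof.
have [F TF Foo] := sigma_finiteT (power_measure (@lebesgue_measure R) n).
exists (fun k => @tuple_of_rV _ R n @^-1` F k).
  by rewrite -preimage_bigcup -TF preimage_setT.
move=> k; have [mF Fk] := Foo k; split.
  by exists (F k) => //; rewrite setTI.
rewrite /lebesgue_rV /pushforward -comp_preimage.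
by rewrite (_ : _ \o _ = id)//; apply/funext => x /=; rewrite rV_of_tupleK.
Qed.

HB.instance Definition _ := Measure_isSigmaFinite.Build _ _ _ lebesgue_rV
  lebesgue_rV_sigma_finite.

Lemma lebesgue_rVE (A : 'I_n -> set R) : (forall i, measurable (A i)) ->
  lebesgue_rV [set v | forall i, A i (v ord0 i)] =
  \prod_(i < n) lebesgue_measure (A i).
Proof.
move=> mA; rewrite -power_measureE// /lebesgue_rV /pushforward.
congr (power_measure _ _ _); apply/seteqP.
by split=> t /= h i; have := h i; rewrite mxE.
Qed.

End lebesgue_rV.
Arguments lebesgue_rV {R} n _.

(* Expectations for the probability density proportional to exp (- U) with
   respect to mu. *)
Section gibbs.
Context d (T : measurableType d) (R : realType).
Variables (mu : set T -> \bar R) (U : T -> R).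

Definition partition_function : R := fine (\int[mu]_x (expR (- U x))%:E).

Definition gibbs_pdf (x : T) : R := expR (- U x) / partition_function.

Definition gibbs_mean (f : T -> R) : \bar R :=
  \int[mu]_x (f x * gibbs_pdf x)%:E.

Definition gibbs_integrable (f : T -> R) :=
  mu.-integrable setT (fun x => (f x * gibbs_pdf x)%:E).

End gibbs.

Section hamiltonian.
Context {R : realType} {m : nat}.
Implicit Types (V : 'rV[R]_m -> R)
  (psi : R -> 'rV[R]_m * 'rV[R]_m -> 'rV[R]_m * 'rV[R]_m).

(* The norm of 'rV[R]_m in the library is the supremum norm. *)
Definition enorm (v : 'rV[R]_m) : R := Num.sqrt (\sum_(i < m) v ord0 i ^+ 2).

Definition grad V (q : 'rV[R]_m) : 'rV[R]_m :=
  \row_(j < m) 'D_(delta_mx ord0 j) V q.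

Definition hamiltonian V (z : 'rV[R]_m * 'rV[R]_m) : R :=
  2^-1 * enorm z.2 ^+ 2 + V z.1.

Definition hamiltonian_solution V (a b : R) (q p : R -> 'rV[R]_m) :=
  forall t, a < t < b -> is_derive t (1 : R) q (p t) /\
                         is_derive t (1 : R) p (- grad V (q t)).

(* Only the values of psi h for 0 < h are meaningful; a solution lives on an
   open interval around 0, since V need not admit global solutions. *)
Definition integrator V psi := exists2 eta : R, 0 <= eta &
  forall (a b : R) (q p : R -> 'rV[R]_m), a < 0 < b ->
    hamiltonian_solution V a b q p ->
    (fun h => psi h (q 0, p 0) - (q h, p h)) =o_ (0^'+) (fun h => h `^ eta).

(* A map of R^m * R^m read on R^(m + m), where the library has Jacobians. *)
Definition phase_map (f : 'rV[R]_m * 'rV[R]_m -> 'rV[R]_m * 'rV[R]_m)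
    (v : 'rV[R]_(m + m)) : 'rV[R]_(m + m) :=
  let w := f (lsubmx v, rsubmx v) in row_mx w.1 w.2.

Definition volume_preserving psi :=
  forall (h : R) (v : 'rV[R]_(m + m)), 0 < h ->
  differentiable (phase_map (psi h)) v /\
    `|\det ('J (phase_map (psi h)) v)| = 1.

Definition reversible psi := forall (h : R) (q p q' p' : 'rV[R]_m), 0 < h ->
  psi h (q, p) = (q', p') <-> psi h (q', - p') = (q, - p).

Definition energy_error V psi (z : 'rV[R]_m * 'rV[R]_m) (h : R) : R :=
  hamiltonian V (psi h z) - hamiltonian V z.

Definition condition1 V psi (nu : R) (alpha : 'rV[R]_m * 'rV[R]_m -> R) :=
  exists2 rho : 'rV[R]_m * 'rV[R]_m -> R -> R,
    forall z h, 0 < h ->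
      energy_error V psi z h = h `^ nu * alpha z + h `^ nu * rho z h &
    forall z, rho z h @[h --> 0^'+] --> (0 : R).

Definition lebesgue_phase : set ('rV[R]_m * 'rV[R]_m) -> \bar R :=
  (lebesgue_rV m \x lebesgue_rV m)%E.

Definition condition2 V psi (nu : R) :=
  exists2 D : 'rV[R]_m * 'rV[R]_m -> R,
    gibbs_integrable lebesgue_phase (hamiltonian V) D &
    forall z, (ereal_sup [set (`|energy_error V psi z h| ^+ 3 / h `^ (3 * nu))%:E
                         | h in `]0%R, 1%R]] <= (D z)%:E)%E.

(* psiM lambda is the integrator for the potential V (q / lambda) and the mass
   matrix lambda ^- 2 I. *)
Definition equivariant
    (psiM : R -> R -> 'rV[R]_m * 'rV[R]_m -> 'rV[R]_m * 'rV[R]_m) psi :=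
  forall (lambda h : R) (q p q' p' : 'rV[R]_m), 0 < lambda -> 0 < h ->
    (q', p') = psiM lambda h (q, p) <->
    (lambda^-1 *: q', lambda *: p') = psi h (lambda^-1 *: q, lambda *: p).

End hamiltonian.

Section product.
Context {R : realType} {m : nat}.
Variables (V : 'rV[R]_m -> R) (lambda : nat -> R)
  (psiM : R -> R -> 'rV[R]_m * 'rV[R]_m -> 'rV[R]_m * 'rV[R]_m) (d : nat).

Local Notation state := (d.-tuple 'rV[R]_m * d.-tuple 'rV[R]_m)%type.

Definition lebesgue_state : set state -> \bar R :=
  (power_measure (lebesgue_rV m) d \x power_measure (lebesgue_rV m) d)%E.

Definition product_hamiltonian (z : state) : R :=
  2^-1 * (\sum_(i < d) enorm (lambda i *: tnth z.2 i) ^+ 2) +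
  \sum_(i < d) V ((lambda i)^-1 *: tnth z.1 i).

Definition product_integrator (h : R) (z : state) : state :=
  ([tuple (psiM (lambda i) h (tnth z.1 i, tnth z.2 i)).1 | i < d],
   [tuple (psiM (lambda i) h (tnth z.1 i, tnth z.2 i)).2 | i < d]).

Definition product_energy_error (z : state) (h : R) : R :=
  product_hamiltonian (product_integrator h z) - product_hamiltonian z.

Definition acceptance_probability (h : R) (z : state) : R :=
  Num.min 1 (expR (- product_energy_error z h)).

Definition mean_acceptance (h : R) : \bar R :=
  gibbs_mean lebesgue_state product_hamiltonian (acceptance_probability h).

End product.

(* Main.v *)
Require Import Defs.
From HB Require Import structures.
From mathcomp Require Import all_boot all_order all_algebra.
From mathcomp Require Import all_classical all_reals all_analysis.
From mathcomp Require Import perm measurable_realfun ring lra zify.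

Set Implicit Arguments.
Unset Strict Implicit.
Unset Printing Implicit Defensive.

Import Order.TTheory GRing.Theory Num.Theory.
Import numFieldNormedType.Exports.

Local Open Scope classical_set_scope.
Local Open Scope ring_scope.

(* By equivariance the rescaled state (q_i / lambda_i, lambda_i p_i) makes the
   total energy error a sum of d independent copies of X = energy_error V psi z h,
   with z distributed according to the Gibbs density of the unscaled problem.

   The momentum flip composed with psi h is a differentiable involution T with
   Jacobian determinant +-1.  Such a T preserves Lebesgue measure: near each point
   T is almost affine, so |T^-1 C| / |C| is close to 1 for small dyadic cells C, and
   bisection extends this to all cells.  Hence E g(X) = E (g(-X) e^(-X)), which
   gives E X = E X^2 / 2 up to O(E |X|^3).

   The acceptance probability min(1, e^(-x)) is replaced by its Gaussian smoothing
   u_t(x) = E min(1, e^(-N(x + t/2, t))), an explicit solution of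
   2 d_t u = u'' + u'.  Adding one particle therefore changes E u_t in the same way
   as increasing t by E X^2, up to O(E |X|^3 + (E X^2)^2), and d of these
   replacements lead from t = rho^2 to t = rho^2 + d E X^2 at the point 0, where
   u_t(0) = 2 Phi(- sqrt t / 2).  With h = l / d^(1 / (2 nu)) the total error vanishes
   and d E X^2 tends to l^(2 nu) Sigma by dominated convergence; then let rho -> 0. *)

(** * Dyadic cells *)

(** [psi h] is differentiable but need not be C^1, so its affine approximations have no locally
    uniform modulus. Bisection needs none: each point may have its own threshold. Since T is its own
    inverse, the differentials at x and at T x are inverse to each other, which yields both the
    upper and the lower estimate for |T^-1 C|.

    The Metropolis function has a kink at 0, so a second-order expansion requires smoothing first.
    The derivatives of u_t blow up as t tends to 0; hence the start at t = rho^2, with constants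
    depending on rho alone, and rho -> 0 only after d -> oo.

    The drift t / 2 of the Gaussian is dictated by E X = E X^2 / 2: the Taylor terms u' E X + u'' E
    X^2 / 2 then merge into (u' + u'') E X^2 / 2, which is the time increment of u. The Gaussian
    limit thus comes out of the heat equation, without a separate central limit theorem. As h^nu is
    of order d^(-1/2), the error per particle is O(d^(-3/2)) and the sum of the d errors is
    O(d^(-1/2)). *)

Lemma exists_invX2_lt (R : realType) (e : R) : 0 < e ->
  exists K, forall k, (K <= k)%N -> (2 ^+ k)^-1 < e.
Proof.
move=> e0; have : (2^-1 : R) ^+ k @[k --> \oo] --> 0.
  by apply: cvg_expr; rewrite ger0_norm ?invr_ge0// invf_lt1// ltr1n.
move=> /cvgrPdist_lt/(_ e e0)[K _ HK]; exists K => k /HK /=.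
by rewrite sub0r normrN exprVn ger0_norm// invr_ge0 exprn_ge0.
Qed.

Section dyadic_cells.
Context {R : realType} {n : nat}.
Implicit Types (v w x : 'rV[R]_n) (k l : nat).

Definition grid k v : {ffun 'I_n -> int} :=
  [ffun i => Num.floor (2 ^+ k * v ord0 i)].

Definition cell k v : set 'rV[R]_n := [set w | grid k w = grid k v].

Lemma grid_le k v i : (grid k v i)%:~R / 2 ^+ k <= v ord0 i.
Proof.
by rewrite ffunE ler_pdivrMr ?exprn_gt0// mulrC floor_le.
Qed.

Lemma grid_gt k v i : v ord0 i < ((grid k v i)%:~R + 1) / 2 ^+ k.
Proof.
by rewrite ffunE ltr_pdivlMr ?exprn_gt0// mulrC -(intrD _ _ 1) floorD1_gt.
Qed.

Lemma gridP k v w : (forall i, (grid k w i)%:~R / 2 ^+ k <= v ord0 i <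
  ((grid k w i)%:~R + 1) / 2 ^+ k) -> grid k v = grid k w.
Proof.
move=> H; apply/ffunP => i; have /andP[] := H i.
rewrite ler_pdivrMr ?exprn_gt0// ltr_pdivlMr ?exprn_gt0// [_ * 2 ^+ _]mulrC => H1 H2.
rewrite [LHS]ffunE; apply: floor_def.
by rewrite H1 intrD.
Qed.

Lemma cellE k v : cell k v =
  [set w | forall i, `[(grid k v i)%:~R / 2 ^+ k,
                       ((grid k v i)%:~R + 1) / 2 ^+ k[%classic (w ord0 i)].
Proof.
apply/seteqP; split => w /=.
  by move=> wv i; rewrite in_itv/= -wv grid_le grid_gt.
by move=> H; apply: gridP => i; have := H i; rewrite in_itv.
Qed.

Lemma cell_refl k v : cell k v v. Proof. by []. Qed.

Lemma cell_dist k v w x i : cell k v w -> cell k v x ->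
  `|w ord0 i - x ord0 i| <= (2 ^+ k)^-1.
Proof.
rewrite /cell/= => wv xv; have := grid_le k w i; have := grid_gt k w i.
have := grid_le k x i; have := grid_gt k x i; rewrite wv xv !mulrDl mul1r.
by move=> h1 h2 h3 h4; rewrite ler_norml; lra.
Qed.

Lemma grid_nested k l v w : (k <= l)%N -> grid l v = grid l w ->
  grid k v = grid k w.
Proof.
move=> kl /ffunP gl; apply/ffunP => i; rewrite !ffunE.
(* The level-l floor determines the level-k one: comparing an integer with the latter amounts to
   comparing its multiple by 2^(l-k) with the former. *)
have key (m : int) (t : R) : (m <= Num.floor (2 ^+ k * t)) =
    (m * 2 ^+ (l - k) <= Num.floor (2 ^+ l * t)).
  rewrite !floor_ge_int intrM rmorphXn/= -(subnK kl) exprD addnK -mulrA.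
  by rewrite [_ * 2 ^+ (l - k)]mulrC ler_pM2l// exprn_gt0.
apply/le_anti; rewrite key; have := gl i; rewrite !ffunE => <-.
by rewrite -key lexx/= key; have := gl i; rewrite !ffunE => ->; rewrite -key.
Qed.

Lemma measurable_rV_box (A : 'I_n -> set R) : (forall i, measurable (A i)) ->
  measurable [set v : 'rV[R]_n | forall i, A i (v ord0 i)].
Proof.
move=> mA; exists [set t | forall i, A i (tnth t i)]; first exact: measurable_box.
by rewrite setTI; apply/seteqP; split => v /= H i; have := H i; rewrite tnth_mktuple.
Qed.

Lemma measurable_cell k v : measurable (cell k v).
Proof.
rewrite cellE; apply: (@measurable_rV_box (fun i =>
  `[(grid k v i)%:~R / 2 ^+ k, ((grid k v i)%:~R + 1) / 2 ^+ k[%classic)).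
by [].
Qed.

Lemma lebesgue_cell k v : lebesgue_rV n (cell k v) = (((2 ^+ k)^-1) ^+ n)%:E.
Proof.
rewrite cellE (@lebesgue_rVE _ _ (fun i =>
  `[(grid k v i)%:~R / 2 ^+ k, ((grid k v i)%:~R + 1) / 2 ^+ k[%classic))//.
transitivity (\prod_(i < n) ((2 ^+ k)^-1 : R)%:E)%E.
  apply: eq_bigr => i _; rewrite lebesgue_measure_itv/= lte_fin.
  rewrite ltr_pM2r ?invr_gt0 ?exprn_gt0// ltrDl ltr01.
  by rewrite -EFinB mulrDl addrAC subrr add0r mul1r.
by rewrite prodEFin prodr_const card_ord.
Qed.

(** The empty set is included to make the family closed under intersection: two cells are nested or
    disjoint. *)
Definition cells : set (set 'rV[R]_n) :=
  [set A | A = set0 \/ exists k v, A = cell k v].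

Lemma cells_setI : setI_closed cells.
Proof.
suff H k l v w : (k <= l)%N -> cell k v `&` cell l w = set0 \/
    cell k v `&` cell l w = cell l w.
  move=> A B [->|[k [v ->]]]; first by rewrite set0I; left.
  move=> [->|[l [w ->]]]; first by rewrite setI0; left.
  case/orP: (leq_total k l) => kl.
    by case: (H _ _ v w kl) => ->; [left|right; exists l, w].
  by rewrite setIC; case: (H _ _ w v kl) => ->; [left|right; exists k, v].
move=> kl; case: (pselect (grid k w = grid k v)) => wv.
  right; apply/seteqP; split => x /=; first by case.
  by move=> xw; split => //; rewrite /cell/= -wv; apply: grid_nested xw.
left; apply/seteqP; split => x //= [xv xw]; apply: wv.
by rewrite -xv; apply/esym; apply: grid_nested xw.
Qed.

(** The cells of level k arranged in a sequence, as countable additivity requires; an index that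
    codes no occupied grid point gives the empty set. *)
Definition numbered_cell k (j : nat) : set 'rV[R]_n :=
  [set v | pickle (grid k v) = j].

Lemma numbered_cellP k j :
  numbered_cell k j = set0 \/ exists v, numbered_cell k j = cell k v.
Proof.
case: (pselect (exists v, numbered_cell k j v)) => [[v vj]|H].
  right; exists v; apply/seteqP; split => w /=; rewrite /numbered_cell/= -vj /cell/=.
    by move/(pcan_inj pickleK).
  by move=> ->.
by left; apply/seteqP; split => v // vj; apply: H; exists v.
Qed.

Lemma measurable_numbered_cell k j : measurable (numbered_cell k j).
Proof.
by case: (numbered_cellP k j) => [->|[v ->]] //; exact: measurable_cell.
Qed.

Lemma numbered_cell_cover k : \bigcup_j numbered_cell k j = setT.
Proof. by apply/seteqP; split => // v _; exists (pickle (grid k v)). Qed.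

Lemma trivIset_numbered_cell k : trivIset setT (numbered_cell k).
Proof. by move=> i j _ _ [v [<- <-]]. Qed.

(** For the inclusion from left to right, an open half-space is the union of the cells it contains,
    because cells shrink, and this union is countable. *)
Lemma measurable_cellsE : measurable = <<s cells >>.
Proof.
apply/seteqP; split; last first.
  apply: smallest_sub; first exact: sigma_algebra_measurable.
  by move=> A [->|[k [v ->]]] //; exact: measurable_cell.
pose S := g_sigma_algebraType cells.
have mc k v : @measurable _ S (cell k v).
  by apply: sub_sigma_algebra; right; exists k, v.
have mnc k j : @measurable _ S (numbered_cell k j).
  by case: (numbered_cellP k j) => [->|[v ->]] //; exact: measurable0.
suff mcoord i : measurable_fun [set: S] (fun v : 'rV[R]_n => v ord0 i).
  move=> A [B mB <-]; rewrite setTI.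
  have /(_ measurableT _ mB) : measurable_fun [set: S] (@tuple_of_rV _ R n : S -> n.-tuple R).
    apply/measurable_fun_tnthP => i; apply: eq_measurable_fun (mcoord i) => v _ /=.
    by rewrite tnth_mktuple.
  by rewrite setTI.
apply: (measurability (@RGenOInfty.G R)); first exact: RGenOInfty.measurableE.
move=> _ [_ [a ->] <-]; rewrite setTI.
rewrite (_ : _ @^-1` _ = \bigcup_k \bigcup_(j in
    [set j | numbered_cell k j `<=` (fun v => v ord0 i) @^-1` `]a, +oo[]) numbered_cell k j).
  apply: bigcupT_measurable => k; exact: bigcup_measurable.
apply/seteqP; split => v /=; last by move=> [k _ [j /= H /H]].
rewrite in_itv/= andbT => av.
have [k /(_ _ (leqnn k)) kv] : exists k, forall l, (k <= l)%N -> (2 ^+ l)^-1 < v ord0 i - a.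
  by apply: exists_invX2_lt; rewrite subr_gt0.
exists k => //; exists (pickle (grid k v)) => // w /= /(pcan_inj pickleK) wv.
rewrite in_itv/= andbT; have := @cell_dist k v w v i wv (cell_refl k v).
by rewrite ler_norml; lra.
Qed.

(** Uniqueness on a pi-system. The unit cells form a countable cover, so finiteness is asked of them
    only. *)
Lemma eq_measure_cells (mu1 mu2 : {measure set 'rV[R]_n -> \bar R}) :
  (forall k v, mu1 (cell k v) = mu2 (cell k v)) ->
  (forall v, (mu1 (cell 0 v) < +oo)%E) ->
  forall A, measurable A -> mu1 A = mu2 A.
Proof.
move=> H Hoo; apply: (measure_unique cells (numbered_cell 0)).
- exact: measurable_cellsE.
- exact: cells_setI.
- move=> i; case: (numbered_cellP 0 i) => [->|[v ->]]; first by left.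
  by right; exists 0%N, v.
- exact: numbered_cell_cover.
- by move=> A [->|[k [v ->]]]; rewrite ?measure0.
- by move=> j; case: (numbered_cellP 0 j) => [->|[v ->]]; rewrite ?measure0.
Qed.

Lemma measurable_open_rV (U : set 'rV[R]_n) : open U -> measurable U.
Proof.
move=> oU.
rewrite (_ : U = \bigcup_k \bigcup_(j in [set j | numbered_cell k j `<=` U])
  numbered_cell k j).
  apply: bigcupT_measurable => k; apply: bigcup_measurable => j _.
  exact: measurable_numbered_cell.
apply/seteqP; split => v /=; last by move=> [k _ [j /= H /H]].
move=> Uv; have /nbhs_ballP[e/= e0 He] : nbhs v U by exact: open_nbhs_nbhs.
have [k /(_ _ (leqnn k)) kv] := exists_invX2_lt e0.
exists k => //; exists (pickle (grid k v)) => // w /= /(pcan_inj pickleK) wv.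
apply: He; split => // i j; rewrite (ord1 i) /ball/=.
by apply: le_lt_trans kv; exact: (@cell_dist k v).
Qed.

Section bisection.
Variables (mu1 mu2 : {measure set 'rV[R]_n -> \bar R}) (c : R).
Local Open Scope ereal_scope.
Let good k v := mu1 (cell k v) <= c%:E * mu2 (cell k v).

(** If every child is good, summing over the children shows the parent good. The sum runs over all
    cells of the next level, those outside the parent contributing 0, which avoids enumerating the
    2^n children. *)
Let bad_step k v : ~ good k v -> exists w, ~ good k.+1 w /\ cell k v w.
Proof.
move=> bad; apply: contrapT => /forallNP H; apply: bad; rewrite /good.
have E (mu : {measure set 'rV[R]_n -> \bar R}) :
    mu (cell k v) = \sum_(0 <= j <oo) mu (cell k v `&` numbered_cell k.+1 j).
  rewrite -[X in mu X]setIT -(numbered_cell_cover k.+1) setI_bigcupr.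
  apply: measure_semi_bigcup.
  - by move=> j; apply: measurableI; [exact: measurable_cell|exact: measurable_numbered_cell].
  - by apply: trivIset_setIl; exact: trivIset_numbered_cell.
  - apply: bigcupT_measurable => j.
    by apply: measurableI; [exact: measurable_cell|exact: measurable_numbered_cell].
rewrite (E mu1) (E mu2) -nneseriesZl//; apply: lee_nneseries => // j _.
case: (numbered_cellP k.+1 j) => [->|[w ->]]; first by rewrite setI0 !measure0 mule0.
case: (pselect (cell k v w)) => kvw; last first.
  rewrite (_ : _ `&` _ = set0) ?measure0 ?mule0//; apply/seteqP; split => x //= [xv xw].
  by apply: kvw; rewrite /cell/= -xv; apply/esym; apply: grid_nested xw.
rewrite (_ : _ `&` _ = cell k.+1 w); last first.
  apply/seteqP; split => x /=; first by case.
  by move=> xw; split => //; rewrite /cell/= -kvw; apply: grid_nested xw.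
by have /not_andP[/contrapT//|] := H w.
Qed.

(* If some cell is bad, so is one of its children; the nested bad cells shrink
   to a point x, whose small enough neighbouring cells are assumed good. *)
Lemma cell_bisection :
  (forall x, exists K, forall k v, (K <= k)%N ->
     (forall w i, cell k v w -> (`|w ord0 i - x ord0 i| <= (2 ^+ k)^-1)%R) ->
     good k v) ->
  forall k v, good k v.
Proof.
move=> H k v; apply: contrapT => bad.
have /choice[f Hf] : forall p : nat * 'rV[R]_n, exists w, ~ good p.1 p.2 ->
    ~ good p.1.+1 w /\ cell p.1 p.2 w.
  move=> [l w]; case: (pselect (good l w)) => [g|b]; first by exists w.
  by have [w' ?] := bad_step b; exists w'.
pose fix xs j := if j is j'.+1 then f ((k + j')%N, xs j') else v.
have badxs j : ~ good (k + j)%N (xs j).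
  by elim: j => [|j IH]; rewrite ?addn0// addnS; have [] := Hf (_, _) IH.
have step j : cell (k + j)%N (xs j) (xs j.+1) by have [] := Hf (_, _) (badxs j).
have nest j m : cell (k + j)%N (xs j) (xs (j + m)%N).
  elim: m => [|m IH]; first by rewrite addn0.
  rewrite /cell/= -IH addnS; apply: (@grid_nested _ (k + (j + m))%N); last exact: step.
  by rewrite leq_add2l leq_addr.
pose lo j i : R := ((grid (k + j)%N (xs j) i)%:~R / 2 ^+ (k + j)%N)%R.
have lohi j m i : (lo j i <= lo m i + (2 ^+ (k + m)%N)^-1)%R.
  apply: le_trans (_ : xs (maxn j m) ord0 i <= _)%R.
    rewrite /lo -(nest j (maxn j m - j)%N) subnKC ?leq_maxl//; exact: grid_le.
  have := @grid_gt (k + m)%N (xs (maxn j m)) i.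
  by rewrite -[X in xs X](subnKC (leq_maxr j m)) (nest m) mulrDl mul1r => /ltW.
(* The limit of the lower corners. Cells are half-open, so x may lie only in their closures; this is
   why the hypothesis concerns cells within 2^-k of x and not cells containing x. *)
pose x : 'rV[R]_n := (\row_i sup [set lo j i | j in setT])%R.
have hs i : has_sup [set lo j i | j in setT].
  split; first by exists (lo 0%N i), 0%N.
  by exists (lo 0%N i + (2 ^+ (k + 0)%N)^-1)%R => _ [j _ <-]; exact: lohi.
have xlo j i : (lo j i <= x ord0 i)%R.
  by rewrite mxE; apply: sup_upper_bound; [exact: hs|exists j].
have xhi j i : (x ord0 i <= lo j i + (2 ^+ (k + j)%N)^-1)%R.
  rewrite mxE; apply: ge_sup; first by case: (hs i).
  by move=> _ [m _ <-]; exact: lohi.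
have [K HK] := H x.
apply: (badxs K); apply: HK; first exact: leq_addl.
move=> w i wc; have := grid_le (k + K)%N w i; have := grid_gt (k + K)%N w i.
rewrite wc mulrDl mul1r -/(lo K i) => h1 h2.
have := xlo K i; have := xhi K i; rewrite ler_norml.
by move: h1 h2; lra.
Qed.

End bisection.

End dyadic_cells.

(** * Measure-preserving maps *)

Lemma measurable_preimage d1 d2 (T1 : measurableType d1)
    (T2 : measurableType d2) (f : T1 -> T2) B : measurable_fun setT f ->
  measurable B -> measurable (f @^-1` B).
Proof. by move=> mf mB; rewrite -[X in measurable X]setTI; exact: mf. Qed.

Section measure_preserving.
Context {R : realType}.
Local Open Scope ereal_scope.

(** The measures are bare set functions, so that the notion applies directly to [lebesgue_phase] and
    [lebesgue_state], which are declared as such. *)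
Definition measure_preserving d1 d2 (T1 : measurableType d1)
    (T2 : measurableType d2) (mu : set T1 -> \bar R) (nu : set T2 -> \bar R)
    (f : T1 -> T2) :=
  measurable_fun setT f /\ forall B, measurable B -> mu (f @^-1` B) = nu B.

Section general.
Context d1 d2 d3 (T1 : measurableType d1) (T2 : measurableType d2)
  (T3 : measurableType d3).

Lemma measure_preserving_comp (mu1 : set T1 -> \bar R) (mu2 : set T2 -> \bar R)
    (mu3 : set T3 -> \bar R) (f : T1 -> T2) (g : T2 -> T3) :
  measure_preserving mu1 mu2 f -> measure_preserving mu2 mu3 g ->
  measure_preserving mu1 mu3 (g \o f).
Proof.
move=> [mf f12] [mg g23]; split; first exact: measurableT_comp.
by move=> B mB; rewrite comp_preimage f12 ?g23//; exact: measurable_preimage.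
Qed.

Lemma measure_preserving_inv (mu1 : set T1 -> \bar R) (mu2 : set T2 -> \bar R)
    (f : T1 -> T2) (g : T2 -> T1) : measurable_fun setT g -> cancel f g ->
  measure_preserving mu1 mu2 f -> measure_preserving mu2 mu1 g.
Proof.
move=> mg fK [mf f12]; split => // B mB.
rewrite -f12; last exact: measurable_preimage.
rewrite -comp_preimage (_ : g \o f = id)//.
by apply/funext => x /=; rewrite fK.
Qed.

Lemma ge0_integral_measure_preserving (mu1 : {measure set T1 -> \bar R})
    (mu2 : {measure set T2 -> \bar R}) (f : T1 -> T2) (F : T2 -> \bar R) :
  measure_preserving mu1 mu2 f -> measurable_fun setT F -> (forall y, 0 <= F y) ->
  \int[mu1]_x F (f x) = \int[mu2]_y F y.
Proof.
move=> [mf f12] mF F0.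
have := ge0_integral_pushforward mf mu1 measurableT mF (fun y _ => F0 y).
rewrite preimage_setT => <-.
by apply: eq_measure_integral => A mA _; exact: f12.
Qed.

End general.

Lemma eq_measure_preserving d1 d2 (T1 : measurableType d1) (T2 : measurableType d2)
    (mu1 : set T1 -> \bar R) (mu2 : set T2 -> \bar R) (f g : T1 -> T2) :
  f =1 g -> measure_preserving mu1 mu2 f -> measure_preserving mu1 mu2 g.
Proof. by move=> /funext ->. Qed.

Section product.
Context d1 d2 d3 d4 (T1 : measurableType d1) (T2 : measurableType d2)
  (T3 : measurableType d3) (T4 : measurableType d4).
Variables (m1 : {sigma_finite_measure set T1 -> \bar R})
  (m2 : {sigma_finite_measure set T2 -> \bar R})
  (m3 : {sigma_finite_measure set T3 -> \bar R})
  (m4 : {sigma_finite_measure set T4 -> \bar R}).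

Lemma measure_preserving_productP d (T : measurableType d)
    (mu : {measure set T -> \bar R}) (f : T -> T1 * T2) :
  measurable_fun setT f ->
  (forall A B, measurable A -> measurable B -> mu (f @^-1` (A `*` B)) = m1 A * m2 B) ->
  measure_preserving mu (m1 \x m2) f.
Proof.
move=> mf H; split => // B mB; apply/esym.
exact: (@product_measure_unique _ _ T1 T2 _ m1 m2 (pushforward mu f : {measure set _ -> \bar R})).
Qed.

Lemma measure_preserving_prod (f : T1 -> T3) (g : T2 -> T4) :
  measure_preserving m1 m3 f -> measure_preserving m2 m4 g ->
  measure_preserving (m1 \x m2) (m3 \x m4) (fun z => (f z.1, g z.2)).
Proof.
move=> [mf f13] [mg g24].
have mfg : measurable_fun setT (fun z : T1 * T2 => (f z.1, g z.2)).
  by apply: measurable_fun_pair; apply: measurableT_comp.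
split => // B mB; apply/esym.
apply: (@product_measure_unique _ _ T3 T4 _ m3 m4 (pushforward (m1 \x m2) (fun z : T1 * T2 => (f z.1, g z.2)) : {measure set _ -> \bar R})) => // A A' mA mA'.
rewrite /= /pushforward (_ : _ @^-1` _ = (f @^-1` A) `*` (g @^-1` A'))//.
rewrite product_measure1E; [|exact: measurable_preimage..].
by congr (_ * _); [exact: f13|exact: g24].
Qed.

(** The product measure integrates the measures of vertical sections, and the map acts on each
    section separately by some [g x]. *)
Lemma measure_preserving_shear (g : T1 -> T2 -> T2) :
  measurable_fun setT (fun z : T1 * T2 => g z.1 z.2) ->
  (forall x, measure_preserving m2 m2 (g x)) ->
  measure_preserving (m1 \x m2) (m1 \x m2) (fun z => (z.1, g z.1 z.2)).
Proof.
move=> mg g22.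
have mS : measurable_fun setT (fun z : T1 * T2 => (z.1, g z.1 z.2)).
  by apply: measurable_fun_pair.
split => // B mB; rewrite /product_measure1/=; apply: eq_integral => x _ /=.
have [_ /(_ _ (measurable_xsection x mB)) <-] := g22 x.
congr (m2 _); apply/seteqP; split => y /=;
  by rewrite /xsection/= !inE.
Qed.

End product.

Lemma measure_preserving_swap d1 d2 (T1 : measurableType d1) (T2 : measurableType d2)
    (m1 : {sigma_finite_measure set T1 -> \bar R})
    (m2 : {sigma_finite_measure set T2 -> \bar R}) :
  measure_preserving (m1 \x m2) (m2 \x m1) (fun z => (z.2, z.1)).
Proof.
apply: measure_preserving_productP; first by apply: measurable_fun_pair.
move=> A B mA mB; rewrite (_ : _ @^-1` _ = B `*` A); last first.
  by apply/seteqP; split => -[x y] /= [].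
by rewrite /= product_measure1E// muleC.
Qed.

End measure_preserving.

(** * Affine maps and Lebesgue measure *)

Section rV_maps.
Context {R : realType}.

Lemma measurable_rV_coord n (i : 'I_n) :
  measurable_fun setT (fun v : 'rV[R]_n => v ord0 i).
Proof.
move=> _ B mB; rewrite setTI.
exists [set t | B (tnth t i)].
  by rewrite -[X in measurable X]setTI; exact: measurable_tnth.
by rewrite setTI; apply/seteqP; split => v /=; rewrite tnth_mktuple.
Qed.

Lemma measurable_fun_rV d (T : measurableType d) n (f : T -> 'rV[R]_n) :
  (forall i, measurable_fun setT (fun x => f x ord0 i)) -> measurable_fun setT f.
Proof.
move=> mf _ _ [B mB <-]; rewrite !setTI.
have : measurable_fun setT (@tuple_of_rV _ R n \o f).
  apply/measurable_fun_tnthP => i; apply: eq_measurable_fun (mf i) => x _ /=.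
  by rewrite tnth_mktuple.
by move=> /(_ measurableT _ mB); rewrite setTI comp_preimage.
Qed.

Lemma continuous_measurable_rV n k (f : 'rV[R]_n -> 'rV[R]_k) :
  continuous f -> measurable_fun setT f.
Proof.
move=> cf; apply: measurable_fun_rV => i.
apply: (measurability (@RGenOpens.G R)); first exact: RGenOpens.measurableE.
move=> _ [_ [a [b ->]] <-]; rewrite setTI; apply: measurable_open_rV.
apply: open_comp; last exact: interval_open.
by move=> v _; apply: (@continuous_comp _ _ _ f (fun w => w ord0 i)); [exact: cf|exact: coord_continuous].
Qed.

Lemma measurable_row_mx a b :
  measurable_fun setT (fun z : 'rV[R]_a * 'rV[R]_b => row_mx z.1 z.2).
Proof.
apply: measurable_fun_rV => i; case: (split_ordP i) => j ->.
  under eq_fun do rewrite row_mxEl.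
  apply: (measurableT_comp (f := fun v : 'rV[R]_a => v ord0 j)) => //.
  exact: measurable_rV_coord.
under eq_fun do rewrite row_mxEr.
apply: (measurableT_comp (f := fun v : 'rV[R]_b => v ord0 j)) => //.
exact: measurable_rV_coord.
Qed.

Lemma measurable_lrsubmx a b :
  measurable_fun setT (fun v : 'rV[R]_(a + b) => (lsubmx v, rsubmx v)).
Proof.
apply: measurable_fun_pair; apply: measurable_fun_rV => i;
  under eq_fun do rewrite mxE; exact: measurable_rV_coord.
Qed.

Lemma measurable_mulmxr n k (A : 'M[R]_(n, k)) :
  measurable_fun setT (fun v : 'rV[R]_n => v *m A).
Proof.
apply: measurable_fun_rV => i; under eq_fun do rewrite mxE.
apply: measurable_sum => j; apply: measurable_funM => //.
exact: measurable_rV_coord.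
Qed.

Lemma measurable_addrV n :
  measurable_fun setT (fun z : 'rV[R]_n * 'rV[R]_n => z.1 + z.2).
Proof.
apply: measurable_fun_rV => i; under eq_fun do rewrite mxE.
by apply: measurable_funD; apply: (measurableT_comp (f := fun v : 'rV[R]_n => v ord0 i)) => //;
  exact: measurable_rV_coord.
Qed.

Local Notation lam := (@lebesgue_rV R).

(** Cells are half-open boxes, and they determine the measure. *)
Lemma lebesgue_rV_preservingP d (T : measurableType d) n
    (mu : {measure set T -> \bar R}) (f : T -> 'rV[R]_n) :
  measurable_fun setT f ->
  (forall a b : 'I_n -> R, (forall i, a i < b i) ->
    mu (f @^-1` [set v | forall i, `[a i, b i[%classic (v ord0 i)]) =
    (\prod_(i < n) (b i - a i)%:E)%E) ->
  measure_preserving mu (lam n) f.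
Proof.
move=> mf H; split => // B mB.
suff E k v : mu (f @^-1` cell k v) = lam n (cell k v).
  apply: (@eq_measure_cells _ _ (pushforward mu f : {measure set _ -> \bar R}) (lebesgue_rV n)) => //.
  by move=> v; rewrite /= /pushforward E lebesgue_cell ltry.
have ab i : (grid k v i)%:~R / 2 ^+ k < ((grid k v i)%:~R + 1) / 2 ^+ k :> R.
  by rewrite ltr_pM2r ?invr_gt0 ?exprn_gt0// ltrDl ltr01.
rewrite cellE (H _ _ ab).
rewrite (@lebesgue_rVE _ _ (fun i =>
  `[(grid k v i)%:~R / 2 ^+ k, ((grid k v i)%:~R + 1) / 2 ^+ k[%classic))//.
by apply: eq_bigr => i _; rewrite lebesgue_measure_itv/= lte_fin ab EFinB.
Qed.

Lemma lebesgue_rV_row_mx a b :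
  measure_preserving (lam a \x lam b)%E (lam (a + b)) (fun z => row_mx z.1 z.2).
Proof.
apply: lebesgue_rV_preservingP; first exact: measurable_row_mx.
move=> s t st.
rewrite (_ : _ @^-1` _ =
  [set v : 'rV[R]_a | forall i, `[s (lshift b i), t (lshift b i)[%classic (v ord0 i)] `*`
  [set v : 'rV[R]_b | forall i, `[s (rshift a i), t (rshift a i)[%classic (v ord0 i)]); last first.
  apply/seteqP; split => -[x y] /=.
    move=> H; split => i; first by have := H (lshift b i); rewrite row_mxEl.
    by have := H (rshift a i); rewrite row_mxEr.
  by move=> [Hx Hy] i; case: (split_ordP i) => j ->; rewrite ?row_mxEl ?row_mxEr.
rewrite /= product_measure1E.
- rewrite big_split_ord/= (@lebesgue_rVE _ _ (fun i => `[s (lshift b i), t (lshift b i)[%classic))//.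
  rewrite (@lebesgue_rVE _ _ (fun i => `[s (rshift a i), t (rshift a i)[%classic))//.
  by congr (_ * _)%E; apply: eq_bigr => i _; rewrite lebesgue_measure_itv/= lte_fin st EFinB.
- by apply: (@measurable_rV_box _ _ (fun i => `[s (lshift b i), t (lshift b i)[%classic)).
- by apply: (@measurable_rV_box _ _ (fun i => `[s (rshift a i), t (rshift a i)[%classic)).
Qed.

Lemma lebesgue_rV_split a b : measure_preserving (lam (a + b)) (lam a \x lam b)%E
  (fun v => (lsubmx v, rsubmx v)).
Proof.
apply: measure_preserving_inv (lebesgue_rV_row_mx a b); first exact: measurable_lrsubmx.
by move=> [x y] /=; rewrite row_mxKl row_mxKr.
Qed.

Lemma lebesgue_affine_itv (d c a b : R) : d != 0 -> a < b ->
  lebesgue_measure ((fun x => x * d + c) @^-1` `[a, b[%classic) =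
  ((b - a) / `|d|)%:E.
Proof.
move=> d0 ab; case: (ltrgt0P d) d0 => [dp|dn|//] _.
- rewrite (_ : _ @^-1` _ = `[(a - c) / d, (b - c) / d[%classic); last first.
    apply/seteqP; split => x /=; rewrite !in_itv/= -lerBlDr -ltrBrDr.
      by rewrite ler_pdivrMr// ltr_pdivlMr.
    by rewrite ler_pdivrMr// ltr_pdivlMr.
  rewrite lebesgue_measure_itv/= lte_fin ltr_pM2r ?invr_gt0// ltrD2r ab.
  by rewrite -EFinB -mulrBl; congr (_ * _)%:E; lra.
- rewrite (_ : _ @^-1` _ = `](b - c) / d, (a - c) / d]%classic); last first.
    apply/seteqP; split => x /=; rewrite !in_itv/= -lerBlDr -ltrBrDr.
      by rewrite ler_ndivlMr// ltr_ndivrMr// andbC.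
    by rewrite ler_ndivlMr// ltr_ndivrMr// andbC.
  rewrite lebesgue_measure_itv/= lte_fin ltr_nM2r ?invr_lt0// ltrD2r ab.
  by rewrite -EFinB -mulrBl invrN mulrN -mulNr; congr (_ * _)%:E; lra.
Qed.

(** The preimage of a box is a box whose sides are scaled by 1 / |d i|, and these factors multiply
    to 1. Translations and diagonal matrices are both instances. *)
Lemma lebesgue_rV_affine n (d c : 'I_n -> R) : `|\prod_(i < n) d i| = 1 ->
  measure_preserving (lam n) (lam n) (fun v => \row_i (v ord0 i * d i + c i)).
Proof.
move=> d1.
have d0 i : d i != 0.
  apply/eqP => di; move: d1; rewrite (bigD1 i)//= di mul0r normr0 => /esym/eqP.
  by rewrite oner_eq0.
apply: lebesgue_rV_preservingP.
  apply: measurable_fun_rV => i; under eq_fun do rewrite mxE.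
  apply: measurable_funD => //; apply: measurable_funM => //.
  exact: measurable_rV_coord.
move=> a b ab.
rewrite (_ : _ @^-1` _ = [set v : 'rV[R]_n | forall i, ((fun x => x * d i + c i) @^-1` `[a i, b i[%classic) (v ord0 i)]); last first.
  by apply/seteqP; split => v /= H i; have := H i; rewrite mxE.
etransitivity.
  apply: (@lebesgue_rVE _ _ (fun i => (fun x => x * d i + c i) @^-1` `[a i, b i[%classic)).
  move=> i; apply: measurable_preimage => //.
  by apply: measurable_funD => //; apply: measurable_funM.
under eq_bigr do rewrite lebesgue_affine_itv//.
rewrite !prodEFin big_split/=; congr (_%:E).
by rewrite prodfV -normr_prod d1 invr1 mulr1.
Qed.

Lemma lebesgue_rV_translation n (c : 'rV[R]_n) :
  measure_preserving (lam n) (lam n) (fun v => v + c).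
Proof.
have : `|\prod_(i < n) (1 : R)| = 1 by rewrite big1 ?normr1.
move=> /(@lebesgue_rV_affine n (fun=> 1) (fun i => c ord0 i)).
apply: eq_measure_preserving => v; apply/rowP => i.
by rewrite !mxE mulr1.
Qed.

Lemma lebesgue_rV_diag n (d : 'rV[R]_n) : `|\det (diag_mx d)| = 1 ->
  measure_preserving (lam n) (lam n) (fun v => v *m diag_mx d).
Proof.
rewrite det_diag => /(@lebesgue_rV_affine n _ (fun=> 0)).
apply: eq_measure_preserving => v; apply/rowP => i.
by rewrite mul_mx_diag !mxE addr0.
Qed.

Lemma lebesgue_rV_perm n (s : 'S_n) :
  measure_preserving (lam n) (lam n) (fun v => v *m perm_mx s).
Proof.
apply: (@eq_measure_preserving _ _ _ _ _ _ _ (fun v => col_perm (s^-1)%g v)).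
  by move=> v; rewrite col_permE invgK.
apply: lebesgue_rV_preservingP.
  apply: measurable_fun_rV => i; under eq_fun do rewrite mxE.
  exact: measurable_rV_coord.
move=> a b ab.
rewrite (_ : _ @^-1` _ = [set v : 'rV[R]_n | forall i, `[a (s i), b (s i)[%classic (v ord0 i)]); last first.
  apply/seteqP; split => v /= H i; have := H.
    by move=> /(_ (s i)); rewrite !mxE permK.
  by move=> /(_ ((s^-1)%g i)); rewrite !mxE permKV.
etransitivity.
  exact: (@lebesgue_rVE _ _ (fun i => `[a (s i), b (s i)[%classic)).
rewrite [RHS](reindex_inj (@perm_inj _ s))/=.
by apply: eq_bigr => i _; rewrite lebesgue_measure_itv/= lte_fin ab EFinB.
Qed.

(** Induction on the dimension: with the first coordinate split off, v *m U applies the lower right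
    block to the remaining coordinates and then shears them by a multiple of the first one. *)
Lemma lebesgue_rV_upper n (U : 'M[R]_n) : (forall i j : 'I_n, (j < i)%N -> U i j = 0) ->
  (forall i, U i i = 1) -> measure_preserving (lam n) (lam n) (fun v => v *m U).
Proof.
elim: n U => [|n IH] U U0 U1.
  apply: (@eq_measure_preserving _ _ _ _ _ _ _ id) => [v|]; first by apply/rowP => -[].
  by split.
pose U' := drsubmx (U : 'M[R]_(1 + n)); pose b := ursubmx (U : 'M[R]_(1 + n)).
have U'mp : measure_preserving (lam n) (lam n) (fun v => v *m U').
  apply: IH => [i j ij|i]; rewrite !mxE; last exact: U1.
  by apply: U0; rewrite /= !ltnS.
have Sh : measure_preserving (lam 1 \x lam n)%E (lam 1 \x lam n)%E
    (fun z => (z.1, z.2 + z.1 *m b)).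
  apply: (@measure_preserving_shear _ _ _ _ _ (lam 1) (lam n) (fun x y => y + x *m b)) => [|x].
    apply: (measurableT_comp (f := fun z : 'rV[R]_n * 'rV[R]_n => z.1 + z.2)
      (g := fun z : 'rV[R]_1 * 'rV[R]_n => (z.2, z.1 *m b))).
      exact: measurable_addrV.
    apply: measurable_fun_pair => //.
    by apply: (measurableT_comp (f := fun v : 'rV[R]_1 => v *m b)) => //; exact: measurable_mulmxr.
  exact: lebesgue_rV_translation.
have idp : measure_preserving (lam 1) (lam 1) id by split.
have := measure_preserving_comp (lebesgue_rV_split 1 n) (measure_preserving_prod idp U'mp).
move=> /measure_preserving_comp/(_ Sh)/measure_preserving_comp/(_ (lebesgue_rV_row_mx 1 n)).
apply: eq_measure_preserving => v /=.
transitivity (row_mx (lsubmx (v : 'rV[R]_(1 + n))) (rsubmx (v : 'rV[R]_(1 + n))) *m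
    block_mx (ulsubmx (U : 'M[R]_(1 + n))) b (dlsubmx (U : 'M[R]_(1 + n))) U').
  rewrite mul_row_block [_ + _ *m U']addrC.
  rewrite (_ : dlsubmx _ = 0) ?mulmx0 ?addr0; last first.
    by apply/matrixP => i j; rewrite !mxE; apply: U0; rewrite /= ord1.
  rewrite (_ : ulsubmx _ = 1%:M) ?mulmx1//.
  apply/matrixP => i j; rewrite !ord1 !mxE eqxx/=.
  by rewrite -(U1 ord0); congr (U _ _); apply/val_inj.
by rewrite hsubmxK submxK.
Qed.

(** Reversing the order of the coordinates conjugates a lower triangular matrix into an upper
    triangular one. *)
Lemma lebesgue_rV_lower n (U : 'M[R]_n) : (forall i j : 'I_n, (i < j)%N -> U i j = 0) ->
  (forall i, U i i = 1) -> measure_preserving (lam n) (lam n) (fun v => v *m U).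
Proof.
pose r : 'S_n := perm (@rev_ord_inj n).
move=> U0 U1.
have H : measure_preserving (lam n) (lam n) (fun v => v *m (\matrix_(i, j) U (r i) (r j))).
  apply: lebesgue_rV_upper => [i j ji|i]; rewrite !mxE ?U1//.
  apply: U0; rewrite !permE/=; have := ltn_ord i; have := ltn_ord j; lia.
have := measure_preserving_comp (lebesgue_rV_perm r) H.
move=> /measure_preserving_comp/(_ (lebesgue_rV_perm r)).
apply: eq_measure_preserving => v /=; rewrite -!mulmxA; congr (_ *m _).
rewrite -row_permE (_ : perm_mx r = perm_mx ((r^-1)^-1)%g); last by rewrite invgK.
rewrite -col_permE.
apply/matrixP => i j; rewrite !mxE permKV.
by congr (U _ _); rewrite !permE rev_ordK.
Qed.

(** LUP factorisation, with the diagonal D of U split off: A is a permutation times L times D times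
    U', where L and U' are unipotent. All the other determinants being 1 or -1, so is that of D. *)
Lemma lebesgue_rV_mulmx n (A : 'M[R]_n) : `|\det A| = 1 ->
  measure_preserving (lam n) (lam n) (fun v => v *m A).
Proof.
case: n A => [|n] A detA.
  apply: (@eq_measure_preserving _ _ _ _ _ _ _ id) => [v|]; first by apply/rowP => -[].
  by split.
have := cormen_lup_correct A; have := cormen_lup_detL A.
have := cormen_lup_perm A; have := @cormen_lup_lower _ _ A; have := @cormen_lup_upper _ _ A.
case: cormen_lup => [[P L] U] /= Uup Llow /is_perm_mxP[s ->] detL PALU.
have detU : \det U = \prod_i U i i.
  rewrite -det_tr det_trig; first by apply: eq_bigr => i _; rewrite mxE.
  by apply/is_trig_mxP => i j ij; rewrite mxE Uup.
have LUE : L *m U = perm_mx s *m A by exact: esym PALU.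
have detsA : `|\det (perm_mx s *m A)| = 1.
  by rewrite det_mulmx det_perm normrM detA mulr1 normrX normrN1 expr1n.
have prodU : `|\prod_i U i i| = 1.
  by rewrite -detU -detsA -LUE det_mulmx detL mul1r.
have U0 i : U i i != 0.
  apply/eqP => Ui; move: prodU; rewrite (bigD1 i)//= Ui mul0r normr0 => /esym/eqP.
  by rewrite oner_eq0.
pose D : 'rV[R]_n.+1 := \row_i U i i.
pose U' := \matrix_(i, j) (U i j / U i i).
have UE : U = diag_mx D *m U'.
  by apply/matrixP => i j; rewrite mul_diag_mx !mxE mulrC divfK.
have AE : A = perm_mx (s^-1)%g *m L *m diag_mx D *m U'.
  rewrite -mulmxA -UE -mulmxA LUE mulmxA.
  by rewrite -perm_mxM mulVg perm_mx1 mul1mx.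
have H1 := lebesgue_rV_perm (s^-1)%g.
have H2 : measure_preserving (lam n.+1) (lam n.+1) (fun v => v *m L).
  apply: lebesgue_rV_lower => [i j ij|i].
    by rewrite (Llow _ _ (ltnW ij)) -val_eqE/= (ltn_eqF ij).
  by rewrite (Llow _ _ (leqnn i)) eqxx.
have H3 : measure_preserving (lam n.+1) (lam n.+1) (fun v => v *m diag_mx D).
  by apply: lebesgue_rV_diag; rewrite det_diag; under eq_bigr do rewrite mxE.
have H4 : measure_preserving (lam n.+1) (lam n.+1) (fun v => v *m U').
  apply: lebesgue_rV_upper => [i j ji|i]; rewrite mxE.
    by rewrite (Uup _ _ ji) mul0r.
  by rewrite divff.
have := measure_preserving_comp (measure_preserving_comp (measure_preserving_comp H1 H2) H3) H4.
by apply: eq_measure_preserving => v /=; rewrite AE !mulmxA.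
Qed.


End rV_maps.

(** * Differentiable involutions *)

Section differentiable_involution.
Context {R : realType}.
Local Notation lam := (@lebesgue_rV R).

Lemma rV_norm_coord n (v : 'rV[R]_n) i : `|v ord0 i| <= `|v|.
Proof.
rewrite [leRHS]/Num.norm/= mx_normrE.
by apply: (le_bigmax_cond _ (fun ij => `|v ij.1 ij.2|) (j := (ord0, i))).
Qed.

Lemma rV_norm_le n (v : 'rV[R]_n) r : 0 <= r ->
  (forall i, `|v ord0 i| <= r) -> `|v| <= r.
Proof.
move=> r0 H; rewrite [leLHS]/Num.norm/= mx_normrE.
by apply/bigmax_leP; split => // -[i j] _ /=; rewrite ord1.
Qed.

(** Supplies the relative error s that may be made on the side of a cube when its volume is to
    change by a prescribed factor only. *)
Lemma expr_near1 n (b c e : R) : (0 < e)%R -> (c < 1)%R -> (1 < b)%R ->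
  exists2 s, 0 < s < e & (1 + s) ^+ n <= b /\ c <= (1 - s) ^+ n.
Proof.
move=> e0 c1 b1.
have up : (1 + s) ^+ n @[s --> (0 : R)^'+] --> (1 : R).
  apply: cvg_at_right_filter; rewrite -[X in _ --> X](expr1n R n).
  apply: (@cvg_comp _ _ _ (fun s : R => 1 + s) (fun x : R => x ^+ n) _ (nbhs (1 : R))).
    have : 1 + s @[s --> (0 : R)] --> (1 + 0 : R) by apply: cvgD; [exact: cvg_cst|exact: cvg_id].
    by rewrite addr0.
  exact: exprn_continuous.
have lo : (1 - s) ^+ n @[s --> (0 : R)^'+] --> (1 : R).
  apply: cvg_at_right_filter; rewrite -[X in _ --> X](expr1n R n).
  apply: (@cvg_comp _ _ _ (fun s : R => 1 - s) (fun x : R => x ^+ n) _ (nbhs (1 : R))).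
    have : 1 - s @[s --> (0 : R)] --> (1 - 0 : R) by apply: cvgB; [exact: cvg_cst|exact: cvg_id].
    by rewrite subr0.
  exact: exprn_continuous.
near (0 : R)^'+ => s; exists s.
  by apply/andP; split; near: s; [exact: nbhs_right_gt|exact: nbhs_right_lt].
split; near: s; first exact: (cvgr_le _ up).
exact: (cvgr_ge _ lo).
Unshelve. all: by end_near. Qed.

Definition cube n (a : 'I_n -> R) (r : R) : set 'rV[R]_n :=
  [set v | forall i, `[a i, a i + r[%classic (v ord0 i)].

Lemma measurable_cube n (a : 'I_n -> R) r : measurable (cube a r).
Proof. by apply: (@measurable_rV_box _ _ (fun i => `[a i, a i + r[%classic)). Qed.

Lemma lebesgue_cube n (a : 'I_n -> R) r : 0 <= r -> lam n (cube a r) = (r ^+ n)%:E.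
Proof.
move=> r0; rewrite /cube (@lebesgue_rVE _ _ (fun i => `[a i, a i + r[%classic))//.
transitivity (\prod_(i < n) r%:E)%E; last by rewrite prodEFin prodr_const card_ord.
apply: eq_bigr => i _; rewrite lebesgue_measure_itv/= lte_fin ltrDl.
case: ltP => r1; first by rewrite -EFinB addrAC subrr add0r.
by congr (_%:E); apply/eqP; rewrite eq_le r0 r1.
Qed.

Lemma cell_cube n k (v : 'rV[R]_n) :
  cell k v = cube (fun i => (grid k v i)%:~R / 2 ^+ k) ((2 ^+ k)^-1).
Proof.
by rewrite cellE /cube; under eq_set do under eq_forall do rewrite mulrDl mul1r.
Qed.

Lemma cube_widen n (a : 'I_n -> R) r s (v w : 'rV[R]_n) :
  cube a r w -> `|v - w| <= s -> cube (fun i => a i - s) (r + 2 * s) v.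
Proof.
move=> aw vw i; have := aw i; rewrite /= !in_itv/=.
have := le_trans (rV_norm_coord (v - w) i) vw; rewrite !mxE ler_norml.
by move=> /andP[? ?] /andP[? ?]; apply/andP; split; lra.
Qed.

Lemma differentiable_approx n (f : 'rV[R]_n -> 'rV[R]_n) (x : 'rV[R]_n) (t : R) :
  0 < t -> differentiable f x -> exists2 d, 0 < d & forall y, `|y - x| < d ->
    `|f y - f x - 'd f x (y - x)| <= t * `|y - x|.
Proof.
move=> t0 /diff_locally /eqaddoP /(_ t t0) /nbhs_ballP [d /= d0 Hd].
exists d => // y yx.
have := Hd (y - x); rewrite -ball_normE /= sub0r normrN => /(_ yx).
by rewrite !fctE/= subrK opprD addrA.
Qed.

Variables (n : nat) (T : 'rV[R]_n -> 'rV[R]_n).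
Hypotheses (TK : involutive T) (dT : forall v, differentiable T v).

Lemma diff_involutionK x : cancel ('d T x) ('d T (T x)).
Proof.
move=> v.
have TT : T \o T = idfun by apply/funext => y /=; rewrite TK.
(* Stating the chain rule for every g equal to T \o T allows g to be [idfun] without rewriting
   inside a differential. *)
have H g : g = T \o T -> 'd g x = 'd T (T x) \o 'd T x :> ('rV[R]_n -> 'rV[R]_n).
  by move=> ->; exact: (diff_comp (dT x) (dT (T x))).
have E : 'd idfun x = idfun :> ('rV[R]_n -> 'rV[R]_n) := @diff_val _ _ _ _ _ _ _ (is_diff_id x).
by rewrite -[LHS]/(('d T (T x) \o 'd T x) v) -(H _ (esym TT)) E.
Qed.

Hypothesis detT : forall v, `|\det ('J T v)| = 1.

(** This affine map approximates T at T x, and its linear part is inverse to ['d T x]. Both cell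
    estimates compare T^-1 with the preimage under it. *)
Lemma diff_preserving x :
  measure_preserving (lam n) (lam n) (fun v => x + 'd T (T x) (v - T x)).
Proof.
have H := measure_preserving_comp (lebesgue_rV_translation (- T x))
  (lebesgue_rV_mulmx (detT (T x))).
apply: eq_measure_preserving (measure_preserving_comp H (lebesgue_rV_translation x)).
by move=> v /=; rewrite addrC /jacobian mul_rV_lin1.
Qed.

Lemma measurable_involution : measurable_fun setT T.
Proof. by apply: continuous_measurable_rV => v; exact: differentiable_continuous. Qed.

Local Open Scope ereal_scope.

(** If T w lies in a cell of side r near x, then w = T (T w) is within s r of its linear
    approximation from x. The affine map of [diff_preserving] sends such a w to within M s r of T w,
    hence into the cell widened by that margin, whose volume is (1 + 2 M s)^n times that of the
    cell. *)
Lemma cell_upper (c : R) (x : 'rV[R]_n) : (1 < c)%R -> exists K, forall k v, (K <= k)%N ->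
  (forall w i, cell k v w -> (`|w ord0 i - x ord0 i| <= (2 ^+ k)^-1)%R) ->
  lam n (T @^-1` cell k v) <= c%:E * lam n (cell k v).
Proof.
move=> c1.
have [M M0 HM] := linear_lipschitz (diff_continuous (dT (T x))).
have [s s0 Hs] : exists2 s : R, (0 < s)%R & ((1 + 2 * (M * s)) ^+ n <= c)%R.
  have [s /andP[s0 _] [Hs _]] := expr_near1 n ltr01 ltr01 c1.
  exists (s / (2 * M))%R; first by rewrite divr_gt0// mulr_gt0.
  by rewrite (_ : (2 * (M * (s / (2 * M))))%R = s)//; field; rewrite gt_eqF.
have [d d0 Hd] := differentiable_approx s0 (dT x).
have [K HK] := exists_invX2_lt d0.
exists K => k v Kk near_x.
have r0 : (0 < (2 ^+ k)^-1 :> R)%R by rewrite invr_gt0 exprn_gt0.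
have rd := HK k Kk.
set r : R := ((2 ^+ k)^-1)%R in r0 rd near_x *.
have {}near_x w : cell k v w -> (`|w - x| <= r)%R.
  by move=> cw; apply: rV_norm_le (ltW r0) _ => i; rewrite !mxE near_x.
pose a i : R := ((grid k v i)%:~R / 2 ^+ k)%R.
have [mg gmp] := diff_preserving x.
have sub : T @^-1` cell k v `<=`
    (fun w => x + 'd T (T x) (w - T x))%R @^-1` cube (fun i => a i - M * s * r)%R (r + 2 * (M * s * r))%R.
  move=> w /= cw; apply: (@cube_widen _ a r _ _ (T w)).
    by move: cw; rewrite cell_cube.
  have := Hd (T w) (le_lt_trans (near_x _ cw) rd).
  rewrite TK => /le_trans/(_ (ler_wpM2l (ltW s0) (near_x _ cw))) => Hw.
  (* The deviation is the image under ['d T (T x)] of the approximation error at x, because the two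
     differentials cancel. *)
  have -> : (x + 'd T (T x) (w - T x) - T w = 'd T (T x) (w - T x - 'd T x (T w - x)))%R.
    by rewrite [RHS]linearB/= diff_involutionK opprB addrA [in RHS](addrC _ x).
  by apply: le_trans (HM _) _; rewrite -mulrA ler_pM2l.
apply: (@le_trans _ _ (lam n (cube (fun i => a i - M * s * r)%R (r + 2 * (M * s * r))%R))).
  rewrite -(gmp _ (measurable_cube _ _)).
  apply: le_measure sub; rewrite inE; apply: measurable_preimage => //.
  - exact: measurable_involution.
  - exact: measurable_cell.
  - exact: measurable_cube.
have Ms0 : (0 <= M * s)%R by rewrite mulr_ge0 ?ltW.
rewrite lebesgue_cell -/r lebesgue_cube; last first.
  by rewrite addr_ge0 ?mulr_ge0 ?ltW.
rewrite -EFinM lee_fin (_ : r + _ = (1 + 2 * (M * s)) * r)%R; last by lra.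
by rewrite exprMn ler_wpM2r// exprn_ge0// ltW.
Qed.

(** Dual argument with the cell shrunk by s r on every side: if the affine map sends u to w in the
    shrunken cell, then T u is within s r of w and stays in the cell. Here T is approximated at T x,
    and u is within M r of T x, which explains the tolerance s / M. *)
Lemma cell_lower (c : R) (x : 'rV[R]_n) : (1 < c)%R -> exists K, forall k v, (K <= k)%N ->
  (forall w i, cell k v w -> (`|w ord0 i - x ord0 i| <= (2 ^+ k)^-1)%R) ->
  lam n (cell k v) <= c%:E * lam n (T @^-1` cell k v).
Proof.
move=> c1.
have [M M0 HM] := linear_lipschitz (diff_continuous (dT x)).
(* The bound 1 / 2 keeps the side (1 - 2 s) r of the shrunken cube positive. *)
have [s /andP[s0 s1] Hs] : exists2 s : R, (0 < s < 1 / 2)%R & (1 <= c * (1 - 2 * s) ^+ n)%R.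
  have c01 : (c^-1 < 1)%R by rewrite invf_lt1// (lt_trans ltr01).
  have [s /andP[s0 s1] [_ Hs]] := expr_near1 n ltr01 c01 c1.
  exists (s / 2)%R; first by rewrite divr_gt0//= ltr_pM2r ?invr_gt0.
  by rewrite mulrCA divff// mulr1 mulrC -ler_pdivrMr ?div1r// (lt_trans ltr01).
have sM0 : (0 < s / M)%R by rewrite divr_gt0.
have [d d0 Hd] := differentiable_approx sM0 (dT (T x)).
have dM0 : (0 < d / M)%R by rewrite divr_gt0.
have [K HK] := exists_invX2_lt dM0.
exists K => k v Kk near_x.
have r0 : (0 < (2 ^+ k)^-1 :> R)%R by rewrite invr_gt0 exprn_gt0.
have rd := HK k Kk.
set r : R := ((2 ^+ k)^-1)%R in r0 rd near_x *.
have {}near_x w : cell k v w -> (`|w - x| <= r)%R.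
  by move=> cw; apply: rV_norm_le (ltW r0) _ => i; rewrite !mxE near_x.
pose a i : R := ((grid k v i)%:~R / 2 ^+ k)%R.
have [mg gmp] := diff_preserving x.
pose C := cube (fun i => a i + s * r)%R (r - 2 * (s * r))%R : set 'rV[R]_n.
have sub : (fun w => x + 'd T (T x) (w - T x))%R @^-1` C `<=` T @^-1` cell k v.
  move=> u; set w := (x + 'd T (T x) (u - T x))%R => /= Cw.
  have cw : cell k v w.
    rewrite cell_cube => i; have := Cw i; rewrite /= !in_itv/= -/(a i) -/r.
    have : (0 < s * r)%R by rewrite mulr_gt0.
    by move=> ? /andP[? ?]; apply/andP; split; lra.
  have uE : (u - T x = 'd T x (w - x))%R.
    rewrite /w [(x + _)%R]addrC addrK.
    by have := diff_involutionK (T x) (u - T x)%R; rewrite TK => ->.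
  have un : (`|u - T x| <= M * r)%R.
    by rewrite uE; apply: le_trans (HM _) _; rewrite ler_pM2l// near_x.
  have := Hd u; rewrite (le_lt_trans un) => [/(_ isT)|]; last first.
    by rewrite mulrC -ltr_pdivlMr.
  rewrite TK => /le_trans /(_ (ler_wpM2l (ltW sM0) un)).
  rewrite -addrA -opprD -/w (_ : (s / M * (M * r)) = s * r)%R; last first.
    by field; rewrite gt_eqF.
  move=> Tuw; have := cube_widen Cw Tuw; rewrite cell_cube.
  move=> H i; have := H i; rewrite /= !in_itv/= -/(a i) -/r.
  by move=> /andP[? ?]; apply/andP; split; lra.
have Cle : lam n C <= lam n (T @^-1` cell k v).
  rewrite -(gmp _ (measurable_cube _ _)).
  apply: le_measure sub; rewrite inE; apply: measurable_preimage => //.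
  - exact: measurable_cube.
  - exact: measurable_involution.
  - exact: measurable_cell.
apply: (@le_trans _ _ (c%:E * lam n C)); last first.
  by apply: lee_wpmul2l Cle; rewrite lee_fin (le_trans ler01)// ltW.
have s20 : (0 <= 1 - 2 * s)%R by lra.
have CE : lam n C = (((1 - 2 * s) ^+ n * r ^+ n)%R)%:E.
  rewrite /C (_ : r - 2 * (s * r) = (1 - 2 * s) * r)%R; last by lra.
  by rewrite lebesgue_cube ?exprMn// mulr_ge0// ltW.
rewrite CE lebesgue_cell -/r -EFinM lee_fin mulrA.
by rewrite ler_peMl// exprn_ge0// ltW.
Qed.

(** Bisection is applied twice, with Lebesgue measure and its pushforward in either order; the
    factor c > 1 is then removed by letting it tend to 1. *)
Lemma lebesgue_rV_involution : measure_preserving (lam n) (lam n) T.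
Proof.
have mT := measurable_involution.
split => // B mB.
have E k v : lam n (T @^-1` cell k v) = lam n (cell k v).
  have lim (X Y : \bar R) : X \is a fin_num -> 0 <= Y ->
      (forall c : R, (1 < c)%R -> X <= c%:E * Y) -> X <= Y.
    case: X Y => [x| |]// [y| |]// _; rewrite ?leey// lee_fin => y0 H.
    rewrite lee_fin; apply/ler_addgt0Pr => e e0; have := H (1 + e / (y + 1))%R.
    rewrite ltrDl divr_gt0 ?ltr_wpDl// => /(_ isT); rewrite -EFinM lee_fin => /le_trans; apply.
    rewrite mulrDl mul1r lerD2l -mulrA ler_piMr// ?(ltW e0)//.
    by rewrite mulrC ler_pdivrMr ?ltr_wpDl// mul1r lerDl.
  pose nu0 : {measure set _ -> \bar R} := pushforward (lebesgue_rV n) T.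
  pose nu := nu0 mT.
  have up (c : R) : (1 < c)%R -> nu (cell k v) <= c%:E * lam n (cell k v).
    move=> c1; apply: (@cell_bisection _ _ nu (lebesgue_rV n)) => x.
    exact: cell_upper.
  have fin1 : lam n (cell k v) \is a fin_num by rewrite lebesgue_cell.
  apply/eqP; rewrite eq_le; apply/andP; split.
    apply: (lim (nu (cell k v))) => //.
    have := up 2%R; rewrite ltr1n => /(_ isT) H.
    rewrite ge0_fin_numE//; apply: le_lt_trans H _.
    by rewrite lebesgue_cell -EFinM ltry.
  apply: lim => // c c1.
  apply: (@cell_bisection _ _ (lebesgue_rV n) nu) => x.
  exact: cell_lower.
apply: (@eq_measure_cells _ _ (pushforward (lebesgue_rV n) T : {measure set _ -> \bar R}) (lebesgue_rV n)) => //.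
by move=> v; rewrite /= /pushforward E lebesgue_cell ltry.
Qed.

End differentiable_involution.

(** * Reversible flows on phase space *)

Section phase_space.
Context {R : realType} {m : nat}.
Local Notation phase := ('rV[R]_m * 'rV[R]_m)%type.
Local Notation lam := (@lebesgue_rV R).

Lemma mulmxr_continuous n k (A : 'M[R]_(n, k)) :
  continuous (mulmxr A : 'rV[R]_n -> 'rV[R]_k).
Proof.
rewrite (_ : (mulmxr A : 'rV[R]_n -> _) = (fun v => \sum_i v ord0 i *: row i A)); last first.
  by apply/funext => v; rewrite /mulmxr mulmx_sum_row.
elim: (index_enum _) => [|i s IH].
  by under eq_fun do rewrite big_nil; exact: cst_continuous.
under eq_fun do rewrite big_cons.
have H : continuous (fun v : 'rV[R]_n => v ord0 i *: row i A).
  move=> v; apply: (@continuous_comp _ _ _ (fun v : 'rV[R]_n => v ord0 i) (fun t => t *: row i A)).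
    exact: coord_continuous.
  exact: scalel_continuous.
by move=> v; apply: (@continuousD _ _ _ (fun v : 'rV[R]_n => v ord0 i *: row i A)); [exact: H|exact: IH].
Qed.

Lemma jacobian_mulmxr n k l (f : 'rV[R]_n -> 'rV[R]_k) (A : 'M[R]_(k, l)) v :
  differentiable f v ->
  differentiable (fun v => f v *m A) v /\ 'J (fun v => f v *m A) v = 'J f v *m A.
Proof.
move=> df; have cA := @mulmxr_continuous _ _ A.
have dA w : differentiable (mulmxr A : 'rV[R]_k -> 'rV[R]_l) w.
  exact: linear_differentiable.
split; first exact: (differentiable_comp df (dA (f v))).
have E : 'd (mulmxr A \o f) v = mulmxr A \o 'd f v :> (_ -> _).
  by rewrite (diff_comp df (dA (f v))) diff_lin.
apply/row_matrixP => i; rewrite row_mul !rowE !mul_rV_lin1.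
by rewrite -[LHS]/('d (mulmxr A \o f) v _) E.
Qed.

Definition flip (z : phase) : phase := (z.1, - z.2).

Definition unphase (v : 'rV[R]_(m + m)) : phase := (lsubmx v, rsubmx v).

Lemma row_mxK (z : phase) : unphase (row_mx z.1 z.2) = z.
Proof. by case: z => q p; rewrite /unphase row_mxKl row_mxKr. Qed.

Lemma phase_map_comp (f g : phase -> phase) v :
  phase_map f (phase_map g v) = phase_map (f \o g) v.
Proof. by rewrite /phase_map /= row_mxKl row_mxKr -surjective_pairing. Qed.

Lemma phase_map_preserving (f : phase -> phase) :
  measure_preserving (lam (m + m)) (lam (m + m)) (phase_map f) ->
  measure_preserving (@lebesgue_phase R m) (@lebesgue_phase R m) f.
Proof.
move=> H; have := measure_preserving_comp (lebesgue_rV_row_mx m m) H.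
move=> /measure_preserving_comp/(_ (lebesgue_rV_split m m)).
apply: eq_measure_preserving => z /=; rewrite -/(unphase _) /phase_map.
by rewrite row_mxK -/(unphase _) row_mxK.
Qed.

Variable psi : R -> phase -> phase.
Hypotheses (psi_volume : volume_preserving psi) (psi_reversible : reversible psi).

Lemma reversed_flow_involutive h : 0 < h -> involutive (flip \o psi h).
Proof.
move=> h0 [q p] /=; case E : (psi h (q, p)) => [q' p'].
have := (psi_reversible q p q' p' h0).1 E; rewrite /flip/= => ->.
by rewrite opprK.
Qed.

Lemma phase_map_flip h v : phase_map (flip \o psi h) v =
  phase_map (psi h) v *m block_mx 1%:M 0 0 (- 1%:M).
Proof.
rewrite /phase_map /= mul_row_block !mulmx0 addr0 add0r mulmx1.
by rewrite mulmxN mulmx1.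
Qed.

Lemma reversed_flow_preserving h : 0 < h ->
  measure_preserving (@lebesgue_phase R m) (@lebesgue_phase R m) (flip \o psi h).
Proof.
move=> h0; apply: phase_map_preserving.
have fE : phase_map (flip \o psi h) =
    (fun v => phase_map (psi h) v *m block_mx 1%:M 0 0 (- 1%:M)).
  by apply/funext => v; exact: phase_map_flip.
apply: lebesgue_rV_involution => [v|v|v].
- rewrite phase_map_comp (_ : _ \o _ = id); first by rewrite /phase_map/= hsubmxK.
  by apply/funext => z /=; exact: reversed_flow_involutive.
- rewrite fE; apply: (jacobian_mulmxr _ _).1.
  exact: (psi_volume v h0).1.
- rewrite fE (jacobian_mulmxr _ (psi_volume v h0).1).2.
  rewrite det_mulmx normrM (psi_volume v h0).2 mul1r det_lblock det1 mul1r.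
  by rewrite -scaleN1r detZ det1 mulr1 normrX normrN1 expr1n.
Qed.

Definition rescale (l : R) (z : phase) : phase := (l *: z.1, l^-1 *: z.2).

Lemma rescale_preserving l : l != 0 ->
  measure_preserving (@lebesgue_phase R m) (@lebesgue_phase R m) (rescale l).
Proof.
move=> l0; apply: phase_map_preserving.
pose D : 'rV[R]_(m + m) := row_mx (const_mx l) (const_mx l^-1).
have detD : `|\det (diag_mx D)| = 1.
  rewrite det_diag big_split_ord/=.
  under eq_bigr do rewrite row_mxEl mxE.
  under [X in _ * X]eq_bigr do rewrite row_mxEr mxE.
  by rewrite !prodr_const -exprMn divff// expr1n normr1.
apply: eq_measure_preserving (lebesgue_rV_mulmx detD) => v.
rewrite /phase_map /rescale/= mul_mx_diag; apply/rowP => i; rewrite !mxE.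
by case: splitP => j ij; rewrite !mxE mulrC; congr (_ * v _ _); apply/val_inj.
Qed.

Variable V : 'rV[R]_m -> R.
Hypothesis mV : measurable_fun setT V.

Lemma enorm2E (v : 'rV[R]_m) : enorm v ^+ 2 = \sum_(i < m) v ord0 i ^+ 2.
Proof. by rewrite sqr_sqrtr// sumr_ge0// => i _; exact: sqr_ge0. Qed.

Lemma measurable_enorm2 : measurable_fun setT (fun v : 'rV[R]_m => enorm v ^+ 2).
Proof.
under eq_fun do rewrite enorm2E.
apply: measurable_sum => i; apply: measurable_funX; exact: measurable_rV_coord.
Qed.

Lemma measurable_hamiltonian : measurable_fun setT (hamiltonian V).
Proof.
apply: measurable_funD; last exact: measurableT_comp.
apply: measurable_funM => //.
apply: (measurableT_comp (f := fun v : 'rV[R]_m => enorm v ^+ 2)) => //.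
exact: measurable_enorm2.
Qed.

Lemma hamiltonian_flip z : hamiltonian V (flip z) = hamiltonian V z.
Proof.
rewrite /hamiltonian !enorm2E; congr (_ * _ + _).
by apply: eq_bigr => i _; rewrite mxE sqrrN.
Qed.

Lemma energy_errorE h z : energy_error V psi z h =
  hamiltonian V ((flip \o psi h) z) - hamiltonian V z.
Proof. by rewrite /= hamiltonian_flip. Qed.

Lemma measurable_energy_error h : 0 < h ->
  measurable_fun setT (fun z => energy_error V psi z h).
Proof.
move=> h0; under eq_fun do rewrite energy_errorE.
have mH := measurable_hamiltonian.
apply: measurable_funB => //; apply: (measurableT_comp mH).
by have [] := reversed_flow_preserving h0.
Qed.

Lemma energy_error_reversed h z : 0 < h ->
  energy_error V psi ((flip \o psi h) z) h = - energy_error V psi z h.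
Proof. by move=> h0; rewrite !energy_errorE reversed_flow_involutive// opprB. Qed.

(** Substitute the flipped flow T: X changes sign, and H becomes H + X because H is even in the
    momentum, so the weight e^(-H) acquires the factor e^(-X). *)
Lemma integral_energy_error_reversed h (g : R -> R) : 0 < h ->
  measurable_fun setT g -> (forall x, 0 <= g x) ->
  (\int[@lebesgue_phase R m]_z
     (g (energy_error V psi z h) * expR (- hamiltonian V z))%:E =
   \int[@lebesgue_phase R m]_z
     (g (- energy_error V psi z h) * expR (- energy_error V psi z h) *
      expR (- hamiltonian V z))%:E)%E.
Proof.
move=> h0 mg g0.
have mH := measurable_hamiltonian; have mX := measurable_energy_error h0.
rewrite -(ge0_integral_measure_preserving (reversed_flow_preserving h0)); last 2 first.
- apply/measurable_EFinP; apply: measurable_funM; first exact: measurableT_comp.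
  by apply: measurableT_comp => //; exact: measurableT_comp.
- by move=> z; rewrite lee_fin mulr_ge0// expR_ge0.
apply: eq_integral => z _; rewrite energy_error_reversed// -mulrA -expRD.
by rewrite energy_errorE; congr (_ * expR _)%:E; ring.
Qed.

End phase_space.

(** * Rearranging the factors of product measures *)

Section product_rearrangement.
Context {R : realType}.
Local Open Scope ereal_scope.

Lemma measure_preserving_id d (T : measurableType d) (mu : set T -> \bar R) :
  measure_preserving mu mu id.
Proof. by split. Qed.

(* In mathcomp-analysis the sigma-finite structure of a product measure is found
   only for factors that are subprobabilities, hence this explicit packing. *)
Section product_sfm.
Context d1 d2 (T1 : measurableType d1) (T2 : measurableType d2).
Variables (m1 : {sigma_finite_measure set T1 -> \bar R})
  (m2 : {sigma_finite_measure set T2 -> \bar R}).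

Let product_sigma_finite : sigma_finite setT (m1 \x m2).
Proof.
have /sigma_finiteP[F [TF ndF Foo]] := sigma_finiteT m1.
have /sigma_finiteP[G [TG ndG Goo]] := sigma_finiteT m2.
exists (fun k => F k `*` G k) => [|k].
  apply/esym/seteqP; split => // -[x y] _.
  have [i _ Fi] : (\bigcup_i F i) x by rewrite -TF.
  have [j _ Gj] : (\bigcup_i G i) y by rewrite -TG.
  exists (maxn i j) => //; split => /=.
    by move: Fi; exact/subsetPset/ndF/leq_maxl.
  by move: Gj; exact/subsetPset/ndG/leq_maxr.
have [[mF Fk] [mG Gk]] := (Foo k, Goo k); split; first exact: measurableX.
by rewrite product_measure1E// lte_mul_pinfty// ge0_fin_numE.
Qed.

Definition product_sfm : {sigma_finite_measure set (T1 * T2)%type -> \bar R} :=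
  HB.pack (m1 \x m2) (Measure_isSigmaFinite.Build _ _ _ (m1 \x m2)
    product_sigma_finite).

End product_sfm.

Section assoc.
Context d1 d2 d3 (T1 : measurableType d1) (T2 : measurableType d2)
  (T3 : measurableType d3).
Variables (m1 : {sigma_finite_measure set T1 -> \bar R})
  (m2 : {sigma_finite_measure set T2 -> \bar R})
  (m3 : {sigma_finite_measure set T3 -> \bar R}).

Lemma measure_preserving_assoc :
  measure_preserving ((m1 \x m2) \x m3) (m1 \x (m2 \x m3))
    (fun z : (T1 * T2) * T3 => (z.1.1, (z.1.2, z.2))).
Proof.
have mf : measurable_fun setT (fun z : (T1 * T2) * T3 => (z.1.1, (z.1.2, z.2))).
  apply: measurable_fun_pair; first exact: measurableT_comp.
  by apply: measurable_fun_pair => //; exact: measurableT_comp.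
split => // B mB.
have mB' := measurable_preimage mf mB.
rewrite [LHS]/product_measure1/= (@fubini_tonelli1 _ _ _ _ _ m1 m2)//; last first.
  exact: measurable_fun_xsection.
rewrite [RHS]/product_measure1/=; apply: eq_integral => x _.
rewrite /fubini_F /= /product_measure1/=; apply: eq_integral => y _.
congr (m3 _); apply/seteqP; split => w /=; by rewrite /xsection/= !inE/= inE.
Qed.

Lemma measure_preserving_assoc_inv :
  measure_preserving (m1 \x (m2 \x m3)) ((m1 \x m2) \x m3)
    (fun z : T1 * (T2 * T3) => ((z.1, z.2.1), z.2.2)).
Proof.
apply: measure_preserving_inv measure_preserving_assoc.
- apply: measurable_fun_pair; last exact: measurableT_comp.
  by apply: measurable_fun_pair => //; exact: measurableT_comp.
- by move=> [[]].
Qed.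

End assoc.

(** A state lists all positions and then all momenta, so joining one particle to a state exchanges
    the two middle factors. *)
Lemma measure_preserving_swap4 d1 d2 d3 d4 (T1 : measurableType d1)
    (T2 : measurableType d2) (T3 : measurableType d3) (T4 : measurableType d4)
    (m1 : {sigma_finite_measure set T1 -> \bar R})
    (m2 : {sigma_finite_measure set T2 -> \bar R})
    (m3 : {sigma_finite_measure set T3 -> \bar R})
    (m4 : {sigma_finite_measure set T4 -> \bar R}) :
  measure_preserving ((m1 \x m2) \x (m3 \x m4)) ((m1 \x m3) \x (m2 \x m4))
    (fun z => ((z.1.1, z.2.1), (z.1.2, z.2.2))).
Proof.
have H1 := measure_preserving_assoc m1 m2 (product_sfm m3 m4).
have H2 := measure_preserving_assoc_inv m2 m3 m4.
have H3 := measure_preserving_prod (m1 := product_sfm m2 m3) (m3 := product_sfm m3 m2)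
  (measure_preserving_swap m2 m3) (measure_preserving_id m4).
have H4 := measure_preserving_assoc m3 m2 m4.
have H := measure_preserving_comp (measure_preserving_comp H2 H3) H4.
have H5 := measure_preserving_prod (m2 := product_sfm m2 (product_sfm m3 m4))
  (m4 := product_sfm m3 (product_sfm m2 m4)) (measure_preserving_id m1) H.
have H6 := measure_preserving_assoc_inv m1 m3 (product_sfm m2 m4).
exact: (measure_preserving_comp (measure_preserving_comp H1 H5) H6).
Qed.

Lemma measure_preserving_tcons d (T : measurableType d)
    (mu : {sigma_finite_measure set T -> \bar R}) n :
  measure_preserving (mu \x power_measure mu n) (power_measure mu n.+1) (@tcons d T n).
Proof. by split; first exact: measurable_tcons. Qed.

End product_rearrangement.

(** * Products of particles *)

Section product_system.
Context {R : realType} {m : nat}.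
Local Notation phase := ('rV[R]_m * 'rV[R]_m)%type.
Local Notation state d := (d.-tuple 'rV[R]_m * d.-tuple 'rV[R]_m)%type.
Local Notation mu := (@lebesgue_phase R m).
Local Notation mud d := (@lebesgue_state R m d).

Definition state_cons d (z : phase * state d) : state d.+1 :=
  (tcons (z.1.1, z.2.1), tcons (z.1.2, z.2.2)).

Lemma state_cons_preserving d :
  measure_preserving (mu \x mud d)%E (mud d.+1) (@state_cons d).
Proof.
pose l := @lebesgue_rV R m; pose p := power_measure l.
have H := measure_preserving_prod (m1 := product_sfm l (p d)) (m2 := product_sfm l (p d))
  (m3 := p d.+1) (m4 := p d.+1) (measure_preserving_tcons l d) (measure_preserving_tcons l d).
exact: (measure_preserving_comp (measure_preserving_swap4 l l (p d) (p d)) H).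
Qed.

Let sigma_mu := product_sfm (@lebesgue_rV R m) (@lebesgue_rV R m).
Let sigma_mud d := product_sfm (power_measure (@lebesgue_rV R m) d)
  (power_measure (@lebesgue_rV R m) d).

Definition particle (lambda : nat -> R) d (s : state d) (i : 'I_d) : phase :=
  rescale (lambda i)^-1 (tnth s.1 i, tnth s.2 i).

Lemma measurable_rescale l : measurable_fun setT (@rescale R m l).
Proof.
by apply: measurable_fun_pair; apply: measurable_fun_rV => i;
  under eq_fun do rewrite mxE; apply: measurable_funM => //;
  apply: (measurableT_comp (f := fun v : 'rV[R]_m => v ord0 i)) => //;
  exact: measurable_rV_coord.
Qed.

Lemma measurable_particle lambda d (i : 'I_d) :
  measurable_fun setT (fun s : state d => particle lambda s i).
Proof.
apply: (measurableT_comp (f := @rescale R m (lambda i)^-1)); first exact: measurable_rescale.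
apply: measurable_fun_pair.
  by apply: (measurableT_comp (f := fun t : d.-tuple 'rV[R]_m => tnth t i)) => //; exact: measurable_tnth.
by apply: (measurableT_comp (f := fun t : d.-tuple 'rV[R]_m => tnth t i)) => //; exact: measurable_tnth.
Qed.

Variables (X H : phase -> R).
Hypotheses (mX : measurable_fun setT X) (mH : measurable_fun setT H).

Definition particle_sum (F : phase -> R) lambda d (s : state d) : R :=
  \sum_(i < d) F (particle lambda s i).

Lemma measurable_particle_sum F lambda d : measurable_fun setT F ->
  measurable_fun setT (@particle_sum F lambda d).
Proof.
move=> mF; apply: measurable_sum => i; apply: (measurableT_comp mF).
exact: measurable_particle.
Qed.

Lemma particle_sum_cons F lambda d (z : phase * state d) :
  particle_sum F lambda (state_cons z) =
  F (rescale (lambda 0%N)^-1 z.1) + particle_sum F (fun i => lambda i.+1) z.2.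
Proof.
rewrite /particle_sum big_ord_recl/= /particle/= !tnth0; case: z => -[q p] [Q P] /=.
by congr (_ + _); apply: eq_bigr => i _; rewrite !tnthS.
Qed.

Lemma measurable_weighted lambda d (g : R -> R) : measurable_fun setT g ->
  measurable_fun setT
    (fun s : state d => (g (particle_sum X lambda s) * expR (- particle_sum H lambda s))%:E).
Proof.
move=> mg; apply/measurable_EFinP; apply: measurable_funM.
  by apply: (measurableT_comp (f := g) (g := @particle_sum X lambda d)) => //; exact: measurable_particle_sum.
apply: measurableT_comp => //; apply: measurableT_comp => //; exact: measurable_particle_sum.
Qed.

(** The unnormalised expectation of g at the total error. As an integral of nonnegative functions in
    the cases of interest, it obeys Tonelli's theorem with no integrability to check; the division
    by Z^d comes at the very end. *)
Definition weight lambda d (g : R -> R) : \bar R :=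
  (\int[mud d]_s (g (particle_sum X lambda s) * expR (- particle_sum H lambda s))%:E)%E.

Lemma weight0 lambda (g : R -> R) : measurable_fun setT g -> (forall x, 0 <= g x) ->
  weight lambda 0 g = (g 0)%:E.
Proof.
move=> mg g0; rewrite /weight /lebesgue_state.
under eq_integral do rewrite /particle_sum !big_ord0 oppr0 expR0 mulr1.
rewrite integral_cst//= -[X in (_ * _ X)%E]setXTT product_measure1E//=.
by rewrite diracT !mule1.
Qed.

Let integrand lambda d (g : R -> R) (zs : phase * state d) : \bar R :=
  (g (X zs.1 + particle_sum X lambda zs.2) * (expR (- H zs.1) * expR (- particle_sum H lambda zs.2)))%:E.

Let measurable_integrand lambda d (g : R -> R) : measurable_fun setT g ->
  measurable_fun setT (@integrand lambda d g).
Proof.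
move=> mg; apply/measurable_EFinP; apply: measurable_funM.
  apply: (measurableT_comp mg); apply: measurable_funD; first exact: measurableT_comp.
  by apply: (measurableT_comp (f := @particle_sum X lambda d) (g := snd)) => //; exact: measurable_particle_sum.
apply: measurable_funM; apply: measurableT_comp => //; apply: measurableT_comp => //.
  exact: measurableT_comp.
by apply: (measurableT_comp (f := @particle_sum H lambda d) (g := snd)) => //; exact: measurable_particle_sum.
Qed.

Let integral_integrand lambda d (g : R -> R) z : measurable_fun setT g -> (forall x, 0 <= g x) ->
  (\int[mud d]_s integrand lambda g (z, s) =
  (expR (- H z))%:E * weight lambda d (fun x => g (X z + x)%R))%E.
Proof.
move=> mg g0; rewrite /weight -ge0_integralZl//=.
- by apply: eq_integral => s _; rewrite -EFinM mulrCA.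
- have mgz : measurable_fun setT (fun x => g (X z + x)%R).
    by apply: measurableT_comp => //; exact: measurable_funD.
  exact: (@measurable_weighted lambda d _ mgz).
- by move=> s _; rewrite lee_fin mulr_ge0// expR_ge0.
Qed.

(** The function of z is a partial integral of the jointly measurable [integrand]. *)
Lemma measurable_weight lambda d (g : R -> R) : measurable_fun setT g -> (forall x, 0 <= g x) ->
  measurable_fun setT (fun z => (expR (- H z))%:E * weight lambda d (fun x => g (X z + x)%R))%E.
Proof.
move=> mg g0; under eq_fun do rewrite -integral_integrand//.
apply: (@measurable_fun_fubini_tonelli_F _ _ _ _ _ (sigma_mud d) (integrand lambda g)) => //.
  exact: measurable_integrand.
by move=> zs; rewrite lee_fin !mulr_ge0// expR_ge0.
Qed.

(** Tonelli's theorem after splitting off the first particle. Its scaling disappears by the volume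
    preserving substitution [rescale], so only the shifted sequence of scalings remains. *)
Lemma weightS lambda d (g : R -> R) : (forall i, 0 < lambda i) ->
  measurable_fun setT g -> (forall x, 0 <= g x) ->
  (weight lambda d.+1 g = \int[mu]_z ((expR (- H z))%:E *
    weight (fun i => lambda i.+1) d (fun x => g (X z + x)%R)))%E.
Proof.
move=> l0 mg g0; rewrite [LHS]/weight.
rewrite -(ge0_integral_measure_preserving (mu1 := product_sfm sigma_mu (sigma_mud d))
  (mu2 := sigma_mud d.+1) (state_cons_preserving d)); last 2 first.
- exact: measurable_weighted.
- by move=> s; rewrite lee_fin mulr_ge0// expR_ge0.
under eq_integral do rewrite !particle_sum_cons opprD expRD.
pose r := rescale (m := m) (lambda 0%N)^-1.
rewrite (@fubini_tonelli1 _ _ _ _ _ sigma_mu (sigma_mud d) (fun zs => integrand (fun i => lambda i.+1) g (r zs.1, zs.2)))//=.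
- have l00 : (lambda 0%N)^-1 != 0 by rewrite invr_neq0// gt_eqF.
  rewrite -(ge0_integral_measure_preserving (mu1 := sigma_mu) (mu2 := sigma_mu)
    (F := fun z => ((expR (- H z))%:E *
      weight (fun i => lambda i.+1) d (fun x => g (X z + x)%R))%E)
    (@rescale_preserving R m _ l00)); last 2 first.
  + exact: measurable_weight.
  + move=> z; rewrite mule_ge0 ?lee_fin ?expR_ge0//.
    by apply: integral_ge0 => s _; rewrite lee_fin mulr_ge0// expR_ge0.
  by apply: eq_integral => z _; rewrite /fubini_F/= integral_integrand.
- apply: (measurableT_comp (measurable_integrand _ mg)).
  apply: measurable_fun_pair => //; apply: measurableT_comp => //.
  exact: measurable_rescale.
- by move=> zs; rewrite lee_fin !mulr_ge0// expR_ge0.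
Qed.

Section weight_bounds.
Variables (Z tau e eps : R) (u : R -> R -> R).
Hypotheses (tau_ge0 : 0 <= tau) (e_ge0 : 0 <= e) (Z_ge0 : 0 <= Z).
Hypotheses (u_ge0 : forall t x, eps <= t -> 0 <= u t x)
  (mu_ : forall t, eps <= t -> measurable_fun setT (u t)).
Hypothesis int_H : (\int[mu]_z (expR (- H z))%:E = Z%:E)%E.

Let mu_shift (t s : R) (f : phase -> R) : eps <= t -> measurable_fun setT f ->
  measurable_fun setT (fun z => u t (s + f z)).
Proof. by move=> te mf; apply: measurableT_comp; [exact: mu_|exact: measurable_funD]. Qed.

Let mu_shift0 (t s : R) : eps <= t -> measurable_fun setT (fun x : R => u t (s + x)).
Proof. by move=> te; apply: measurableT_comp; [exact: mu_|exact: measurable_funD]. Qed.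

Let shiftE t s a : (fun x => u t (s + (a + x))) = (fun x => u t (s + a + x)).
Proof. by apply/funext => x; rewrite addrA. Qed.

Let mexpH : measurable_fun setT (fun z => (expR (- H z))%:E).
Proof. by apply/measurable_EFinP; apply: measurableT_comp => //; exact: measurableT_comp. Qed.

Let int_cH c : 0 <= c -> (\int[mu]_z (c * expR (- H z))%:E = (c * Z)%:E)%E.
Proof.
move=> c0; under eq_integral do rewrite EFinM.
by rewrite ge0_integralZl_EFin//= ?int_H.
Qed.

Let eps_step t d : eps <= t -> eps <= t + d%:R * tau.
Proof. by move=> te; rewrite ler_wpDr// mulr_ge0. Qed.

(** Each particle costs e and advances the time by tau. In the induction the error of the first
    particle becomes part of the shift, hence the generality in s; the other d particles are
    replaced first, and the first one is then replaced at time t + d tau. *)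
Lemma weight_upper lambda d t s : (forall i, 0 < lambda i) -> eps <= t ->
  (forall t s, eps <= t ->
    (\int[mu]_z (u t (s + X z) * expR (- H z))%:E <= (Z * (u (t + tau) s + e))%:E)%E) ->
  (weight lambda d (fun x => u t (s + x)%R) <=
    (Z ^+ d * (u (t + d%:R * tau) s + d%:R * e))%:E)%E.
Proof.
move=> + te step; elim: d => [|d IH] in lambda s * => l0.
  rewrite weight0//; last 2 first.
  - exact: mu_shift0.
  - by move=> x; exact: u_ge0.
  by rewrite expr0 mul1r !mul0r !addr0.
rewrite weightS//; last 2 first.
- exact: mu_shift0.
- by move=> x; exact: u_ge0.
have te' := eps_step d te.
apply: (@le_trans _ _ (\int[mu]_z ((Z ^+ d)%:E *
    ((u (t + d%:R * tau) (s + X z) * expR (- H z))%:E + (d%:R * e * expR (- H z))%:E))%E)%E).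
  apply: ge0_le_integral => //.
  - move=> z _; rewrite mule_ge0 ?lee_fin ?expR_ge0//.
    by apply: integral_ge0 => x _; rewrite lee_fin mulr_ge0 ?expR_ge0 ?u_ge0.
  - apply: (@measurable_weight (fun i => lambda i.+1) d (fun x => u t (s + x))).
      exact: mu_shift0.
    by move=> x; exact: u_ge0.
  - apply: measurable_funeM; apply: emeasurable_funD; apply/measurable_EFinP.
      by apply: measurable_funM; [exact: mu_shift|exact/measurable_EFinP].
    by apply: measurable_funM => //; exact/measurable_EFinP.
  - move=> z _; rewrite -EFinD -mulrDl -EFinM mulrA mulrC EFinM.
    apply: lee_wpmul2l; first by rewrite lee_fin expR_ge0.
    rewrite shiftE.
    by apply: IH => i; exact: l0.
rewrite ge0_integralZl_EFin ?exprn_ge0//; last 2 first.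
- by move=> z _; rewrite adde_ge0 ?lee_fin ?mulr_ge0 ?expR_ge0 ?u_ge0.
- apply: emeasurable_funD; apply/measurable_EFinP.
    by apply: measurable_funM; [exact: mu_shift|exact/measurable_EFinP].
  by apply: measurable_funM => //; exact/measurable_EFinP.
rewrite ge0_integralD//; last 4 first.
- by move=> z _; rewrite lee_fin mulr_ge0 ?expR_ge0 ?u_ge0.
- by apply/measurable_EFinP; apply: measurable_funM; [exact: mu_shift|exact/measurable_EFinP].
- by move=> z _; rewrite lee_fin !mulr_ge0 ?expR_ge0.
- by apply/measurable_EFinP; apply: measurable_funM => //; exact/measurable_EFinP.
rewrite int_cH ?mulr_ge0//.
apply: (@le_trans _ _ ((Z ^+ d)%:E * ((Z * (u (t + d%:R * tau + tau) s + e))%:E + (d%:R * e * Z)%:E))%E).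
  by apply: lee_wpmul2l; [rewrite lee_fin exprn_ge0|apply: leeD => //; exact: step].
rewrite -EFinD -EFinM lee_fin exprSr -mulrA -natr1.
rewrite (_ : t + (d%:R + 1) * tau = t + d%:R * tau + tau); last by ring.
by rewrite le_eqVlt; apply/orP; left; apply/eqP; ring.
Qed.

(** The same induction. The errors stand on the larger side, so that nothing is subtracted in the
    extended reals. *)
Lemma weight_lower lambda d t s : (forall i, 0 < lambda i) -> eps <= t ->
  (forall t s, eps <= t ->
    ((Z * u (t + tau) s)%:E <= \int[mu]_z (u t (s + X z) * expR (- H z))%:E + (Z * e)%:E)%E) ->
  ((Z ^+ d * u (t + d%:R * tau) s)%:E <=
    weight lambda d (fun x => u t (s + x)%R) + (Z ^+ d * (d%:R * e))%:E)%E.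
Proof.
move=> + te step; elim: d => [|d IH] in lambda s * => l0.
  rewrite weight0//; last 2 first.
  - exact: mu_shift0.
  - by move=> x; exact: u_ge0.
  by rewrite expr0 !mul1r !mul0r -EFinD !addr0.
rewrite weightS//; last 2 first.
- exact: mu_shift0.
- by move=> x; exact: u_ge0.
have te' := eps_step d te.
have mW : measurable_fun setT (fun z => (expR (- H z))%:E *
    weight (fun i => lambda i.+1) d (fun x => u t (s + (X z + x))%R))%E.
  apply: (@measurable_weight (fun i => lambda i.+1) d (fun x => u t (s + x))).
    exact: mu_shift0.
  by move=> x; exact: u_ge0.
have W0 z : (0 <= (expR (- H z))%:E *
    weight (fun i => lambda i.+1) d (fun x => u t (s + (X z + x))%R))%E.
  rewrite mule_ge0 ?lee_fin ?expR_ge0//.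
  by apply: integral_ge0 => x _; rewrite lee_fin mulr_ge0 ?expR_ge0 ?u_ge0.
have mE : measurable_fun setT (fun z => (Z ^+ d * (d%:R * e) * expR (- H z))%:E).
  by apply/measurable_EFinP; apply: measurable_funM => //; exact/measurable_EFinP.
have int_le : ((Z ^+ d)%:E * \int[mu]_z (u (t + d%:R * tau) (s + X z) * expR (- H z))%:E <=
    \int[mu]_z ((expR (- H z))%:E *
      weight (fun i => lambda i.+1) d (fun x => u t (s + (X z + x))%R)) +
    (Z ^+ d * (d%:R * e) * Z)%:E)%E.
  have muX : measurable_fun setT (fun z => (u (t + d%:R * tau) (s + X z) * expR (- H z))%:E).
    by apply/measurable_EFinP; apply: measurable_funM; [exact: mu_shift|exact/measurable_EFinP].
  have muX0 z : (0 <= (u (t + d%:R * tau) (s + X z) * expR (- H z))%:E)%E.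
    by rewrite lee_fin mulr_ge0 ?expR_ge0 ?u_ge0.
  rewrite -int_cH ?mulr_ge0 ?exprn_ge0// -ge0_integralZl_EFin ?exprn_ge0//.
  rewrite -ge0_integralD//; last first.
    by move=> z _; rewrite lee_fin !mulr_ge0 ?exprn_ge0 ?expR_ge0.
  apply: ge0_le_integral => //.
  - by move=> z _; rewrite mule_ge0// lee_fin exprn_ge0.
  - exact: measurable_funeM.
  - exact: emeasurable_funD.
  - move=> z _; rewrite [X in (_ + X)%E]EFinM [X in (_ + X)%E]muleC.
    have -> : ((Z ^+ d)%:E * (u (t + d%:R * tau) (s + X z) * expR (- H z))%:E =
        (expR (- H z))%:E * (Z ^+ d * u (t + d%:R * tau) (s + X z))%:E)%E.
      by rewrite -!EFinM; congr (_%:E); ring.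
    rewrite -ge0_muleDr//; last 2 first.
    + by apply: integral_ge0 => x _; rewrite lee_fin mulr_ge0 ?expR_ge0 ?u_ge0.
    + by rewrite lee_fin !mulr_ge0 ?exprn_ge0.
    apply: lee_wpmul2l; first by rewrite lee_fin expR_ge0.
    by rewrite shiftE; apply: IH => i; exact: l0.
have Zd0 : (0 <= (Z ^+ d)%:E)%E by rewrite lee_fin exprn_ge0.
have := lee_wpmul2l Zd0 (step _ s te').
rewrite ge0_muleDr ?lee_fin ?mulr_ge0//; last first.
  by apply: integral_ge0 => z _; rewrite lee_fin mulr_ge0 ?expR_ge0 ?u_ge0.
move=> H1; have := le_trans H1 (leeD int_le (lexx _)).
rewrite -addeA -!EFinM -EFinD.
rewrite exprSr -!mulrA -natr1 (_ : t + (d%:R + 1) * tau = t + d%:R * tau + tau); last by ring.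
move=> /le_trans; apply; apply: leeD => //; rewrite lee_fin.
by rewrite le_eqVlt; apply/orP; left; apply/eqP; ring.
Qed.

End weight_bounds.

End product_system.

(** * One-variable calculus *)

Section derivative_rules.
Context {R : realType}.
Implicit Types (f g : R -> R) (x : R).

(** Derivatives are assembled as terms from the pointwise rules that follow; this lemma then
    exchanges the computed value for the desired one, leaving an identity to [ring] or [field]. *)
Lemma is_derive1_eq f x a b : is_derive x (1 : R) f a -> a = b -> is_derive x (1 : R) f b.
Proof. by move=> ? <-. Qed.

Lemma is_derive1_mul f g x a b : is_derive x (1 : R) f a -> is_derive x (1 : R) g b ->
  is_derive x (1 : R) (fun y => f y * g y) (f x * b + g x * a).
Proof. by move=> df dg; exact: is_deriveM. Qed.

Lemma is_derive1_add f g x a b : is_derive x (1 : R) f a -> is_derive x (1 : R) g b ->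
  is_derive x (1 : R) (fun y => f y + g y) (a + b).
Proof. by move=> df dg; exact: is_deriveD. Qed.

Lemma is_derive1_opp f x a : is_derive x (1 : R) f a ->
  is_derive x (1 : R) (fun y => - f y) (- a).
Proof. by move=> df; exact: is_deriveN. Qed.

Lemma is_derive1_circ f g x a b : is_derive (g x) (1 : R) f a ->
  is_derive x (1 : R) g b -> is_derive x (1 : R) (fun y => f (g y)) (a * b).
Proof. by move=> df dg; exact: is_derive1_comp. Qed.

Lemma is_derive1_cst (c x : R) : is_derive x (1 : R) (fun _ : R => c) 0.
Proof. exact: is_derive_cst. Qed.

Lemma is_derive1_id x : is_derive x (1 : R) (fun y => y) 1.
Proof. exact: is_derive_id. Qed.

Lemma is_derive1_inv x : x != 0 -> is_derive x (1 : R) (fun y => y^-1) (- (x ^- 2)).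
Proof.
move=> x0; have := @is_deriveV R id x 1 1 x0 (is_derive_id _ _).
by move=> H; apply: (is_derive1_eq H); exact: mulr1.
Qed.

Lemma derive_le_dist f (df : R -> R) (a b K : R) :
  (forall x, x \in `[Num.min a b, Num.max a b] -> is_derive x (1 : R) f (df x)) ->
  (forall x, x \in `[Num.min a b, Num.max a b] -> `|df x| <= K) ->
  `|f b - f a| <= K * `|b - a|.
Proof.
wlog ab : a b / a <= b => [H|].
  case/orP: (le_total a b) => ab; first exact: H.
  by rewrite minC maxC [`|f b - _|]distrC [`|b - a|]distrC; exact: H.
rewrite (min_idPl ab) (max_idPr ab) => fdf dfK.
have fdf' (x : R) : x \in `]a, b[ -> is_derive x 1 f (df x).
  by rewrite in_itv/= => /andP[/ltW ax /ltW xb]; apply: fdf; rewrite in_itv/= ax xb.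
have [|c cab ->] := @MVT_segment R f df a b ab fdf'.
  apply: derivable_within_continuous => x xab.
  by have [] := fdf x xab.
by rewrite normrM ler_wpM2r// dfK.
Qed.

End derivative_rules.

(** * The smoothed Metropolis function *)

Section normal_cdf.
Context {R : realType}.

Definition Phi (x : R) : R := fine (normal_prob 0 1 `]-oo, x]).

Definition phi (x : R) : R := normal_pdf 0 1 x.

Lemma Phi_fin x : (Phi x)%:E = normal_prob 0 1 `]-oo, x].
Proof. by rewrite /Phi fineK// fin_num_measure. Qed.

Lemma phiE x : phi x = normal_peak 1 * expR (- (x ^+ 2 / 2)).
Proof.
rewrite /phi normal_pdfE ?oner_eq0// /normal_fun subr0 expr1n.
by congr (_ * expR _); rewrite mulNr.
Qed.

Lemma phi_ge0 x : 0 <= phi x.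
Proof. exact: normal_pdf_ge0. Qed.

Lemma normal_peak_le1 : normal_peak (1 : R) <= 1.
Proof.
have pi1 : 1 <= pi *+ 2 :> R by have := pi_ge2 R; rewrite mulr2n; lra.
rewrite /normal_peak expr1n mul1r invf_le1 ?sqrtr_gt0; last exact: lt_le_trans pi1.
by rewrite -[leLHS]sqrtr1; exact: ler_wsqrtr.
Qed.

Lemma expRN_le_inv (y : R) : 0 <= y -> (1 + y) * expR (- y) <= 1.
Proof.
move=> y0; rewrite expRN ler_pdivrMr ?expR_gt0// mul1r.
exact: expR_ge1Dx.
Qed.

Lemma phi_le1 x : phi x <= 1.
Proof.
rewrite phiE -[leRHS]mulr1 ler_pM ?normal_peak_ge0 ?expR_ge0 ?normal_peak_le1//.
by rewrite expR_le1 oppr_le0 divr_ge0// sqr_ge0.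
Qed.

(** A crude bound, from (1 + y) e^(-y) <= 1 at y = x^2 / 2. *)
Lemma sqr_phi_le2 x : x ^+ 2 * phi x <= 2.
Proof.
have y0 : 0 <= x ^+ 2 / 2 by rewrite divr_ge0// sqr_ge0.
have := expRN_le_inv y0; have := expR_ge0 (- (x ^+ 2 / 2)).
rewrite phiE; have := normal_peak_le1; have := normal_peak_ge0 (1 : R).
set p := normal_peak _; set E := expR _; move: (x ^+ 2) y0 => y; nra.
Qed.

(** From 2 |x| <= x^2 + 1 and the two preceding bounds. *)
Lemma norm_mul_phi_le2 x : `|x| * phi x <= 2.
Proof.
have := sqr_phi_le2 x; have := phi_le1 x; have := phi_ge0 x.
rewrite -[x ^+ 2]real_normK ?num_real//; have := normr_ge0 x.
set a := `|x|; set f := phi x => a0 f0 f1 H.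
have : 0 <= (a - 1) ^+ 2 * f by rewrite mulr_ge0// sqr_ge0.
by nra.
Qed.

Lemma Phi_ge0 x : 0 <= Phi x.
Proof. by rewrite fine_ge0. Qed.

Lemma Phi_le1 x : Phi x <= 1.
Proof. by rewrite -lee_fin Phi_fin; exact: probability_le1. Qed.

Lemma is_derive_Phi x : is_derive x (1 : R) Phi (phi x).
Proof.
have cphi : continuous (normal_pdf (0 : R) 1) by apply: continuous_normal_pdf; rewrite oner_eq0.
have xu : x < x + 1 by rewrite ltrDl.
have iphi : (@lebesgue_measure R).-integrable `]-oo, (x + 1)] (EFin \o normal_pdf 0 1).
  by apply: integrableS (integrable_normal_pdf 0 1).
have [D DE] := @continuous_FTC1 R (normal_pdf 0 1) -oo%O x (x + 1) xu iphi (ltNyr _) (cphi x).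
by apply: DeriveDef => //; rewrite -derive1E.
Qed.

Lemma is_derive_phi x : is_derive x (1 : R) phi (- x * phi x).
Proof.
have -> : phi = (fun x => normal_peak 1 * expR (- (x * x * 2^-1))).
  by apply/funext => y; rewrite phiE expr2.
have d2 := is_derive1_mul (is_derive1_mul (is_derive1_id x) (is_derive1_id x)) (is_derive1_cst 2^-1 x).
have := is_derive1_mul (is_derive1_cst (normal_peak 1) x)
  (is_derive1_circ (is_derive_expR _) (is_derive1_opp d2)).
by move/is_derive1_eq; apply; rewrite /= ; field.
Qed.

Lemma Phi_le x y : x <= y -> Phi x <= Phi y.
Proof.
move=> xy; rewrite -lee_fin !Phi_fin; apply: le_measure; rewrite ?inE//.
by move=> z /=; rewrite !in_itv/= => /le_trans; apply.
Qed.

(** Continuity of the measure gives both limits along the integers, and monotonicity of [Phi]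
    extends them to all reals. *)
Lemma Phi_tails (e : R) : 0 < e -> exists2 M : R, 0 < M &
  (forall y, M <= y -> 1 - e <= Phi y) /\ (forall y, y <= - M -> Phi y <= e).
Proof.
move=> e0.
have up : (fun n => Phi n%:R) @ \oo --> (1 : R).
  suff : (fun n => Phi n%:R) @ \oo --> fine (normal_prob (0 : R) 1 (\bigcup_n `]-oo, n%:R]%classic)).
    rewrite (_ : \bigcup_n _ = setT); first by rewrite probability_setT.
    apply/seteqP; split => // x _; exists (Num.truncn `|x|).+1 => //=.
    by rewrite in_itv/= (le_trans (ler_norm x))// ltW// truncnS_gt.
  apply: fine_cvg; rewrite fineK ?fin_num_measure//; last exact: bigcupT_measurable.
  apply: (@nondecreasing_cvg_mu _ _ _ (normal_prob (0 : R) 1) (fun n => `]-oo, n%:R]%classic)) => //.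
    exact: bigcupT_measurable.
  move=> n m nm; apply/subsetPset => x /=; rewrite !in_itv/= => /le_trans; apply.
  by rewrite ler_nat.
have lo : (fun n => Phi (- n%:R)) @ \oo --> (0 : R).
  suff : (fun n => Phi (- n%:R)) @ \oo --> fine (normal_prob (0 : R) 1 (\bigcap_n `]-oo, (- n%:R)]%classic)).
    rewrite (_ : \bigcap_n _ = set0); first by rewrite measure0.
    apply/seteqP; split => // x /(_ (Num.truncn `|x|).+1 I) /=.
    rewrite in_itv/= leNgt => /negP; apply.
    by rewrite ltrNl (le_lt_trans (ler_norm _))// normrN truncnS_gt.
  apply: fine_cvg; rewrite fineK ?fin_num_measure//; last exact: bigcapT_measurable.
  apply: (@nonincreasing_cvg_mu _ _ _ (normal_prob (0 : R) 1) (fun n => `]-oo, (- n%:R)]%classic)) => //.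
  - by rewrite ltey_eq fin_num_measure.
  - exact: bigcapT_measurable.
  move=> n m nm; apply/subsetPset => x /=; rewrite !in_itv/= => /le_trans; apply.
  by rewrite lerN2 ler_nat.
near \oo => n.
have nn : n%:R <= n.+1%:R :> R by rewrite ler_nat.
exists n.+1%:R => //; split => y ny.
- apply: le_trans (Phi_le (le_trans nn ny)).
  by near: n; apply: (cvgr_ge _ up); rewrite ltrBlDr ltrDl.
- have nn' : - n.+1%:R <= - n%:R :> R by rewrite lerN2.
  apply: le_trans (Phi_le (le_trans ny nn')) _.
  by near: n; exact: (cvgr_le _ lo).
Unshelve. all: by end_near. Qed.

End normal_cdf.

Section heat_solution.
Context {R : realType}.
Implicit Types r x t : R.

(* E(min(1, e^(-Y))) for Y of law N(x + r^2 / 2, r^2). *)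
Definition smoothed r x : R :=
  Phi (- (x / r + r / 2)) + expR (- x) * Phi (x / r - r / 2).

(** The point 0 standardised for N(x + r^2 / 2, r^2), so that [Phi (lower_arg r x)] is the
    probability of Y <= 0. *)
Definition lower_arg r x : R := - (x / r + r / 2).

(** The contribution E(e^(-Y); Y > 0) to [smoothed], and also minus its x-derivative. *)
Definition right_part r x : R := expR (- x) * Phi (x / r - r / 2).

(** Completing the square: (x / r - r / 2)^2 + 2 x = (x / r + r / 2)^2. This identity makes the
    Gaussian terms cancel in the derivatives of [smoothed]. *)
Lemma phi_shift r x : r != 0 ->
  expR (- x) * phi (x / r - r / 2) = phi (lower_arg r x).
Proof.
move=> r0; rewrite !phiE mulrCA -expRD; congr (_ * expR _).
by rewrite /lower_arg; field.
Qed.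

Lemma right_part_ge0 r x : 0 <= right_part r x.
Proof. by rewrite mulr_ge0 ?expR_ge0 ?Phi_ge0. Qed.

Lemma smoothed_ge0 r x : 0 <= smoothed r x.
Proof. by rewrite addr_ge0 ?Phi_ge0 ?right_part_ge0. Qed.

Lemma right_part_le r x : right_part r x <= smoothed r x.
Proof. by rewrite lerDr Phi_ge0. Qed.

Lemma is_derive_lower_arg r x :
  is_derive x (1 : R) (fun y => lower_arg r y) (- r^-1).
Proof.
have := is_derive1_opp (is_derive1_add
  (is_derive1_mul (is_derive1_id x) (is_derive1_cst r^-1 x)) (is_derive1_cst (r / 2) x)).
by move/is_derive1_eq; apply; rewrite mulr0 mulr1 add0r addr0.
Qed.

Lemma is_derive_right_part r x : r != 0 ->
  is_derive x (1 : R) (right_part r) (phi (lower_arg r x) / r - right_part r x).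
Proof.
move=> r0.
have dE := is_derive1_circ (is_derive_expR (- x)) (is_derive1_opp (is_derive1_id x)).
have db := is_derive1_add (is_derive1_mul (is_derive1_id x) (is_derive1_cst r^-1 x))
  (is_derive1_cst (- (r / 2)) x).
have := is_derive1_mul dE (is_derive1_circ (is_derive_Phi _) db).
move/is_derive1_eq; apply; rewrite -phi_shift// /right_part; ring.
Qed.

Lemma is_derive_phi_lower_arg r x :
  is_derive x (1 : R) (fun y => phi (lower_arg r y))
    (lower_arg r x * phi (lower_arg r x) / r).
Proof.
have := is_derive1_circ (is_derive_phi _) (is_derive_lower_arg r x).
by move/is_derive1_eq; apply; ring.
Qed.

Lemma is_derive_smoothed r x : r != 0 ->
  is_derive x (1 : R) (smoothed r) (- right_part r x).
Proof.
move=> r0.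
have := is_derive1_add (is_derive1_circ (is_derive_Phi _) (is_derive_lower_arg r x))
  (is_derive_right_part x r0).
by move/is_derive1_eq; apply; ring.
Qed.

Lemma is_derive_lower_arg_r r x : r != 0 ->
  is_derive r (1 : R) (fun s => lower_arg s x) (x / r ^+ 2 - 2^-1).
Proof.
move=> r0; have := is_derive1_opp (is_derive1_add
  (is_derive1_mul (is_derive1_cst x r) (is_derive1_inv r0))
  (is_derive1_mul (is_derive1_id r) (is_derive1_cst 2^-1 r))).
by move/is_derive1_eq; apply; field.
Qed.

(** By [phi_shift] the terms in x / r^2 cancel and the two halves add up. With t = r^2 the time
    derivative is -phi / (2 r), which is half of u'' + u'. *)
Lemma is_derive_smoothed_r r x : r != 0 ->
  is_derive r (1 : R) (fun s => smoothed s x) (- phi (lower_arg r x)).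
Proof.
move=> r0.
have db := is_derive1_add (is_derive1_mul (is_derive1_cst x r) (is_derive1_inv r0))
  (is_derive1_opp (is_derive1_mul (is_derive1_id r) (is_derive1_cst 2^-1 r))).
have := is_derive1_add
  (is_derive1_circ (is_derive_Phi _) (is_derive_lower_arg_r x r0))
  (is_derive1_mul (is_derive1_cst (expR (- x)) r) (is_derive1_circ (is_derive_Phi _) db)).
move/is_derive1_eq; apply.
rewrite -(phi_shift x r0) mulr0 addr0; field.
exact: r0.
Qed.

Lemma smoothed_lipschitz_r r s x : 0 < r -> 0 < s ->
  `|smoothed s x - smoothed r x| <= `|s - r|.
Proof.
move=> r0 s0; rewrite -[leRHS]mul1r.
apply: (@derive_le_dist R (fun s => smoothed s x) (fun s => - phi (lower_arg s x))).
- move=> y; rewrite in_itv/= => /andP[y0 _]; apply: is_derive_smoothed_r.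
  by rewrite gt_eqF// (lt_le_trans _ y0)// lt_min r0.
- by move=> y _; rewrite normrN ger0_norm ?phi_ge0 ?phi_le1.
Qed.

Lemma smoothed_nonincreasing r x y : r != 0 -> x <= y -> smoothed r y <= smoothed r x.
Proof.
move=> r0 xy; rewrite -subr_le0.
have [|c _ ->] := @MVT_segment R (smoothed r) (fun z => - right_part r z) x y xy
    (fun z _ => is_derive_smoothed z r0).
  by apply: derivable_within_continuous => z _; have [] := is_derive_smoothed z r0.
by rewrite mulNr oppr_le0 mulr_ge0 ?right_part_ge0 ?subr_ge0.
Qed.

Definition metropolis x : R := Num.min 1 (expR (- x)).

Lemma metropolis_ge0 x : 0 <= metropolis x.
Proof. by rewrite le_min ler01 expR_ge0. Qed.

Lemma measurable_metropolis : measurable_fun setT metropolis.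
Proof.
by apply: measurable_minr => //; apply: measurableT_comp => //.
Qed.

(** [smoothed s x] tends to [metropolis x] as s tends to 0, and [smoothed] is 1-Lipschitz in its
    first argument. *)
Let smoothed_near_neq0 r x : 0 < r -> x != 0 -> `|smoothed r x - metropolis x| <= r.
Proof.
move=> r0 x0; apply/ler_addgt0Pr => e e0.
(* The factor e^(-|x|) compensates the e^(-x) that multiplies a tail of [Phi] when x < 0. *)
have e'0 : 0 < e / 2 * expR (- `|x|) by rewrite mulr_gt0 ?expR_gt0 ?divr_gt0.
have [M M0 [Mup Mlo]] := Phi_tails e'0.
have expx : expR (- `|x|) <= 1 by rewrite expR_le1 oppr_le0.
have M1 : 0 < M + 1 by rewrite addr_gt0.
(* With |x| / s >= M + 1 and s <= 1, both arguments of [Phi] are beyond M in absolute value even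
   after the shift by s / 2. *)
pose s := Num.min r (Num.min 1 (`|x| / (M + 1))).
have s0 : 0 < s by rewrite !lt_min r0 ltr01 divr_gt0// normr_gt0.
have sr : s <= r by rewrite ge_min lexx.
have s1 : s <= 1 by rewrite !ge_min lexx orbT.
have xs : M + 1 <= `|x| / s.
  rewrite ler_pdivlMr// mulrC -ler_pdivlMr//.
  by rewrite !ge_min lexx !orbT.
have step : `|smoothed s x - metropolis x| <= e.
  have e'2 : e / 2 * expR (- `|x|) <= e / 2 by rewrite ler_piMr// divr_ge0 ?ltW.
  rewrite /smoothed /metropolis; case: (ltrgt0P x) x0 => // xp _.
  - move: xs expx e'2 Mup Mlo; rewrite gtr0_norm// => xs expx e'2 Mup Mlo.
    rewrite (min_idPr _); last by rewrite expR_le1 oppr_le0 ltW.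
    have := Mlo (- (x / s + s / 2)); have := Mup (x / s - s / 2).
    have := Phi_ge0 (- (x / s + s / 2)); have := Phi_le1 (x / s - s / 2).
    set A := Phi _; set B := Phi _ => A1 B0 HA HB.
    have {}HA : 1 - e / 2 * expR (- x) <= A by apply: HA; lra.
    have {}HB : B <= e / 2 * expR (- x) by apply: HB; lra.
    have := expR_ge0 (- x); move: (expR (- x)) expx e'2 HA HB => E E1 e'2 HA HB E0.
    rewrite ler_norml; apply/andP; split; nra.
  - move: xs expx e'2 Mup Mlo; rewrite ltr0_norm// opprK => xs expx e'2 Mup Mlo.
    rewrite (min_idPl _); last by rewrite -expR0 ler_expR oppr_ge0 ltW.
    have xsN : - x / s = - (x / s) by rewrite mulNr.
    have := Mup (- (x / s + s / 2)); have := Mlo (x / s - s / 2).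
    have := Phi_le1 (- (x / s + s / 2)); have := Phi_ge0 (x / s - s / 2).
    set A := Phi _; set B := Phi _ => A0 B1 HA HB.
    have {}HB : 1 - e / 2 * expR x <= B by apply: HB; lra.
    have {}HA : A <= e / 2 * expR x by apply: HA; lra.
    have HA' : expR (- x) * A <= e / 2.
      apply: le_trans (ler_wpM2l (expR_ge0 _) HA) _.
      by rewrite mulrCA -expRD addNr expR0 mulr1.
    have HA0 : 0 <= expR (- x) * A by rewrite mulr_ge0 ?expR_ge0.
    rewrite ler_norml; apply/andP; split; lra.
have := smoothed_lipschitz_r x s0 r0; rewrite [`|r - s|]ger0_norm ?subr_ge0//.
move=> rs; rewrite -(subrK (smoothed s x) (smoothed r x)) -addrA.
apply: le_trans (ler_normD _ _) _; apply: lerD => //.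
by apply: le_trans rs _; rewrite lerBlDr lerDl ltW.
Qed.

(** At x = 0 the bound is inherited by monotonicity: from small positive points for the lower
    estimate, and from -1, where the Metropolis function already equals 1, for the upper one. *)
Lemma smoothed_near r x : 0 < r -> `|smoothed r x - metropolis x| <= r.
Proof.
move=> r0; have [->|x0] := eqVneq x 0; last exact: smoothed_near_neq0.
have rN0 : r != 0 by rewrite gt_eqF.
rewrite /metropolis oppr0 expR0 minxx ler_norml; apply/andP; split.
  apply/ler_addgt0Pr => e e0.
  have := @smoothed_nonincreasing r 0 e rN0 (ltW e0).
  have := @smoothed_near_neq0 r e r0; rewrite gt_eqF// => /(_ isT).
  rewrite /metropolis (min_idPr _); last by rewrite expR_le1 oppr_le0 ltW.
  have := expR_ge1Dx (- e); rewrite ler_norml => ? /andP[? ?] ?; lra.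
have N10 : -1 <= 0 :> R by rewrite oppr_le0.
have := @smoothed_nonincreasing r (-1) 0 rN0 N10.
have := @smoothed_near_neq0 r (-1) r0; rewrite oppr_eq0 oner_eq0 => /(_ isT).
rewrite /metropolis (min_idPl _); last by rewrite -expR0 ler_expR opprK.
by rewrite ler_norml => /andP[? ?] ?; lra.
Qed.

(** [smoothed] decreases in r, and for small s it is within s of the Metropolis function, which is
    at most 1. *)
Lemma smoothed_le1 r x : 0 < r -> smoothed r x <= 1.
Proof.
move=> r0; apply/ler_addgt0Pr => e e0.
pose s := Num.min r e.
have s0 : 0 < s by rewrite lt_min r0.
have sr : s <= r by rewrite ge_min lexx.
have se : s <= e by rewrite ge_min lexx orbT.
have rs : smoothed r x <= smoothed s x.
  rewrite -subr_le0.
  have d z : z \in `]s, r[ -> is_derive z (1 : R) (fun s => smoothed s x) (- phi (lower_arg z x)).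
    rewrite in_itv/= => /andP[sz _]; apply: is_derive_smoothed_r.
    by rewrite gt_eqF// (lt_trans s0).
  have [|c _ ->] := @MVT_segment R (fun s => smoothed s x) (fun z => - phi (lower_arg z x)) s r sr d.
    apply: derivable_within_continuous => z; rewrite in_itv/= => /andP[sz _].
    have z0 : z != 0 by rewrite gt_eqF// (lt_le_trans s0).
    by have [] := is_derive_smoothed_r x z0.
  by rewrite mulNr oppr_le0 mulr_ge0 ?phi_ge0 ?subr_ge0.
have := smoothed_near x s0; rewrite ler_norml => /andP[_].
have : metropolis x <= 1 by rewrite ge_min lexx.
by lra.
Qed.

Lemma measurable_smoothed r : r != 0 -> measurable_fun setT (smoothed r).
Proof.
move=> r0; apply: continuous_measurable_fun => x.
by apply: differentiable_continuous; apply/derivable1_diffP; have [] := is_derive_smoothed x r0.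
Qed.

(** The mean value bound applied twice, hence K and not K / 2. The hypotheses are confined to the
    segment because the time derivatives are controlled only for t >= rho^2. *)
Lemma taylor1 (f f1 f2 : R -> R) (K x y : R) :
  (forall z, z \in `[Num.min x (x + y), Num.max x (x + y)] -> is_derive z (1 : R) f (f1 z)) ->
  (forall z, z \in `[Num.min x (x + y), Num.max x (x + y)] -> is_derive z (1 : R) f1 (f2 z)) ->
  (forall z, z \in `[Num.min x (x + y), Num.max x (x + y)] -> `|f2 z| <= K) ->
  `|f (x + y) - f x - f1 x * y| <= K * `|y| ^+ 2.
Proof.
move=> d1 d2 HK; pose g z := f z - f1 x * (z - x).
have xI : x \in `[Num.min x (x + y), Num.max x (x + y)].
  by rewrite in_itv/= ge_min lexx le_max lexx.
have := @derive_le_dist R g (fun z => f1 z - f1 x) x (x + y) (K * `|y|).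
have -> : x + y - x = y by ring.
have -> : K * `|y| * `|y| = K * `|y| ^+ 2 by ring.
have -> : g (x + y) - g x = f (x + y) - f x - f1 x * y by rewrite /g; ring.
apply => z zI.
  have := is_derive1_add (d1 z zI) (is_derive1_opp (is_derive1_mul (is_derive1_cst (f1 x) z)
     (is_derive1_add (is_derive1_id z) (is_derive1_cst (- x) z)))).
  by move/is_derive1_eq; apply; ring.
have sub w : w \in `[Num.min x z, Num.max x z] -> w \in `[Num.min x (x + y), Num.max x (x + y)].
  move: xI zI; rewrite !in_itv/= => /andP[x1 x2] /andP[z1 z2] /andP[w1 w2].
  apply/andP; split; first by apply: le_trans w1; rewrite le_min x1.
  by apply: le_trans w2 _; rewrite ge_max x2.
apply: le_trans (derive_le_dist (fun w wI => d2 w (sub w wI)) (fun w wI => HK w (sub w wI))) _.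
apply: ler_wpM2l; first exact: le_trans (HK x xI).
move: zI; rewrite in_itv/= => /andP[]; rewrite ge_min le_max ler_norml.
have [y0|y0] := ler0P y; case/orP => ? /orP[] ?; apply/andP; split; lra.
Qed.

Lemma taylor2 (f f1 f2 f3 : R -> R) (K x y : R) :
  (forall z, is_derive z (1 : R) f (f1 z)) -> (forall z, is_derive z (1 : R) f1 (f2 z)) ->
  (forall z, is_derive z (1 : R) f2 (f3 z)) -> (forall z, `|f3 z| <= K) ->
  `|f (x + y) - f x - f1 x * y - f2 x / 2 * y ^+ 2| <= K * `|y| ^+ 3.
Proof.
move=> d1 d2 d3 HK; pose g z := f z - f1 x * (z - x) - f2 x / 2 * (z - x) ^+ 2.
have := @derive_le_dist R g (fun z => f1 z - f1 x - f2 x * (z - x)) x (x + y) (K * `|y| ^+ 2).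
have -> : g (x + y) - g x = f (x + y) - f x - f1 x * y - f2 x / 2 * y ^+ 2.
  by rewrite /g; ring.
have -> : x + y - x = y by ring.
have -> : K * `|y| ^+ 2 * `|y| = K * `|y| ^+ 3 by ring.
apply => z zI.
  have dz := is_derive1_add (is_derive1_id z) (is_derive1_cst (- x) z).
  have := is_derive1_add (is_derive1_add (d1 z) (is_derive1_opp
    (is_derive1_mul (is_derive1_cst (f1 x) z) dz)))
    (is_derive1_opp (is_derive1_mul (is_derive1_cst (f2 x / 2) z) (is_derive1_mul dz dz))).
  by rewrite /g; under [X in is_derive _ _ X _ -> _]eq_fun do rewrite -expr2;
    move/is_derive1_eq; apply; field.
have := @taylor1 f1 f2 f3 K x (z - x) (fun w _ => d2 w) (fun w _ => d3 w) (fun w _ => HK w).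
rewrite [x + (z - x)]addrC subrK => /le_trans; apply.
apply: ler_wpM2l; first exact: le_trans (HK x).
rewrite lerXn2r ?nnegrE//.
move: zI; rewrite in_itv/= => /andP[]; rewrite ge_min le_max ler_norml.
have [y0|y0] := ler0P y; case/orP => ? /orP[] ?; apply/andP; split; lra.
Qed.

(** c1 and c2 are the first two x-derivatives; the heat equation makes (c1 + c2) / 2 the time
    derivative, which couples the two expansions. C depends on rho alone, as all remainders are
    bounded by powers of 1 / rho uniformly in t and x. *)
Lemma smoothed_expansion rho : 0 < rho -> exists2 C : R, 0 <= C &
  forall t x, rho ^+ 2 <= t -> exists c1 c2 : R, [/\ `|c1| <= 1,
    forall y, `|smoothed (Num.sqrt t) (x + y) - smoothed (Num.sqrt t) x
                - c1 * y - c2 / 2 * y ^+ 2| <= C * `|y| ^+ 3 &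
    forall tau, 0 <= tau -> `|smoothed (Num.sqrt (t + tau)) x
      - smoothed (Num.sqrt t) x - (c1 + c2) / 2 * tau| <= C * tau ^+ 2].
Proof.
move=> rho0.
have i0 : 0 < rho^-1 by rewrite invr_gt0.
(* C1 bounds the third x-derivative, C2 the second time derivative. *)
pose C1 : R := 1 + rho^-1 + 2 * rho^-1 ^+ 2.
pose C2 : R := (2 * rho^-1 ^+ 2 + 2 * rho^-1 + rho^-1 ^+ 2) * rho^-1.
have C10 : 0 <= C1 by rewrite !addr_ge0 ?mulr_ge0 ?exprn_ge0 ?ltW.
have C20 : 0 <= C2 by rewrite mulr_ge0 ?addr_ge0 ?mulr_ge0 ?exprn_ge0 ?ltW.
exists (C1 + C2); first exact: addr_ge0.
move=> t x rt.
have sqrt_gt s : rho ^+ 2 <= s -> rho <= Num.sqrt s.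
  by move=> rs; rewrite -[leLHS]gtr0_norm// -sqrtr_sqr ler_wsqrtr.
have rt' := sqrt_gt _ rt; set r := Num.sqrt t in rt' *.
have r0 : 0 < r by exact: lt_le_trans rt'.
have rN0 : r != 0 by rewrite gt_eqF.
have ir s : rho <= s -> 0 < s^-1 <= rho^-1.
  move=> rs; have s0 : 0 < s by exact: lt_le_trans rs.
  by rewrite invr_gt0 s0/= lef_pV2 ?posrE.
exists (- right_part r x), (right_part r x - phi (lower_arg r x) / r); split.
- rewrite normrN ger0_norm ?right_part_ge0//.
  exact: le_trans (right_part_le _ _) (smoothed_le1 _ r0).
- move=> y; apply: le_trans (_ : C1 * `|y| ^+ 3 <= _); last first.
    by rewrite ler_wpM2r ?exprn_ge0// lerDl.
  apply: (@taylor2 (smoothed r) (fun z => - right_part r z)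
    (fun z => right_part r z - phi (lower_arg r z) / r)
    (fun z => phi (lower_arg r z) / r - right_part r z
       - lower_arg r z * phi (lower_arg r z) / r / r)) => z.
  + exact: is_derive_smoothed.
  + have := is_derive1_opp (is_derive_right_part z rN0).
    by move/is_derive1_eq; apply; ring.
  + have := is_derive1_add (is_derive_right_part z rN0) (is_derive1_opp
      (is_derive1_mul (is_derive_phi_lower_arg r z) (is_derive1_cst r^-1 z))).
    by move/is_derive1_eq; apply; ring.
  + have h1 := norm_mul_phi_le2 (lower_arg r z).
    have h2 := phi_le1 (lower_arg r z); have h3 := phi_ge0 (lower_arg r z).
    have h4 := le_trans (right_part_le r z) (smoothed_le1 z r0).
    have h5 := right_part_ge0 r z; have /andP[j0 j1] := ir _ rt'.
    set p := phi _ in h1 h2 h3 *; set a := lower_arg _ _ in h1 *.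
    have h6 : `|a * p / r / r| <= 2 * rho^-1 ^+ 2.
      rewrite -mulrA -expr2 normrM normrM [`|p|]ger0_norm//.
      rewrite [`|_ ^+ 2|]ger0_norm; last by rewrite exprn_ge0// ltW.
      apply: ler_pM => //.
      - by rewrite mulr_ge0.
      - by rewrite exprn_ge0// ltW.
      - by apply: lerXn2r => //; rewrite nnegrE ltW.
    have h7 : 0 <= p / r <= rho^-1.
      rewrite mulr_ge0 ?(ltW j0)//=; apply: le_trans j1.
      by rewrite ler_piMl// ltW.
    move: h6 h7; rewrite ler_norml => /andP[? ?] /andP[? ?].
    by rewrite /C1 ler_norml; apply/andP; split; lra.
- move=> tau tau0; apply: le_trans (_ : C2 * tau ^+ 2 <= _); last first.
    by rewrite ler_wpM2r ?exprn_ge0// lerDr.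
  have -> : (- right_part r x + (right_part r x - phi (lower_arg r x) / r)) / 2 =
      - phi (lower_arg r x) / (2 * r).
    by field; exact: rN0.
  have -> : C2 * tau ^+ 2 = C2 * `|tau| ^+ 2 by rewrite real_normK ?num_real.
  have tt z : z \in `[Num.min t (t + tau), Num.max t (t + tau)] -> rho ^+ 2 <= z.
    by rewrite in_itv/= (min_idPl _) ?lerDl// => /andP[+ _]; exact: le_trans.
  apply: (@taylor1 (fun s => smoothed (Num.sqrt s) x)
    (fun s => - phi (lower_arg (Num.sqrt s) x) / (2 * Num.sqrt s))
    (fun s => let q := Num.sqrt s in let a := lower_arg q x in
       (phi a / q ^+ 2 - a ^+ 2 * phi a / q ^+ 2 - a * phi a / q) / 2 * (2 * q)^-1)) => z /tt rz.
  + have z0 : 0 < z by apply: lt_le_trans rz; rewrite exprn_gt0.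
    have q0 : Num.sqrt z != 0 by rewrite gt_eqF// sqrtr_gt0.
    have := is_derive1_circ (is_derive_smoothed_r x q0) (is_derive1_sqrt z0).
    by move/is_derive1_eq; apply.
  + have z0 : 0 < z by apply: lt_le_trans rz; rewrite exprn_gt0.
    have q0 : Num.sqrt z != 0 by rewrite gt_eqF// sqrtr_gt0.
    have dq : is_derive (Num.sqrt z) (1 : R) (fun q => - phi (lower_arg q x) / (2 * q))
      (let q := Num.sqrt z in let a := lower_arg q x in
       (phi a / q ^+ 2 - a ^+ 2 * phi a / q ^+ 2 - a * phi a / q) / 2).
      have q20 : 2 * Num.sqrt z != 0 by rewrite mulf_neq0.
      have d2q := is_derive1_mul (is_derive1_cst 2 (Num.sqrt z)) (is_derive1_id (Num.sqrt z)).
      have := is_derive1_mul (is_derive1_opp (is_derive1_circ (is_derive_phi _)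
        (is_derive_lower_arg_r x q0))) (is_derive1_circ (is_derive1_inv q20) d2q).
      move/is_derive1_eq; apply => /=.
      (* Eliminating x in favour of a = [lower_arg] leaves only phi a, a phi a and a^2 phi a, which
         are bounded uniformly in x. *)
      have -> : x / Num.sqrt z ^+ 2 - 2^-1 = - lower_arg (Num.sqrt z) x / Num.sqrt z - 1.
        by rewrite /lower_arg; field.
      by field.
    exact: (is_derive1_circ dq (is_derive1_sqrt z0)).
  + have rq := sqrt_gt _ rz; have /andP[] := ir _ rq.
    rewrite /=; set q := Num.sqrt z; set a := lower_arg q x => j0 j1.
    have j2 : q^-1 ^+ 2 <= rho^-1 ^+ 2 by apply: lerXn2r => //; rewrite nnegrE ltW.
    have j20 : 0 <= q^-1 ^+ 2 by rewrite exprn_ge0// ltW.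
    have h1 : `|a ^+ 2 * phi a / q ^+ 2| <= 2 * rho^-1 ^+ 2.
      have ap0 := mulr_ge0 (sqr_ge0 a) (phi_ge0 a).
      rewrite -exprVn ger0_norm; last exact: mulr_ge0 ap0 j20.
      by apply: ler_pM => //; exact: sqr_phi_le2.
    have h2 : `|a * phi a / q| <= 2 * rho^-1.
      rewrite normrM normrM [`|phi a|]ger0_norm ?phi_ge0// [`|q^-1|]gtr0_norm//.
      apply: ler_pM => //; [by rewrite mulr_ge0 ?phi_ge0|exact: ltW|exact: norm_mul_phi_le2].
    have h3 : `|phi a / q ^+ 2| <= rho^-1 ^+ 2.
      rewrite -exprVn ger0_norm; last exact: mulr_ge0 (phi_ge0 a) j20.
      by rewrite -[leRHS]mul1r; apply: ler_pM => //; [exact: phi_ge0|exact: phi_le1].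
    rewrite normrM /C2; apply: ler_pM => //.
      rewrite normrM [`|2^-1|]ger0_norm ?invr_ge0//.
      have := ler_normB (phi a / q ^+ 2 - a ^+ 2 * phi a / q ^+ 2) (a * phi a / q).
      have := ler_normB (phi a / q ^+ 2) (a ^+ 2 * phi a / q ^+ 2).
      by lra.
    rewrite invfM normrM [`|2^-1|]ger0_norm ?invr_ge0// gtr0_norm//.
    by lra.
Qed.

End heat_solution.

(** * Gibbs weights *)

Section partition.
Context {R : realType}.
Local Notation lam := (@lebesgue_rV R).
Local Open Scope ereal_scope.

Lemma measurable_gaussian n :
  measurable_fun setT (fun v : 'rV[R]_n => (expR (- (2^-1 * enorm v ^+ 2)))%:E).
Proof.
apply/measurable_EFinP; apply: measurableT_comp => //; apply: measurableT_comp => //.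
by apply: measurable_funM => //; exact: measurable_enorm2.
Qed.

Lemma lebesgue_rV1 :
  measure_preserving (@lebesgue_measure R) (lam 1) (fun x => const_mx x).
Proof.
apply: lebesgue_rV_preservingP.
  by apply: measurable_fun_rV => i; under eq_fun do rewrite mxE; exact: measurable_id.
move=> a b ab; rewrite big_ord1.
rewrite (_ : _ @^-1` _ = `[a ord0, b ord0[%classic); last first.
  apply/seteqP; split => x /=; first by move=> /(_ ord0); rewrite mxE.
  by move=> H i; rewrite mxE (ord1 i).
by etransitivity; [exact: lebesgue_measure_itv|rewrite /= lte_fin ab EFinB].
Qed.

Lemma gaussian1_integral_lty :
  \int[lam 1]_v (expR (- (2^-1 * enorm v ^+ 2)))%:E < +oo.
Proof.
rewrite -(ge0_integral_measure_preserving lebesgue_rV1); last 2 first.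
- exact: measurable_gaussian.
- by move=> v; rewrite lee_fin expR_ge0.
have p0 : (0 < normal_peak (1 : R))%R by apply: normal_peak_gt0; rewrite oner_eq0.
apply: (@le_lt_trans _ _ (((normal_peak (1 : R))^-1)%:E * 1)); last by rewrite mule1 ltry.
rewrite -(integral_normal_pdf (0 : R) 1) -ge0_integralZl_EFin//; last 3 first.
- by move=> x _; rewrite lee_fin normal_pdf_ge0.
- by apply/measurable_EFinP; exact: measurable_normal_pdf.
- by rewrite invr_ge0 ltW.
rewrite le_eqVlt; apply/orP; left; apply/eqP; apply: eq_integral => x _.
rewrite -EFinM -/(phi x) phiE (mulrA (normal_peak 1)^-1%R) mulVf ?gt_eqF// mul1r enorm2E big_ord1 mxE.
by rewrite mulrC.
Qed.

(** The integral factors over the coordinates, which are split off one at a time; in dimension 0 the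
    whole space is a single unit cell. *)
Lemma gaussian_integral_lty n :
  \int[lam n]_v (expR (- (2^-1 * enorm v ^+ 2)))%:E < +oo.
Proof.
elim: n => [|n IH].
  under eq_integral do rewrite enorm2E big_ord0 mulr0 oppr0 expR0.
  rewrite integral_cst// mul1e.
  have E : lam 0 (cell 0 (0 : 'rV[R]_0)) < +oo by rewrite lebesgue_cell ltry.
  rewrite (_ : setT = cell 0 (0 : 'rV[R]_0)); first exact: E.
  by apply/seteqP; split => // v _; apply/ffunP => -[].
rewrite -(ge0_integral_measure_preserving (lebesgue_rV_row_mx 1 n)); last 2 first.
- exact: (@measurable_gaussian (1 + n)).
- by move=> v; rewrite lee_fin expR_ge0.
pose g1 (x : 'rV[R]_1) : \bar R := (expR (- (2^-1 * enorm x ^+ 2)))%:E.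
pose gn (x : 'rV[R]_n) : \bar R := (expR (- (2^-1 * enorm x ^+ 2)))%:E.
rewrite (@fubini_tonelli1 _ _ _ _ _ (lam 1) (lam n))//=; last first.
  exact: (measurableT_comp (@measurable_gaussian (1 + n)%N) (@measurable_row_mx R 1 n)).
have -> : \int[lam 1]_x fubini_F (lam n) (fun z : 'rV[R]_1 * 'rV[R]_n =>
      (expR (- (2^-1 * enorm (row_mx z.1 z.2) ^+ 2)))%:E) x =
    \int[lam 1]_x ((fine (\int[lam n]_y gn y))%:E * g1 x).
  apply: eq_integral => x _; rewrite /fubini_F fineK ?ge0_fin_numE//; last first.
    by apply: integral_ge0 => y _; rewrite lee_fin expR_ge0.
  rewrite muleC -ge0_integralZl_EFin ?expR_ge0//; last 2 first.
  - by move=> y _; rewrite lee_fin expR_ge0.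
  - exact: measurable_gaussian.
  apply: eq_integral => y _; rewrite -EFinM -expRD !enorm2E big_split_ord/=.
  congr (expR _)%:E; rewrite mulrDr opprD; congr (- (_ * _) - _ * _)%R.
    by apply: eq_bigr => i _; rewrite row_mxEl.
  by apply: eq_bigr => i _; rewrite row_mxEr.
rewrite ge0_integralZl_EFin//; last 3 first.
- by move=> y _; rewrite lee_fin expR_ge0.
- exact: measurable_gaussian.
- by rewrite fine_ge0// integral_ge0// => y _; rewrite lee_fin expR_ge0.
apply: lte_mul_pinfty => //; last exact: gaussian1_integral_lty.
by rewrite lee_fin fine_ge0// integral_ge0// => y _; rewrite lee_fin expR_ge0.
Qed.

Variables (m : nat) (V : 'rV[R]_m -> R).
Hypothesis V_int : (lam m).-integrable setT (fun q => (expR (- V q))%:E).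
Local Notation mu := (@lebesgue_phase R m).

(** Read off from the measurability of e^(-V), which is part of its integrability. *)
Lemma measurable_potential : measurable_fun setT V.
Proof.
have /measurable_EFinP mexp := measurable_int _ V_int.
rewrite (_ : V = (fun q => - ln (expR (- V q)))%R); last first.
  by apply/funext => q; rewrite expRK opprK.
by apply: measurableT_comp => //; apply: measurableT_comp mexp; exact: measurable_ln.
Qed.

Let w z : \bar R := (expR (- hamiltonian V z))%:E.

Let mw : measurable_fun setT w.
Proof.
apply/measurable_EFinP; apply: measurableT_comp => //; apply: measurableT_comp => //.
exact: measurable_hamiltonian measurable_potential.
Qed.

Lemma partition_lty : \int[mu]_z w z < +oo.
Proof.
rewrite /lebesgue_phase (@fubini_tonelli1 _ _ _ _ _ (lam m) (lam m))//; last first.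
  by move=> z; rewrite lee_fin expR_ge0.
pose G := fine (\int[lam m]_p (expR (- (2^-1 * enorm p ^+ 2)))%:E).
have -> : \int[lam m]_q fubini_F (lam m) w q = \int[lam m]_q (G%:E * (expR (- V q))%:E).
  apply: eq_integral => q _; rewrite /fubini_F fineK; last first.
    rewrite ge0_fin_numE; first exact: gaussian_integral_lty.
    by apply: integral_ge0 => y _; rewrite lee_fin expR_ge0.
  rewrite muleC -ge0_integralZl_EFin ?expR_ge0//; last exact: measurable_gaussian.
  by apply: eq_integral => p _; rewrite -EFinM -expRD -opprD addrC.
have G0 : (0 <= G)%R by rewrite fine_ge0// integral_ge0// => y _; rewrite lee_fin expR_ge0.
rewrite ge0_integralZl_EFin//; last exact: measurable_int V_int.
apply: lte_mul_pinfty => //.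
have /integrableP[_] := V_int; apply: le_lt_trans.
by rewrite le_eqVlt; apply/orP; left; apply/eqP; apply: eq_integral => q _; rewrite gee0_abs// lee_fin expR_ge0.
Qed.

(** A zero integral of an everywhere positive function would make the whole space null, yet the
    product of two unit cells has measure 1. *)
Lemma partition_gt0 : 0 < \int[mu]_z w z.
Proof.
rewrite lt0e integral_ge0 ?andbT; last by move=> z _; rewrite lee_fin expR_ge0.
apply/negP => /eqP int0.
have : \int[mu]_z `|w z| = 0.
  by rewrite -int0; apply: eq_integral => z _; rewrite gee0_abs// lee_fin expR_ge0.
move/(ae_eq_integral_abs _ measurableT mw) => [N [mN N0 sub]].
have NT : N = setT.
  apply/seteqP; split => // z _; apply: sub => /= /(_ I) /eqP.
  by rewrite eqe gt_eqF// expR_gt0.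
pose c : set 'rV[R]_m := cell 0 0.
have mc : measurable c by exact: measurable_cell.
have muc : mu (c `*` c) = 1.
  apply: (etrans (product_measure1E (lebesgue_rV m) (lebesgue_rV m) mc mc)).
  change (lam m c * lam m c = 1).
  by rewrite lebesgue_cell expr0 invr1 expr1n mule1.
have : mu (c `*` c) <= mu N.
  apply: le_measure; rewrite ?inE//; first exact: measurableX.
  by rewrite NT.
have -> : mu N = 0 by exact: N0.
by rewrite muc lee_fin ler10.
Qed.

Definition partition_value : R := fine (\int[mu]_z w z).

Lemma partition_valueE : \int[mu]_z (expR (- hamiltonian V z))%:E = partition_value%:E.
Proof. by rewrite fineK// ge0_fin_numE ?partition_lty// ltW// partition_gt0. Qed.

Lemma partition_value_gt0 : (0 < partition_value)%R.
Proof. by rewrite -lte_fin -partition_valueE partition_gt0. Qed.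

End partition.

(** * The mean acceptance as a normalised weight *)

Section acceptance.
Context {R : realType} {m : nat}.
Local Notation phase := ('rV[R]_m * 'rV[R]_m)%type.
Variables (V : 'rV[R]_m -> R) (lambda : nat -> R).
Variables (psi : R -> phase -> phase) (psiM : R -> R -> phase -> phase).
Hypotheses (V_int : (lebesgue_rV m).-integrable setT (fun q => (expR (- V q))%:E))
  (lambda_gt0 : forall i, 0 < lambda i) (psi_volume : volume_preserving psi)
  (psi_reversible : reversible psi) (psi_equivariant : equivariant psiM psi).

Local Notation X h := (fun z => energy_error V psi z h).
Local Notation H := (hamiltonian V).
Local Notation Z := (partition_value V).

Lemma product_hamiltonianE d (s : d.-tuple 'rV[R]_m * d.-tuple 'rV[R]_m) :
  product_hamiltonian V lambda s = particle_sum H lambda s.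
Proof.
rewrite /product_hamiltonian mulr_sumr -big_split; apply: eq_bigr => i _ /=.
by rewrite /hamiltonian /particle /rescale /= invrK.
Qed.

Lemma product_energy_errorE d (s : d.-tuple 'rV[R]_m * d.-tuple 'rV[R]_m) h :
  0 < h -> product_energy_error V lambda psiM s h = particle_sum (X h) lambda s.
Proof.
move=> h0; rewrite /product_energy_error !product_hamiltonianE /particle_sum -sumrB.
apply: eq_bigr => i _; rewrite /energy_error /particle; congr (hamiltonian V _ - _).
rewrite /product_integrator /= !tnth_mktuple /rescale /= invrK.
case E : (psiM _ _ _) => [q' p'] /=.
by rewrite ((psi_equivariant _ _ _ _ (lambda_gt0 i) h0).1 (esym E)).
Qed.

Let mH : measurable_fun setT H.
Proof. exact: measurable_hamiltonian (measurable_potential V_int). Qed.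

Let mX h : 0 < h -> measurable_fun setT (X h).
Proof.
by move=> h0; exact: (measurable_energy_error psi_volume psi_reversible (measurable_potential V_int) h0).
Qed.

Lemma weight_cst1 h d : 0 < h -> weight (X h) H lambda d (fun=> 1) = (Z ^+ d)%:E.
Proof.
move=> h0; elim: d lambda lambda_gt0 => [|d IH] l l0; first by rewrite weight0.
rewrite weightS//; last exact: mX.
under eq_integral do rewrite IH// muleC.
rewrite ge0_integralZl_EFin//; last 2 first.
- by apply/measurable_EFinP; apply: measurableT_comp => //; exact: measurableT_comp.
- by rewrite exprn_ge0// ltW// partition_value_gt0.
by rewrite partition_valueE// -EFinM exprSr.
Qed.

Lemma mean_acceptanceE h d : 0 < h -> mean_acceptance V lambda psiM d h =
  ((Z ^- d)%:E * weight (X h) H lambda d (@metropolis R))%E.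
Proof.
move=> h0; rewrite /mean_acceptance /gibbs_mean /gibbs_pdf.
have -> : partition_function (@lebesgue_state R m d) (product_hamiltonian V lambda (d := d)) = Z ^+ d.
  rewrite /partition_function; under eq_integral do rewrite product_hamiltonianE -[expR _]mul1r.
  have := weight_cst1 d h0; rewrite /weight => ->.
  by [].
have mW := @measurable_weighted R m _ _ (mX h0) mH lambda d _ (@measurable_metropolis R).
rewrite /weight -ge0_integralZl_EFin//; last 2 first.
- by move=> s _; rewrite lee_fin mulr_ge0 ?expR_ge0 ?metropolis_ge0.
- by rewrite invr_ge0 exprn_ge0// ltW// partition_value_gt0.
apply: eq_integral => s _; rewrite -EFinM; congr (_%:E).
rewrite /acceptance_probability product_energy_errorE// product_hamiltonianE.
by rewrite /metropolis [RHS]mulrC -[RHS]mulrA.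
Qed.

End acceptance.

(** Through this bound, integrability of the third power covers the lower powers. *)
Lemma ler_1cube (R : realDomainType) (a : R) j : 0 <= a -> (j <= 3)%N ->
  a ^+ j <= 1 + a ^+ 3.
Proof.
move=> a0 j3; have [a1|/ltW a1] := leP a 1.
  by apply: le_trans (exprn_ile1 j a0 a1) _; rewrite lerDl exprn_ge0.
by apply: le_trans (ler_weXn2l a1 j3) _; rewrite lerDr.
Qed.

(** * Replacing one particle *)

Section moments.
Context {R : realType} d (T : measurableType d).
Variables (mu : {measure set T -> \bar R}) (X w : T -> R).
Hypotheses (mX : measurable_fun setT X) (mw : measurable_fun setT w)
  (w_ge0 : forall z, 0 <= w z).
Hypotheses (w_int : mu.-integrable setT (EFin \o w))
  (X3_int : mu.-integrable setT (EFin \o (fun z => `|X z| ^+ 3 * w z))).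

Definition wint (f : T -> R) : R := (\int[mu]_z (f z * w z))%R.

Definition wintegrable (f : T -> R) :=
  mu.-integrable setT (EFin \o (fun z => f z * w z)).

Lemma wintegrableD f g : wintegrable f -> wintegrable g ->
  wintegrable (fun z => f z + g z).
Proof.
move=> fi gi; have := integrableD measurableT fi gi.
by apply: eq_integrable => // z _; rewrite /= mulrDl.
Qed.

Lemma wintegrableZ c f : wintegrable f -> wintegrable (fun z => c * f z).
Proof.
move=> fi; have := integrableZl measurableT c fi.
by apply: eq_integrable => // z _; rewrite /= -mulrA.
Qed.

Lemma wintD f g : wintegrable f -> wintegrable g ->
  wint (fun z => f z + g z) = wint f + wint g.
Proof.
move=> fi gi; rewrite /wint -RintegralD//.
by apply: eq_Rintegral => z _; rewrite mulrDl.
Qed.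

Lemma wintZ c f : wintegrable f -> wint (fun z => c * f z) = c * wint f.
Proof.
move=> fi; rewrite /wint -RintegralZl//.
by apply: eq_Rintegral => z _; rewrite mulrA.
Qed.

Lemma wint_norm_le f g : wintegrable f -> wintegrable g ->
  (forall z, `|f z| <= g z) -> `|wint f| <= wint g.
Proof.
move=> fi gi fg; apply: le_trans (le_normr_Rintegral measurableT fi) _.
apply: le_Rintegral => // [|z _]; first exact: integrable_norm.
by rewrite normrM (ger0_norm (w_ge0 z)) ler_wpM2r.
Qed.

Lemma integrable_dominated (f : T -> R) (a b : R) : measurable_fun setT f ->
  (forall z, `|f z| <= a + b * `|X z| ^+ 3) -> wintegrable f.
Proof.
move=> mf fab.
have gint : mu.-integrable setT
    (fun z => a%:E * (EFin \o w) z + b%:E * (EFin \o (fun z => (`|X z| ^+ 3 * w z)%R)) z)%E.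
  by apply: integrableD => //; exact: integrableZl.
apply: le_integrable gint => //.
  by apply/measurable_EFinP; exact: measurable_funM.
move=> z _ /=; rewrite lee_fin normrM (ger0_norm (w_ge0 z)).
apply: le_trans (ler_norm _); rewrite mulrA -mulrDl.
by apply: ler_wpM2r.
Qed.

Lemma wint_EFin f : wintegrable f ->
  (\int[mu]_z (f z * w z)%:E = (wint f)%:E)%E.
Proof. by move=> fint; rewrite /wint /Rintegral fineK//; exact: integrable_fin_num. Qed.

(* E(X) - E(X^2) / 2 is a third-order term: the reversibility identity moves
   the contribution of {X < 0} to {X > 0}, where it is weighted by e^(-X). *)
Lemma skewness :
  (forall g : R -> R, measurable_fun setT g -> (forall x, 0 <= g x) ->
    (\int[mu]_z (g (X z) * w z)%:E =
     \int[mu]_z (g (- X z) * expR (- X z) * w z)%:E)%E) ->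
  `|wint X - 2^-1 * wint (fun z => X z ^+ 2)| <= 2^-1 * wint (fun z => `|X z| ^+ 3).
Proof.
move=> rev.
pose pos (x : R) := Num.max x 0.
(* Chosen so that g x = - (x - x^2 / 2) for x <= 0 and g x = 0 for x > 0: adding g X erases the
   negative part of the integrand X - X^2 / 2. *)
pose g (x : R) := pos (- x) + pos (- x) ^+ 2 / 2.
have mpos : measurable_fun setT pos by apply: measurable_maxr.
have pos_ge0 x : 0 <= pos x by rewrite le_max lexx orbT.
have mg : measurable_fun setT g.
  have mpN : measurable_fun setT (fun x : R => pos (- x)) by exact: measurableT_comp.
  by apply: measurable_funD => //; apply: measurable_funM => //; exact: measurable_funX.
have g_ge0 x : 0 <= g x by rewrite addr_ge0 ?divr_ge0 ?sqr_ge0.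
have X1 z : `|X z| <= 1 + 1 * `|X z| ^+ 3.
  by rewrite mul1r; exact: (@ler_1cube _ _ 1%N (normr_ge0 (X z)) isT).
have X2 z : `|X z ^+ 2| <= 1 + 1 * `|X z| ^+ 3.
  by rewrite normrX mul1r; exact: ler_1cube.
have pos_le x : pos x <= `|x| by rewrite ge_max ler_norm normr_ge0.
have iX := integrable_dominated mX X1.
have iX2 : wintegrable (fun z => X z ^+ 2).
  by apply: integrable_dominated X2; exact: measurable_funX.
have iX3 := X3_int.
have igX : wintegrable (fun z => g (X z)).
  apply: (@integrable_dominated _ 2 2); first exact: measurableT_comp.
  move=> z; rewrite ger0_norm// /g; have := pos_le (- X z); rewrite normrN.
  have := X1 z; have := X2 z; have := pos_ge0 (- X z); have := normr_ge0 (X z).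
  by rewrite normrX !mul1r; move: (pos _) `|X z| => p a; nra.
pose k z := g (- X z) * expR (- X z).
have mk : measurable_fun setT k.
  apply: measurable_funM; apply: measurableT_comp => //; exact: measurableT_comp.
(* k vanishes for X <= 0, so its exponential may be taken at most 1, which makes k integrable. *)
have kE z : k z = (pos (X z) + pos (X z) ^+ 2 / 2) * expR (- pos (X z)).
  rewrite /k /g opprK /pos; case: leP => // _.
  by rewrite expr0n/= mul0r addr0 !mul0r.
have ik : wintegrable k.
  apply: (@integrable_dominated _ 2 2) => // z.
  rewrite kE ger0_norm; last by rewrite mulr_ge0 ?expR_ge0 ?addr_ge0 ?divr_ge0 ?sqr_ge0.
  have e1 : expR (- pos (X z)) <= 1 by rewrite expR_le1 oppr_le0.
  have := pos_le (X z); have := pos_ge0 (X z); have := normr_ge0 (X z).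
  have := X1 z; have := X2 z; have := expR_ge0 (- pos (X z)); rewrite normrX !mul1r.
  move: e1; move: (expR _) => e; move: (pos _) `|X z| => p a e1 e0 a2 a1 a0 p0 pa.
  apply: le_trans (_ : (p + p ^+ 2 / 2) * 1 <= _); last by nra.
  by apply: ler_wpM2l => //; rewrite addr_ge0 ?divr_ge0 ?sqr_ge0.
have revE : wint (fun z => g (X z)) = wint k.
  by rewrite /wint /Rintegral (rev _ mg g_ge0).
have iX2h := wintegrableZ (- 2^-1) iX2.
have ikN := wintegrableZ (-1) ik.
have iA := wintegrableD iX iX2h.
have iB := wintegrableD igX ikN.
have -> : wint X - 2^-1 * wint (fun z => X z ^+ 2) =
    wint (fun z => (X z + - 2^-1 * X z ^+ 2) + (g (X z) + -1 * k z)).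
  by rewrite (wintD iA iB) (wintD iX iX2h) (wintD igX ikN) (wintZ _ iX2) (wintZ _ ik) revE; ring.
rewrite -(wintZ _ iX3); apply: wint_norm_le (wintegrableD iA iB) (wintegrableZ _ iX3) _ => z.
rewrite kE /g /pos; have [X0|X0] := leP (X z) 0.
  rewrite (max_idPl _) ?oppr_ge0// expr0n/= mul0r addr0 mul0r mulr0 addr0.
  rewrite sqrrN (_ : _ + _ = 0) ?normr0 ?mulr_ge0 ?exprn_ge0//.
  by field.
rewrite (max_idPr _) ?oppr_le0 ?(ltW X0)// expr0n/= mul0r add0r add0r.
rewrite (gtr0_norm X0).
(* What remains for x > 0 is x - x^2 / 2 - (x + x^2 / 2) e^(-x); the bounds 1 - x <= e^(-x) <= 1 /
   (1 + x) enclose it between -x^3 / 2 and x^3 / 2. *)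
have := expR_ge1Dx (- X z); have := expRN_le_inv (ltW X0).
move: (expR _) => e; move: (X z) X0 => x x0 e1 e2.
have c0 : 0 <= x + x ^+ 2 / 2 by rewrite addr_ge0 ?divr_ge0 ?sqr_ge0// ltW.
rewrite ler_norml; apply/andP; split; rewrite -subr_ge0.
  rewrite -(pmulr_rge0 _ (addr_gt0 ltr01 x0)).
  have e1' : 0 <= 1 - (1 + x) * e by rewrite subr_ge0.
  have H := mulr_ge0 c0 e1'.
  have x4 : 0 <= x ^+ 4 by rewrite exprn_ge0// ltW.
  rewrite [leRHS](_ : _ = (x + x ^+ 2 / 2) * (1 - (1 + x) * e) + x ^+ 4 / 2).
    by rewrite addr_ge0 ?divr_ge0.
  by field.
have e2' : 0 <= e - (1 - x) by rewrite subr_ge0.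
have H := mulr_ge0 c0 e2'.
by apply: le_trans H _; rewrite le_eqVlt; apply/orP; left; apply/eqP; field.
Qed.

(** t1 stands for the value of the smoothed function at s after the time tau. Skewness turns c1 E X
    + c2 / 2 E X^2 into (c1 + c2) / 2 tau, the increment that t1 has too; only remainders are
    left. *)
Lemma one_step (u u1 : R -> R) (C c1 c2 s t1 : R) :
  0 <= C -> `|c1| <= 1 -> measurable_fun setT u -> (forall x, 0 <= u x <= 1) ->
  (forall y, `|u (s + y) - u s - c1 * y - c2 / 2 * y ^+ 2| <= C * `|y| ^+ 3) ->
  `|wint X - 2^-1 * wint (fun z => X z ^+ 2)| <= 2^-1 * wint (fun z => `|X z| ^+ 3) ->
  let Z := wint (fun=> 1) in let tau := wint (fun z => X z ^+ 2) / Z in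
  0 < Z -> `|t1 - u s - (c1 + c2) / 2 * tau| <= C * tau ^+ 2 ->
  `|wint (fun z => u (s + X z)) - Z * t1| <=
    Z * ((C + 1) * (wint (fun z => `|X z| ^+ 3) / Z) + C * tau ^+ 2).
Proof.
move=> C0 c11 mu_ u01 taylor skew Z tau Z0 time.
have X1 z : `|X z| <= 1 + 1 * `|X z| ^+ 3.
  by rewrite mul1r; exact: (@ler_1cube _ _ 1%N (normr_ge0 (X z)) isT).
have X2 z : `|X z ^+ 2| <= 1 + 1 * `|X z| ^+ 3.
  by rewrite normrX mul1r; exact: ler_1cube.
have iX := integrable_dominated mX X1.
have iX2 : wintegrable (fun z => X z ^+ 2).
  by apply: integrable_dominated X2; exact: measurable_funX.
have iX3 : wintegrable (fun z => `|X z| ^+ 3) := X3_int.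
have iu : wintegrable (fun z => u (s + X z)).
  apply: (@integrable_dominated _ 1 0).
    by apply: measurableT_comp => //; exact: measurable_funD.
  by move=> z; rewrite mul0r addr0; have /andP[? ?] := u01 (s + X z); rewrite ger0_norm.
have i1 : wintegrable (fun=> 1).
  by apply: (@integrable_dominated _ 1 0) => // z; rewrite mul0r addr0 normr1.
have iA := wintegrableD iu (wintegrableZ (- u s) i1).
have iB := wintegrableD (wintegrableZ (- c1) iX) (wintegrableZ (- (c2 / 2)) iX2).
have := wint_norm_le (wintegrableD iA iB) (wintegrableZ C iX3).
rewrite (wintD iA iB) (wintD iu (wintegrableZ _ i1))
  (wintD (wintegrableZ _ iX) (wintegrableZ _ iX2)) (wintZ _ i1) (wintZ _ iX) (wintZ _ iX2) (wintZ _ iX3).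
rewrite -/Z; have -> : wint (fun z => X z ^+ 2) = Z * tau by rewrite /tau mulrC divfK ?gt_eqF.
move: skew; have -> : wint (fun z => X z ^+ 2) = Z * tau by rewrite /tau mulrC divfK ?gt_eqF.
set I1 := wint X; set I3 := wint (fun z => `|X z| ^+ 3); set Iu := wint _ => skew main.
have {}main : `|Iu + - u s * Z + (- c1 * I1 + - (c2 / 2) * (Z * tau))| <= C * I3.
  apply: main => z; apply: le_trans (taylor (X z)); rewrite le_eqVlt; apply/orP; left.
  by apply/eqP; congr `| _ |; ring.
have h1 : `|c1 * (I1 - 2^-1 * (Z * tau))| <= 2^-1 * I3.
  by rewrite normrM -[leRHS]mul1r; apply: ler_pM.
have h2 : `|Z * (t1 - u s - (c1 + c2) / 2 * tau)| <= Z * (C * tau ^+ 2).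
  by rewrite normrM (gtr0_norm Z0); apply: ler_wpM2l time; exact: ltW.
have I30 : 0 <= I3.
  by apply: Rintegral_ge0 => z _; rewrite mulr_ge0 ?exprn_ge0.
have -> : Z * ((C + 1) * (I3 / Z) + C * tau ^+ 2) = (C + 1) * I3 + Z * (C * tau ^+ 2).
  by field; rewrite gt_eqF.
(* Taylor remainder in x, plus the skewness defect, minus the remainder in time. *)
have -> : Iu - Z * t1 = (Iu + - u s * Z + (- c1 * I1 + - (c2 / 2) * (Z * tau))) +
    (c1 * (I1 - 2^-1 * (Z * tau)) - Z * (t1 - u s - (c1 + c2) / 2 * tau)) by field.
apply: le_trans (ler_normD _ _) _.
apply: le_trans (lerD main (ler_normB _ _)) _.
by have := lerD h1 h2; lra.
Qed.

End moments.

Lemma smoothed0 (R : realType) (t : R) : smoothed (Num.sqrt t) 0 = 2 * Phi (- (Num.sqrt t / 2)).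
Proof. by rewrite /smoothed mul0r add0r sub0r oppr0 expR0 mul1r mulr_natl mulr2n. Qed.

Lemma sandwich (R : realFieldType) (M U Zd a r b : R) :
  U <= Zd * (a + b) -> Zd * a <= U + Zd * b -> M <= U + r * Zd -> U <= M + r * Zd ->
  `|M - Zd * a| <= (r + b) * Zd.
Proof. by move=> *; rewrite ler_norml; apply/andP; split; lra. Qed.

(** * The acceptance for a fixed dimension and step size *)

Section fixed_step.
Context {R : realType} {m : nat}.
Local Notation phase := ('rV[R]_m * 'rV[R]_m)%type.
Local Notation mu := (lebesgue_rV m \x lebesgue_rV m)%E.
Variables (V : 'rV[R]_m -> R) (lambda : nat -> R).
Variables (psi : R -> phase -> phase) (psiM : R -> R -> phase -> phase).
Hypotheses (V_int : (lebesgue_rV m).-integrable setT (fun q => (expR (- V q))%:E))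
  (lambda_gt0 : forall i, 0 < lambda i) (psi_volume : volume_preserving psi)
  (psi_reversible : reversible psi) (psi_equivariant : equivariant psiM psi).
Variable h : R.
Hypothesis h_gt0 : 0 < h.

Local Notation X := (fun z => energy_error V psi z h).
Local Notation H := (hamiltonian V).
Local Notation w := (fun z => expR (- hamiltonian V z)).
Local Notation Z := (partition_value V).
Local Notation weight := (weight X (hamiltonian V)).

Let mH : measurable_fun setT H.
Proof. exact: measurable_hamiltonian (measurable_potential V_int). Qed.

Let mX : measurable_fun setT X.
Proof.
exact: (measurable_energy_error psi_volume psi_reversible (measurable_potential V_int) h_gt0).
Qed.

Lemma measurable_boltzmann : measurable_fun setT w.
Proof. by apply: measurableT_comp => //; exact: measurableT_comp. Qed.

Lemma integrable_boltzmann : mu.-integrable setT (EFin \o w).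
Proof.
apply/integrableP; split; first by apply/measurable_EFinP; exact: measurable_boltzmann.
under eq_integral do rewrite /= ger0_norm ?expR_ge0//.
exact: partition_lty.
Qed.

Lemma wint1 : wint mu w (fun=> 1) = Z.
Proof. by rewrite /wint; under eq_Rintegral do rewrite mul1r. Qed.

Lemma weight_le d (f g : R -> R) : measurable_fun setT f -> measurable_fun setT g ->
  (forall x, 0 <= f x) -> (forall x, f x <= g x) ->
  (weight lambda d f <= weight lambda d g)%E.
Proof.
move=> mf mg f0 fg; apply: ge0_le_integral => //.
- by move=> s _; rewrite lee_fin mulr_ge0 ?expR_ge0.
- exact: measurable_weighted.
- exact: measurable_weighted.
- by move=> s _; rewrite lee_fin ler_wpM2r ?expR_ge0.
Qed.

Lemma weight_addcst d (g : R -> R) (c : R) : 0 <= c -> measurable_fun setT g ->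
  (forall x, 0 <= g x) ->
  (weight lambda d (fun x => g x + c)%R = weight lambda d g + (c * Z ^+ d)%:E)%E.
Proof.
move=> c0 mg g0.
have E : (weight lambda d (fun=> c) = (c * Z ^+ d)%:E)%E.
  rewrite EFinM -(weight_cst1 V_int lambda_gt0 psi_volume psi_reversible d h_gt0).
  rewrite /weight -ge0_integralZl_EFin//; last first.
    exact: (@measurable_weighted _ _ _ _ mX mH lambda d (fun=> 1)).
  by apply: eq_integral => s _; rewrite -EFinM mul1r.
rewrite -E -ge0_integralD//.
- by apply: eq_integral => s _; rewrite -EFinD mulrDl.
- by move=> s _; rewrite lee_fin mulr_ge0 ?expR_ge0.
- exact: measurable_weighted.
- by move=> s _; rewrite lee_fin mulr_ge0 ?expR_ge0.
- exact: (@measurable_weighted _ _ _ _ mX mH lambda d (fun=> c)).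
Qed.

Hypothesis X3_int : mu.-integrable setT (EFin \o (fun z => `|X z| ^+ 3 * w z)).

Let tau := wint mu w (fun z => X z ^+ 2) / Z.
Let m3 := wint mu w (fun z => `|X z| ^+ 3) / Z.

(** The expansion enters as a hypothesis so that C can be fixed from rho before d and h vary. The
    term rho is the cost of replacing the Metropolis function by its smoothing at t = rho^2; the
    other term is d times the error of one replacement. *)
Lemma acceptance_bound d (rho C : R) : 0 < rho -> 0 <= C ->
  (forall t x, rho ^+ 2 <= t -> exists c1 c2 : R, [/\ `|c1| <= 1,
    forall y, `|smoothed (Num.sqrt t) (x + y) - smoothed (Num.sqrt t) x
                - c1 * y - c2 / 2 * y ^+ 2| <= C * `|y| ^+ 3 &
    forall tau, 0 <= tau -> `|smoothed (Num.sqrt (t + tau)) x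
      - smoothed (Num.sqrt t) x - (c1 + c2) / 2 * tau| <= C * tau ^+ 2]) ->
  exists2 a : R, mean_acceptance V lambda psiM d h = a%:E &
    `|a - 2 * Phi (- (Num.sqrt (rho ^+ 2 + d%:R * tau) / 2))| <=
      rho + d%:R * ((C + 1) * m3 + C * tau ^+ 2).
Proof.
move=> rho0 C0 expansion.
have Z0 : 0 < Z := partition_value_gt0 V_int.
have tau0 : 0 <= tau.
  rewrite divr_ge0 ?(ltW Z0)//; apply: Rintegral_ge0 => z _.
  by rewrite mulr_ge0 ?sqr_ge0 ?expR_ge0.
have m30 : 0 <= m3.
  rewrite divr_ge0 ?(ltW Z0)//; apply: Rintegral_ge0 => z _.
  by rewrite mulr_ge0 ?exprn_ge0 ?expR_ge0.
pose e := (C + 1) * m3 + C * tau ^+ 2.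
have e0 : 0 <= e := addr_ge0 (mulr_ge0 (addr_ge0 C0 ler01) m30) (mulr_ge0 C0 (sqr_ge0 tau)).
pose u t := smoothed (Num.sqrt t : R).
have sqrt_gt0 t : rho ^+ 2 <= t -> 0 < Num.sqrt t.
  by move=> rt; rewrite sqrtr_gt0 (lt_le_trans _ rt)// exprn_gt0.
have u_ge0 t x : rho ^+ 2 <= t -> 0 <= u t x by move=> _; exact: smoothed_ge0.
have mu_ t : rho ^+ 2 <= t -> measurable_fun setT (u t).
  by move=> /sqrt_gt0 t0; apply: measurable_smoothed; rewrite gt_eqF.
have w0 z : 0 <= w z by exact: expR_ge0.
have skew := skewness mX measurable_boltzmann w0 integrable_boltzmann X3_int
  (fun g mg g0 => integral_energy_error_reversed psi_volume psi_reversible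
     (measurable_potential V_int) h_gt0 mg g0).
have step t s : rho ^+ 2 <= t ->
    `|wint mu w (fun z => u t (s + X z)) - Z * u (t + tau) s| <= Z * e.
  move=> rt; have [c1 [c2 [c11 tx tt]]] := expansion t s rt.
  have := @one_step _ _ _ mu X w mX measurable_boltzmann w0 integrable_boltzmann X3_int
    (u t) (fun _ => 0) C c1 c2 s (u (t + tau) s) C0 c11 (mu_ t rt).
  rewrite wint1; apply => //.
    by move=> x; rewrite u_ge0//= smoothed_le1// sqrt_gt0.
  exact: tt.
have int_u t s : rho ^+ 2 <= t ->
    (\int[mu]_z (u t (s + X z) * w z)%:E = (wint mu w (fun z => u t (s + X z)))%:E)%E.
  move=> rt; apply: wint_EFin.
  apply: (@integrable_dominated _ _ _ mu X w measurable_boltzmann w0 integrable_boltzmann X3_int _ 1 0).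
    by apply: measurableT_comp; [exact: mu_|exact: measurable_funD].
  by move=> z; rewrite mul0r addr0 ger0_norm ?u_ge0// smoothed_le1// sqrt_gt0.
have up := @weight_upper R m X H mX mH Z tau e (rho ^+ 2) u tau0 e0 (ltW Z0) u_ge0 mu_
  (partition_valueE V_int) lambda d (rho ^+ 2) 0 lambda_gt0 (lexx _).
have lo := @weight_lower R m X H mX mH Z tau e (rho ^+ 2) u tau0 e0 (ltW Z0) u_ge0 mu_
  (partition_valueE V_int) lambda d (rho ^+ 2) 0 lambda_gt0 (lexx _).
pose u0 := u (rho ^+ 2); pose u1 := u (rho ^+ 2 + d%:R * tau).
have {}up : (weight lambda d u0 <=
    (Z ^+ d * (u1 0 + d%:R * e))%:E)%E.
  have -> : u0 = (fun x => u0 (0 + x)).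
    by apply/funext => x; rewrite add0r.
  apply: up => t s rt; rewrite int_u// lee_fin mulrDr.
  by have := step t s rt; rewrite ler_norml => /andP[_]; rewrite lerBlDl.
have {}lo : ((Z ^+ d * u1 0)%:E <=
    weight lambda d u0 + (Z ^+ d * (d%:R * e))%:E)%E.
  have -> : u0 = (fun x => u0 (0 + x)).
    by apply/funext => x; rewrite add0r.
  apply: lo => t s rt; rewrite int_u// -EFinD lee_fin.
  by have := step t s rt; rewrite ler_norml => /andP[+ _]; rewrite lerBrDr addrC lerBlDr.
have near x : `|u0 x - metropolis x| <= rho.
  by rewrite /u0 /u sqrtr_sqr (gtr0_norm rho0); exact: smoothed_near.
have um := mu_ _ (lexx (rho ^+ 2)).
have met_le : (weight lambda d (@metropolis R) <=
    weight lambda d u0 + (rho * Z ^+ d)%:E)%E.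
  rewrite -weight_addcst ?(ltW rho0)//; last by move=> x; exact: u_ge0.
  apply: weight_le.
  - exact: measurable_metropolis.
  - exact: measurable_funD.
  - exact: metropolis_ge0.
  - by move=> x; have := near x; rewrite ler_norml => /andP[+ _]; rewrite lerBrDr addrC lerBlDr.
have u_le : (weight lambda d u0 <=
    weight lambda d (@metropolis R) + (rho * Z ^+ d)%:E)%E.
  rewrite -weight_addcst ?(ltW rho0)//; [|exact: measurable_metropolis|exact: metropolis_ge0].
  apply: weight_le.
  - exact: um.
  - by apply: measurable_funD => //; exact: measurable_metropolis.
  - by move=> x; exact: u_ge0.
  - by move=> x; have := near x; rewrite ler_norml => /andP[_ +]; rewrite lerBlDl.
have Zd0 : 0 < Z ^+ d by rewrite exprn_gt0.
have wu_fin : weight lambda d u0 \is a fin_num.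
  rewrite ge0_fin_numE; first exact: le_lt_trans up (ltry _).
  by apply: integral_ge0 => s _; rewrite lee_fin mulr_ge0 ?expR_ge0 ?u_ge0.
have wm_fin : weight lambda d (@metropolis R) \is a fin_num.
  rewrite ge0_fin_numE; last first.
    by apply: integral_ge0 => s _; rewrite lee_fin mulr_ge0 ?expR_ge0 ?metropolis_ge0.
  apply: le_lt_trans met_le _; rewrite -(fineK wu_fin) -EFinD; exact: ltry.
rewrite (mean_acceptanceE V_int lambda_gt0 psi_volume psi_reversible psi_equivariant d h_gt0).
move: up lo met_le u_le; rewrite -(fineK wu_fin) -(fineK wm_fin) -!EFinD !lee_fin.
move: (fine (weight lambda d u0)) (fine (weight lambda d (@metropolis R))) => U M.
rewrite -smoothed0 -/(u _) -/u1 => up lo met_le u_le.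
exists (Z ^- d * M); first by rewrite EFinM.
have -> : Z ^- d * M - u1 0 =
    (M - Z ^+ d * u1 0) / Z ^+ d.
  by field; rewrite gt_eqF.
rewrite normrM [`|(Z ^+ d)^-1|]gtr0_norm ?invr_gt0// ler_pdivrMr// -/e.
exact: sandwich up lo met_le u_le.
Qed.

End fixed_step.

(** * The limit *)

Section limits.
Context {R : realType}.

Lemma sqrt_dist (a b : R) : 0 <= a -> 0 <= b ->
  `|Num.sqrt a - Num.sqrt b| <= Num.sqrt `|a - b|.
Proof.
wlog ab : a b / b <= a => [H|] a0 b0.
  case/orP: (le_total b a) => ab; first exact: H.
  by rewrite distrC [`|a - b|]distrC; exact: H.
rewrite ger0_norm; last by rewrite subr_ge0 ler_wsqrtr.
rewrite ger0_norm ?subr_ge0// lerBlDr.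
have s0 : 0 <= Num.sqrt (a - b) + Num.sqrt b by rewrite addr_ge0 ?sqrtr_ge0.
rewrite -[leRHS]ger0_norm// -sqrtr_sqr ler_wsqrtr// sqrrD !sqr_sqrtr ?subr_ge0//.
have := mulr_ge0 (sqrtr_ge0 (a - b)) (sqrtr_ge0 b).
by move: (_ * _) => p p0; rewrite mulr2n; lra.
Qed.

Lemma Phi_lipschitz (x y : R) : `|Phi x - Phi y| <= `|x - y|.
Proof.
rewrite -[leRHS]mul1r; apply: (@derive_le_dist R Phi phi) => z _.
  exact: is_derive_Phi.
by rewrite ger0_norm ?phi_ge0 ?phi_le1.
Qed.

Lemma eventually_natr_gt (M : R) : \forall n \near \oo, M < n%:R.
Proof.
exists (Num.truncn `|M|).+1 => // n /= Mn.
apply: le_lt_trans (ler_norm M) _; apply: lt_le_trans (truncnS_gt _) _.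
by rewrite ler_nat.
Qed.

Variables (nu ell : R).
Hypotheses (nu_gt0 : 0 < nu) (ell_gt0 : 0 < ell).

(** For n = 0 this is the default value ell / 0 = 0, hence the condition 0 < n in what follows. *)
Definition step_size (n : nat) : R := ell / n%:R `^ (1 / (2 * nu)).

Let pow_gt0 (n : nat) : (0 < n)%N -> 0 < n%:R `^ (1 / (2 * nu)) :> R.
Proof. by move=> n0; rewrite powR_gt0// ltr0n. Qed.

Lemma step_size_gt0 (n : nat) : (0 < n)%N -> 0 < step_size n.
Proof. by move=> n0; rewrite divr_gt0 ?pow_gt0. Qed.

Lemma step_size_powR (n : nat) : (0 < n)%N ->
  step_size n `^ nu = ell `^ nu / Num.sqrt n%:R.
Proof.
move=> n0; have s0 : 0 < Num.sqrt n%:R :> R by rewrite sqrtr_gt0 ltr0n.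
apply: (mulIf (lt0r_neq0 s0)); rewrite divfK ?gt_eqF//.
have -> : Num.sqrt n%:R = (n%:R `^ (1 / (2 * nu))) `^ nu :> R.
  rewrite -powRrM (_ : 1 / (2 * nu) * nu = 2^-1) ?powR12_sqrt//.
  by field; rewrite gt_eqF.
rewrite -powRM ?divfK ?gt_eqF ?pow_gt0// ltW ?step_size_gt0//.
Qed.

Lemma step_size_lt (e : R) : 0 < e -> \forall n \near \oo, 0 < step_size n < e.
Proof.
move=> e0; near=> n.
have n0 : (0 < n)%N by near: n; exact: nbhs_infty_gt.
rewrite step_size_gt0//= ltr_pdivrMr ?pow_gt0// mulrC -ltr_pdivrMr//.
have le0 : 0 <= ell / e by rewrite divr_ge0 ?ltW.
have -> : ell / e = ((ell / e) `^ (2 * nu)) `^ (1 / (2 * nu)).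
  by rewrite -powRrM mul1r divff ?powRr1// gt_eqF// mulr_gt0.
apply: gt0_ltr_powR; rewrite ?nnegrE ?powR_ge0//.
  by rewrite divr_gt0// mulr_gt0.
by near: n; exact: eventually_natr_gt.
Unshelve. all: by end_near. Qed.

Lemma step_size_cvg : step_size n @[n --> \oo] --> (0 : R)^'+.
Proof.
move=> A [e /= e0 He].
have := step_size_lt e0; apply: filterS => n /andP[n0 ne].
by apply: He => //=; rewrite sub0r normrN gtr0_norm.
Qed.

End limits.

Section limit_theorem.
Context {R : realType} {m : nat}.
Local Notation phase := ('rV[R]_m * 'rV[R]_m)%type.
Local Notation mu := (lebesgue_rV m \x lebesgue_rV m)%E.
Variables (V : 'rV[R]_m -> R) (psi : R -> phase -> phase).
Hypotheses (V_int : (lebesgue_rV m).-integrable setT (fun q => (expR (- V q))%:E))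
  (psi_volume : volume_preserving psi) (psi_reversible : reversible psi).
Variables (nu : R) (alpha : phase -> R).
Hypothesis cond1 : condition1 V psi nu alpha.

Local Notation X h := (fun z => energy_error V psi z h).
Local Notation w := (fun z => expR (- hamiltonian V z)).
Local Notation Z := (partition_value V).

Let Z0 : 0 < Z := partition_value_gt0 V_int.
Let w0 z : 0 <= w z. Proof. exact: expR_ge0. Qed.
Let mw : measurable_fun setT w := measurable_boltzmann V_int.
Let mX h : 0 < h -> measurable_fun setT (X h).
Proof.
by move=> h0; exact: (measurable_energy_error psi_volume psi_reversible (measurable_potential V_int) h0).
Qed.

Variable D : phase -> R.
Hypotheses (D_int : wintegrable mu w D)
  (D_ub : forall h z, 0 < h <= 1 -> `|X h z| ^+ 3 <= D z * (h `^ nu) ^+ 3).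

Lemma integrable_X3 h : 0 < h <= 1 ->
  mu.-integrable setT (EFin \o (fun z => `|X h z| ^+ 3 * w z)).
Proof.
move=> h01; have /andP[h0 _] := h01.
have := integrableZl measurableT ((h `^ nu) ^+ 3) D_int; apply: le_integrable => //.
  apply/measurable_EFinP; apply: measurable_funM => //; apply: measurable_funX.
  by apply: measurableT_comp => //; exact: mX.
move=> z _; rewrite /= lee_fin ger0_norm ?mulr_ge0 ?exprn_ge0//.
apply: le_trans (ler_norm _); rewrite mulrA; apply: ler_wpM2r => //.
by rewrite mulrC; exact: D_ub.
Qed.

Lemma wint_X3_le h : 0 < h <= 1 ->
  wint mu w (fun z => `|X h z| ^+ 3) <= (h `^ nu) ^+ 3 * wint mu w D.
Proof.
move=> h01; rewrite -(wintZ _ D_int).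
apply: le_trans (ler_norm _) _; apply: wint_norm_le => //.
- exact: integrable_X3.
- exact: wintegrableZ.
- by move=> z; rewrite ger0_norm ?exprn_ge0// mulrC; exact: D_ub.
Qed.

Lemma cvg_scaled_error h z : h n @[n --> \oo] --> (0 : R)^'+ ->
  X (h n) z / (h n `^ nu) @[n --> \oo] --> alpha z.
Proof.
move=> h_cvg; have [rho rhoE rho_cvg] := cond1.
have h0 : \forall n \near \oo, 0 < h n by exact: (h_cvg [set x | 0 < x] (nbhs_right_gt 0)).
rewrite -[alpha z]addr0.
have : alpha z + rho z (h n) @[n --> \oo] --> alpha z + 0.
  by apply: cvgD; [exact: cvg_cst|exact: (@cvg_comp _ _ _ h (rho z) _ _ _ h_cvg (rho_cvg z))].
apply: cvg_trans; apply: near_eq_cvg; near=> n.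
have hn : 0 < h n by near: n.
rewrite rhoE//= -mulrDr [RHS]mulrC mulKf// gt_eqF// powR_gt0//.
Unshelve. all: by end_near. Qed.

(** Dominated convergence: since a^2 <= 1 + a^3, the squares of the scaled errors are at most 1 + D.
    Measurability and integrability of alpha^2, not part of [condition1], come with the limit. *)
Lemma cvg_second_moment h : (forall n, 0 < h n <= 1) ->
  h n @[n --> \oo] --> (0 : R)^'+ ->
  wintegrable mu w (fun z => alpha z ^+ 2) /\
  wint mu w (fun z => X (h n) z ^+ 2) / (h n `^ nu) ^+ 2 @[n --> \oo] -->
  wint mu w (fun z => alpha z ^+ 2).
Proof.
move=> h01 h_cvg.
have h0 n : 0 < h n by case/andP: (h01 n).
pose g n z := (X (h n) z / (h n `^ nu)) ^+ 2.
have g_ge0 n z : 0 <= g n z by exact: sqr_ge0.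
have mg n : measurable_fun setT (g n).
  by apply: measurable_funX; apply: measurable_funM => //; exact: mX.
have g_cvg z : g n z @[n --> \oo] --> alpha z ^+ 2.
  apply: (@cvg_comp _ _ _ (fun n => X (h n) z / (h n `^ nu)) (fun x => x ^+ 2) _ (nbhs (alpha z))).
    exact: cvg_scaled_error.
  exact: exprn_continuous.
have malpha : measurable_fun setT (fun z => alpha z ^+ 2).
  exact: (measurable_fun_cvg mg (fun z _ => g_cvg z)).
have g_ub n z : g n z <= 1 + D z.
  rewrite /g -real_normK ?num_real// normrM normfV (ger0_norm (powR_ge0 _ _)).
  apply: le_trans (ler_1cube _ _) _ => //; first by rewrite divr_ge0 ?powR_ge0.
  by rewrite lerD2l expr_div_n ler_pdivrMr ?exprn_gt0 ?powR_gt0//; exact: D_ub.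
have dom : mu.-integrable setT (fun z => ((1 + D z) * w z)%:E).
  have i1 := integrable_boltzmann V_int; have := integrableD measurableT i1 D_int.
  by apply: eq_integrable => // z _; rewrite /= mulrDl mul1r.
have mgw n : measurable_fun setT (fun z => (g n z * w z)%:E).
  by apply/measurable_EFinP; exact: measurable_funM.
have maw : measurable_fun setT (fun z => (alpha z ^+ 2 * w z)%:E).
  by apply/measurable_EFinP; exact: measurable_funM.
have g_ae : {ae mu, forall z, setT z ->
    (g n z * w z)%:E @[n --> \oo] --> (alpha z ^+ 2 * w z)%:E}.
  by apply: aeW => z _; apply: cvg_EFin; [exact: nearW|apply: cvgM => //; exact: cvg_cst].
have g_dom : {ae mu, forall z n, setT z ->
    (`|(g n z * w z)%:E| <= ((1 + D z) * w z)%:E)%E}.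
  apply: aeW => z n _; rewrite lee_fin ger0_norm ?(mulr_ge0 (g_ge0 _ _) (w0 _))//.
  exact: ler_wpM2r.
have [int_a _ +] := @dominated_convergence _ _ _ mu setT measurableT
  (fun n z => (g n z * w z)%:E) (fun z => (alpha z ^+ 2 * w z)%:E)
  (fun z => ((1 + D z) * w z)%:E) mgw maw g_ae dom g_dom.
have int_g n : wintegrable mu w (g n).
  apply: (le_integrable measurableT (mgw n) _ dom) => z _; rewrite /= lee_fin ger0_norm ?(mulr_ge0 (g_ge0 _ _) (w0 _))//.
  by apply: le_trans (ler_norm _); exact: ler_wpM2r.
rewrite (wint_EFin int_a) => g_int; split => //.
move: g_int => /fine_cvg; apply: cvg_trans; apply: near_eq_cvg; apply: nearW => n /=.
rewrite (wint_EFin (int_g n)) /=.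
have hn0 : 0 < (h n `^ nu) ^+ 2 by rewrite exprn_gt0// powR_gt0.
apply: (mulfI (lt0r_neq0 hn0)); rewrite -(wintZ _ (int_g n)) [RHS]mulrC divfK ?gt_eqF//.
by apply: eq_Rintegral => z _; rewrite /g expr_div_n [_ * (_ / _)]mulrC divfK ?gt_eqF.
Qed.

End limit_theorem.

Lemma near_eq_cvg_to (R : realType) (f g : nat -> R) (l : R) :
  (\forall n \near \oo, f n = g n) -> f n @[n --> \oo] --> l -> g n @[n --> \oo] --> l.
Proof. by move=> fg; apply: cvg_trans; exact: near_eq_cvg. Qed.

Section limit_acceptance.
Context {R : realType} {m : nat}.
Local Notation phase := ('rV[R]_m * 'rV[R]_m)%type.
Local Notation mu := (lebesgue_rV m \x lebesgue_rV m)%E.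
Variables (V : 'rV[R]_m -> R) (psi : R -> phase -> phase).
Hypotheses (V_int : (lebesgue_rV m).-integrable setT (fun q => (expR (- V q))%:E))
  (psi_volume : volume_preserving psi) (psi_reversible : reversible psi).
Variables (nu ell : R) (alpha : phase -> R).
Hypotheses (nu_gt0 : 0 < nu) (ell_gt0 : 0 < ell) (cond1 : condition1 V psi nu alpha).

Local Notation X h := (fun z => energy_error V psi z h).
Local Notation w := (fun z => expR (- hamiltonian V z)).
Local Notation Z := (partition_value V).
Local Notation step := (step_size nu ell).

Let Z0 : 0 < Z := partition_value_gt0 V_int.

Variable D : phase -> R.
Hypotheses (D_int : wintegrable mu w D)
  (D_ub : forall h z, 0 < h <= 1 -> `|X h z| ^+ 3 <= D z * (h `^ nu) ^+ 3).

Lemma cvg_natrV : n%:R^-1 @[n --> \oo] --> (0 : R).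
Proof. by rewrite -cvg_shiftS; exact: cvg_harmonic. Qed.

Lemma step_size_le1 : \forall n \near \oo, (0 < n)%N /\ 0 < step n <= 1.
Proof.
near=> n; split; first by near: n; exact: nbhs_infty_gt.
have /andP[-> /ltW->] : 0 < step n < 1 by near: n; exact: step_size_lt.
by [].
Unshelve. all: by end_near. Qed.

Lemma cvg_total_variance : wintegrable mu w (fun z => alpha z ^+ 2) /\
  n%:R * (wint mu w (fun z => X (step n) z ^+ 2) / Z) @[n --> \oo] -->
  (ell `^ nu) ^+ 2 * (wint mu w (fun z => alpha z ^+ 2) / Z).
Proof.
(* Domination is required for every n, so the finitely many steps outside ]0, 1] are replaced by
   1. *)
pose h n := if 0 < step n <= 1 then step n else 1.
have h01 n : 0 < h n <= 1 by rewrite /h; case: ifPn => // _; rewrite ltr01 lexx.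
have hE : \forall n \near \oo, step n = h n.
  by apply: filterS step_size_le1 => n [_ n1]; rewrite /h n1.
have h_cvg : h n @[n --> \oo] --> (0 : R)^'+.
  by apply: cvg_trans (step_size_cvg nu_gt0 ell_gt0); exact: near_eq_cvg.
have [alpha_int second] := cvg_second_moment V_int psi_volume psi_reversible
  cond1 D_int D_ub h01 h_cvg.
split => //; rewrite [Y in _ --> Y]mulrCA.
have {second} : wint mu w (fun z => X (h n) z ^+ 2) / (h n `^ nu) ^+ 2 *
    ((ell `^ nu) ^+ 2 / Z) @[n --> \oo] -->
    wint mu w (fun z => alpha z ^+ 2) * ((ell `^ nu) ^+ 2 / Z).
  by apply: cvgM second _; exact: cvg_cst.
apply: near_eq_cvg_to; near=> n.
have [n0 n1] : (0 < n)%N /\ 0 < step n <= 1 by near: n; exact: step_size_le1.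
have hn : step n = h n by near: n.
rewrite /= -hn step_size_powR// expr_div_n sqr_sqrtr//.
by field; rewrite pnatr_eq0 -lt0n n0 !gt_eqF// powR_gt0.
Unshelve. all: by end_near. Qed.

(** The bound D gives n h^(3 nu) E D, which is of order n^(-1/2). *)
Lemma cvg_total_third_moment :
  n%:R * (wint mu w (fun z => `|X (step n) z| ^+ 3) / Z) @[n --> \oo] --> 0.
Proof.
pose K := (ell `^ nu) ^+ 3 * (wint mu w D / Z).
have inv_sqrt_cvg : Num.sqrt (n%:R^-1) @[n --> \oo] --> (0 : R).
  rewrite -[Y in _ --> Y]sqrtr0.
  by apply: (continuous_cvg _ _ cvg_natrV); exact: sqrt_continuous.
have K_cvg : K * Num.sqrt (n%:R^-1) @[n --> \oo] --> 0.
  by rewrite -[Y in _ --> Y](mulr0 K); apply: cvgM => //; exact: cvg_cst.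
apply: (squeeze_cvgr _ (cvg_cst 0) K_cvg); near=> n.
have [n0 n1] : (0 < n)%N /\ 0 < step n <= 1 by near: n; exact: step_size_le1.
have I0 : 0 <= wint mu w (fun z => `|X (step n) z| ^+ 3).
  by apply: Rintegral_ge0 => z _; rewrite mulr_ge0 ?exprn_ge0 ?expR_ge0.
rewrite mulr_ge0 ?divr_ge0 ?(ltW Z0)//=.
have := wint_X3_le V_int psi_volume psi_reversible D_int D_ub n1.
have s0 : 0 < Num.sqrt n%:R :> R by rewrite sqrtr_gt0 ltr0n.
have sE : n%:R = Num.sqrt n%:R ^+ 2 :> R by rewrite sqr_sqrtr.
rewrite step_size_powR// sqrtrV// /K [Y in Y * (_ / Z)]sE => le3.
apply: le_trans (_ : Num.sqrt n%:R ^+ 2 *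
  ((ell `^ nu / Num.sqrt n%:R) ^+ 3 * wint mu w D / Z) <= _).
  by apply: ler_wpM2l; rewrite ?sqr_ge0// ler_pM2r ?invr_gt0.
rewrite le_eqVlt; apply/orP; left; apply/eqP.
by field; rewrite !gt_eqF.
Unshelve. all: by end_near. Qed.

(** With S n = n tau the convergent total variance, n tau^2 is S n * (S n / n), which tends to 0. *)
Lemma cvg_total_error (C : R) :
  n%:R * ((C + 1) * (wint mu w (fun z => `|X (step n) z| ^+ 3) / Z) +
    C * (wint mu w (fun z => X (step n) z ^+ 2) / Z) ^+ 2) @[n --> \oo] --> 0.
Proof.
have [_ S_cvg] := cvg_total_variance.
pose M3 n := n%:R * (wint mu w (fun z => `|X (step n) z| ^+ 3) / Z).
pose S n := n%:R * (wint mu w (fun z => X (step n) z ^+ 2) / Z).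
pose s := (ell `^ nu) ^+ 2 * (wint mu w (fun z => alpha z ^+ 2) / Z).
have : (C + 1) * M3 n + C * (S n * (S n * n%:R^-1)) @[n --> \oo] -->
    (C + 1) * 0 + C * (s * (s * 0)).
  apply: cvgD; apply: cvgM; try exact: cvg_cst; first exact: cvg_total_third_moment.
  by apply: (cvgM S_cvg); apply: (cvgM S_cvg); exact: cvg_natrV.
rewrite !mulr0 addr0; apply: near_eq_cvg_to; near=> n.
have n0 : (0 < n)%N by near: n; exact: nbhs_infty_gt.
rewrite /M3 /S; field.
by rewrite pnatr_eq0 -lt0n n0 gt_eqF.
Unshelve. all: by end_near. Qed.

Variables (lambda : nat -> R) (psiM : R -> R -> phase -> phase).
Hypotheses (lambda_gt0 : forall i, 0 < lambda i)
  (psi_equivariant : equivariant psiM psi).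

Lemma mean_acceptance_cvg :
  mean_acceptance V lambda psiM n (step n) @[n --> \oo] -->
  (2 * Phi (- (Num.sqrt ((ell `^ nu) ^+ 2 *
    (wint mu w (fun z => alpha z ^+ 2) / Z)) / 2)))%:E.
Proof.
have [_ S_cvg] := cvg_total_variance.
have alpha0 : 0 <= wint mu w (fun z => alpha z ^+ 2) / Z.
  rewrite divr_ge0 ?(ltW Z0)//; apply: Rintegral_ge0 => z _.
  by rewrite mulr_ge0 ?sqr_ge0 ?expR_ge0.
set s := _ ^+ 2 * _ in S_cvg *.
have s0 : 0 <= s by rewrite mulr_ge0 ?sqr_ge0.
set c := 2 * Phi _.
pose S n := n%:R * (wint mu w (fun z => X (step n) z ^+ 2) / Z).
(* The 4 rho consist of rho for the smoothing, rho for the accumulated error and 2 rho for the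
   displacement of the final time. *)
suff bound (rho : R) : 0 < rho -> \forall n \near \oo, exists2 a,
    mean_acceptance V lambda psiM n (step n) = a%:E & `|a - c| <= 4 * rho.
  apply/fine_cvgP; split.
    by apply: filterS (bound 1 ltr01) => n [a aE _]; rewrite aE.
  apply/cvgrPdist_le => e e0; have e4 : 0 < e / 4 by rewrite divr_gt0.
  apply: filterS (bound _ e4) => n [a aE ac] /=; rewrite /step_size in aE.
  by rewrite aE /= distrC; apply: le_trans ac _; rewrite mulrC divfK.
move=> rho0; have [C C0 expansion] := smoothed_expansion rho0.
have rho2 : 0 < rho ^+ 2 by rewrite exprn_gt0.
near=> n.
have [n0 n1] : (0 < n)%N /\ 0 < step n <= 1.
  by near: n; exact: step_size_le1.
have h0 : 0 < step n by case/andP: n1.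
have [a aE ac] := acceptance_bound V_int lambda_gt0 psi_volume psi_reversible
  psi_equivariant h0 (integrable_X3 V_int psi_volume psi_reversible D_int D_ub n1)
  n rho0 C0 expansion.
exists a => //.
have Sn : `|s - S n| <= rho ^+ 2.
  near: n; move/cvgrPdist_le : S_cvg; exact.
have en : `|0 - n%:R * ((C + 1) * (wint mu w (fun z => `|X (step n) z| ^+ 3) / Z) +
    C * (wint mu w (fun z => X (step n) z ^+ 2) / Z) ^+ 2)| <= rho.
  by near: n; move/cvgrPdist_le : (cvg_total_error C); exact.
have Sn0 : 0 <= rho ^+ 2 + S n.
  rewrite addr_ge0 ?(ltW rho2)// mulr_ge0// divr_ge0 ?(ltW Z0)//.
  by apply: Rintegral_ge0 => z _; rewrite mulr_ge0 ?sqr_ge0 ?expR_ge0.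
have phi_close : `|2 * Phi (- (Num.sqrt (rho ^+ 2 + S n) / 2)) - c| <= 2 * rho.
  rewrite -mulrBr normrM ger0_norm//.
  (* The times differ by at most 2 rho^2, so the square root is at most 2 rho. *)
  apply: le_trans (_ : 2 * (2^-1 * Num.sqrt `|rho ^+ 2 + S n - s|) <= _).
    rewrite ler_pM2l//; apply: le_trans (Phi_lipschitz _ _) _.
    rewrite opprK addrC -mulrBl normrM [`|2^-1|]ger0_norm// mulrC ler_pM2l//.
    by rewrite distrC; exact: sqrt_dist.
  rewrite mulrA divff// mul1r -(ger0_norm (_ : 0 <= 2 * rho)) ?mulr_ge0 ?(ltW rho0)//.
  rewrite -[`|2 * rho|]sqrtr_sqr ler_wsqrtr// exprMn.
  move: Sn; rewrite !ler_norml => /andP[Sn1 Sn2]; by apply/andP; split; have := rho2; lra.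
move: en; rewrite sub0r normrN => /(le_trans (ler_norm _)) en.
rewrite -(subrKA (2 * Phi (- (Num.sqrt (rho ^+ 2 + S n) / 2)))).
apply: le_trans (ler_normD _ _) _; apply: le_trans (lerD ac phi_close) _.
by move: en; lra.
Unshelve. all: by end_near. Qed.

End limit_acceptance.

Theorem theorem3p5 (R : realType) (m : nat) (V : 'rV[R]_m -> R)
  (V_diff : forall q, differentiable V q)
  (V_int : (lebesgue_rV m).-integrable setT (fun q => (expR (- V q))%:E))
  (lambda : nat -> R) (lambda_gt0 : forall i, 0 < lambda i)
  (psi : R -> 'rV[R]_m * 'rV[R]_m -> 'rV[R]_m * 'rV[R]_m)
  (psiM : R -> R -> 'rV[R]_m * 'rV[R]_m -> 'rV[R]_m * 'rV[R]_m)
  (psi_integrator : integrator V psi)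
  (psi_volume : volume_preserving psi)
  (psi_reversible : reversible psi)
  (psi_equivariant : equivariant psiM psi)
  (nu : R) (nu_gt0 : 0 < nu) (alpha : 'rV[R]_m * 'rV[R]_m -> R)
  (cond1 : condition1 V psi nu alpha)
  (cond2 : condition2 V psi nu)
  (ell : R) (ell_gt0 : 0 < ell) :
  let Sigma := fine (gibbs_mean lebesgue_phase (hamiltonian V)
                       (fun z => alpha z ^+ 2)) in
  mean_acceptance V lambda psiM d (ell / d%:R `^ (1 / (2 * nu)))
    @[d --> \oo] -->
  (2%:E * normal_prob 0 1 `]-oo, (- (ell `^ nu * Num.sqrt Sigma / 2))%R])%E.
Proof.
move=> Sigma; have [D D_gibbs D_sup] := cond2.
pose w z := expR (- hamiltonian V z).
pose Z := partition_value V.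
have Z0 : 0 < Z := partition_value_gt0 V_int.
have gibbsE z : gibbs_pdf (@lebesgue_phase R m) (hamiltonian V) z = w z / Z by [].
have D_int : wintegrable (lebesgue_rV m \x lebesgue_rV m)%E w D.
  have := integrableZl measurableT Z D_gibbs; apply: eq_integrable => // z _.
  by rewrite /= gibbsE; congr _%:E; field; rewrite gt_eqF.
(* The supremum in [condition2] is unfolded into a bound free of division. *)
have D_ub h z : 0 < h <= 1 -> `|energy_error V psi z h| ^+ 3 <= D z * (h `^ nu) ^+ 3.
  move=> h01; have h0 : 0 < h by case/andP: h01.
  rewrite -ler_pdivrMr ?exprn_gt0 ?powR_gt0// -powR_mulrn ?powR_ge0// -powRrM [nu * _]mulrC.
  rewrite -lee_fin; apply: le_trans (D_sup z); apply: ereal_sup_ubound.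
  by exists h; rewrite //= in_itv.
(* Integrability of alpha^2 is what allows the constant 1 / Z to leave the integral defining
   [Sigma]. *)
have [alpha_int _] :=
  cvg_total_variance V_int psi_volume psi_reversible nu_gt0 ell_gt0 cond1 D_int D_ub.
have SigmaE : Sigma = wint (lebesgue_rV m \x lebesgue_rV m)%E w (fun z => alpha z ^+ 2) / Z.
  rewrite /Sigma /gibbs_mean mulrC -wintZ//.
  by congr fine; apply: eq_integral => z _; rewrite gibbsE; congr _%:E; ring.
pose s := (ell `^ nu) ^+ 2 * Sigma.
have sqrt_s : Num.sqrt s = ell `^ nu * Num.sqrt Sigma.
  by rewrite sqrtrM ?sqr_ge0// sqrtr_sqr ger0_norm ?powR_ge0.
rewrite -Phi_fin -EFinM -sqrt_s /s SigmaE.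
exact: (mean_acceptance_cvg V_int psi_volume psi_reversible nu_gt0 ell_gt0 cond1
  D_int D_ub lambda_gt0 psi_equivariant).
Qed.
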